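(* Let $X$ be a topological space, $\mathcal{O}_B$ a sheaf of $\mathbf{Q}$-algebras on $X$ and $\mathcal{O}_X$ a sheaf of $\mathcal{O}_B$-algebras. Let $\mathcal{F}$ be a sheaf of $\mathcal{O}_X$-modules and $D\colon\mathcal{O}_X\to\mathcal{F}$ an $\mathcal{O}_B$-derivation. Let $h$ and $h'$ be iterated Hasse derivations of $\mathcal{F}$ extending $D$. If $D$ is integrable, then $h$ and $h'$ are equivalent. Furthermore, if (in addition) $\nu D(\mathcal{O}_X)\neq0$ for every nonzero $\mathcal{O}_X$-linear map $\nu\colon\mathcal{F}\to\mathcal{S}(\mathcal{F})$, then $h$ and $h'$ are canonically equivalent.
   Context: All rings are commutative $\mathbf{Q}$-algebras, apart from the tensor algebra $\mathcal{T}(\mathcal{F})$ and its quotients $\mathcal{R}(\mathcal{F})$, $\mathcal{A}(\mathcal{F})$ below. Tensor products are over $\mathcal{O}_X$. Tensor operations. For $n\ge 0$ let $\mathcal{T}^n(\mathcal{F})$, $\mathcal{S}^n(\mathcal{F})$, $\mathcal{A}^n(\mathcal{F})$ be the $n$-th tensor, symmetric and exterior powers of $\mathcal{F}$ over $\mathcal{O}_X$, with $\mathcal{T}(\mathcal{F})=\prod_{n\ge0}\mathcal{T}^n(\mathcal{F})$ and $\mathcal{S}(\mathcal{F})=\prod_{n\ge0}\mathcal{S}^n(\mathcal{F})$ (direct products). Set $\mathcal{R}^0(\mathcal{F}):=\mathcal{O}_X$, $\mathcal{R}^n(\mathcal{F}):=\mathcal{S}^{n-1}(\mathcal{F})\otimes\mathcal{F}$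 for $n\ge1$ (so $\mathcal{R}^1(\mathcal{F})=\mathcal{F}$, $\mathcal{R}^2(\mathcal{F})=\mathcal{T}^2(\mathcal{F})$), and $\mathcal{R}(\mathcal{F}):=\prod_{n\ge0}\mathcal{R}^n(\mathcal{F})$, naturally a graded $\mathcal{O}_X$-algebra quotient of $\mathcal{T}(\mathcal{F})$; $\mathcal{S}(\mathcal{F})$ is naturally a quotient of $\mathcal{R}(\mathcal{F})$, and a section of $\mathcal{R}^n(\mathcal{F})$ and its image in $\mathcal{S}^n(\mathcal{F})$ are denoted by the same symbol. $D$-connections. A $D$-connection is a map of $\mathcal{O}_B$-modules $\gamma\colon\mathcal{F}\to\mathcal{T}^2(\mathcal{F})$ with $\gamma(am)=D(a)\otimes m+a\gamma(m)$ for all local sections $a$ of $\mathcal{O}_X$ and $m$ of $\mathcal{F}$. It is flat if $\gamma D(\mathcal{O}_X)$ lies in the kernel $\mathcal{K}^2(\mathcal{F})$ of $\mathcal{T}^2(\mathcal{F})\to\mathcal{A}^2(\mathcal{F})$. The derivation $D$ is integrable if there exists a flat $D$-connection (on $X$). Extended $D$-connections. An extended $D$-connection is a map of $\mathcal{O}_B$-modules $T=(T_0,T_1,\dots)\colon\mathcal{F}\to\prod_{i=0}^\infty\mathcal{R}^{i+1}(\mathcal{F})$ such that $T_0=\mathrm{id}_{\mathcal{F}}$ and, for each $i\ge1$ and all local sections $a$ of $\mathcal{O}_X$ and $m$ of $\mathcal{F}$, $$T_i(am)=aT_i(m)+\sum_{j=1}^i\frac1j\,T_{j-1}D(a)\,T_{i-j}(m),$$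 with products in $\mathcal{R}(\mathcal{F})$. Hasse derivations. A Hasse derivation of $\mathcal{F}$ is a map of $\mathcal{O}_B$-algebras $h=(h_0,h_1,\dots)\colon\mathcal{O}_X\to\prod_{i=0}^\infty\mathcal{S}^i(\mathcal{F})=\mathcal{S}(\mathcal{F})$ with $h_0=\mathrm{id}_{\mathcal{O}_X}$. It extends $D$ if $h_1=D$. A Hasse derivation $h$ extending $D$ is iterated if there is an extended $D$-connection $T$ such that, for each $i\ge1$, $h_i(a)$ is the class of $(1/i)T_{i-1}D(a)$ in $\mathcal{S}^i(\mathcal{F})$ for all local sections $a$ of $\mathcal{O}_X$. Equivalence. The $\mathcal{O}_X$-algebra automorphisms $\phi$ of $\mathcal{S}(\mathcal{F})$ considered are those given by homogeneous parts and not decreasing degrees: $\phi=\sum_{q\ge0}\phi_q$ with $\phi_q$ homogeneous of degree $q$, i.e. there are $\mathcal{O}_X$-linear maps $\phi_q\colon\mathcal{S}^p(\mathcal{F})\to\mathcal{S}^{p+q}(\mathcal{F})$ ($p,q\ge0$) such that the degree-$n$ component of $\phi((\omega_p)_{p\ge0})$ is $\sum_{p=0}^n\phi_{n-p}(\omega_p)$. Two Hasse derivations $h,h'$ of $\mathcal{F}$ are equivalent if there is such an automorphism $\phi$ with $\phi_0|_{\mathcal{F}}=\mathrm{id}_{\mathcal{F}}$ and $h'=\phi h$ (composition). They are canonically equivalent when there is exactly one such automorphism $\phi$. *)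

(* Defs.v *)
From HB Require Import structures.
From mathcomp Require Import all_boot perm all_algebra.
From mathcomp Require Import boolp classical_sets topology_structure.

Set Implicit Arguments.
Unset Strict Implicit.
Unset Printing Implicit Defensive.

Import GRing.Theory.
Local Open Scope classical_set_scope.
Local Open Scope ring_scope.
Local Open Scope quotient_scope.

Definition semilinear (A B : comPzRingType) (M : lmodType A) (M' : lmodType B)
    (rho : A -> B) (r : M -> M') : Prop :=
  forall a m m', r (a *: m + m') = rho a *: r m + r m'.

Inductive lcomb (A G : Type) : Type :=
| LCzero
| LCadd of lcomb A G & lcomb A G
| LCscale of A & lcomb A G
| LCgen of G.
Arguments LCzero {A G}.
Arguments LCgen {A G}.

HB.instance Definition _ A G := gen_eqMixin (lcomb A G).
HB.instance Definition _ A G := gen_choiceMixin (lcomb A G).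

Section Presentation.
Variables (A : comPzRingType) (G : Type).
Local Notation L := (lcomb A G).
Local Notation add := (@LCadd A G).
Local Notation scl := (@LCscale A G).
Variable rel : L -> L -> Prop.

(* pmod below is the A-module with generators G and relations rel: formal linear
   combinations modulo the smallest congruence that contains rel and satisfies
   the module axioms. *)
Inductive lcong : L -> L -> Prop :=
| LCrel s t : rel s t -> lcong s t
| LCrefl s : lcong s s
| LCsym s t : lcong s t -> lcong t s
| LCtrans s t u : lcong s t -> lcong t u -> lcong s u
| LCcongD s s' t t' : lcong s s' -> lcong t t' -> lcong (add s t) (add s' t')
| LCcongZ a s s' : lcong s s' -> lcong (scl a s) (scl a s')
| LCaddA s t u : lcong (add s (add t u)) (add (add s t) u)
| LCaddC s t : lcong (add s t) (add t s)
| LCadd0 s : lcong (add LCzero s) s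
| LCscale0 s : lcong (scl 0 s) LCzero
| LCscale1 s : lcong (scl 1 s) s
| LCscaleA a b s : lcong (scl a (scl b s)) (scl (a * b) s)
| LCscaleDr a s t : lcong (scl a (add s t)) (add (scl a s) (scl a t))
| LCscaleDl a b s : lcong (scl (a + b) s) (add (scl a s) (scl b s)).

Definition lcongb (s t : L) : bool := `[< lcong s t >].

Lemma lcongb_equiv : equiv_class_of lcongb.
Proof.
split=> [s|s t|t s u].
- by apply/asboolP; exact: LCrefl.
- by apply/asboolP/asboolP => /LCsym.
- by move=> /asboolP st /asboolP tu; apply/asboolP; exact: LCtrans st tu.
Qed.

Canonical lcongb_equivRel := EquivRelPack lcongb_equiv.
Canonical lcongb_encModRel := defaultEncModRel lcongb.

Definition pmod := {eq_quot lcongb}.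
HB.instance Definition _ := Choice.on pmod.

Definition pcls (s : L) : pmod := \pi_pmod s.

Lemma pclsP s t : pcls s = pcls t <-> lcong s t.
Proof.
split; first by move/eqmodP/asboolP.
by move=> st; apply/eqmodP/asboolP.
Qed.

Lemma pcls_repr x : pcls (repr x) = x.
Proof. exact: reprK. Qed.

Lemma pcls_surj x : exists s, x = pcls s.
Proof. by exists (repr x); rewrite pcls_repr. Qed.

Definition pzero : pmod := pcls LCzero.
Definition padd (x y : pmod) : pmod := pcls (add (repr x) (repr y)).
Definition pscale (a : A) (x : pmod) : pmod := pcls (scl a (repr x)).
Definition popp (x : pmod) : pmod := pscale (-1) x.

Lemma repr_pcls s : lcong (repr (pcls s)) s.
Proof. by apply/pclsP; rewrite pcls_repr. Qed.

Lemma padd_cls s t : padd (pcls s) (pcls t) = pcls (add s t).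
Proof. by apply/pclsP/LCcongD; exact: repr_pcls. Qed.

Lemma pscale_cls a s : pscale a (pcls s) = pcls (scl a s).
Proof. by apply/pclsP/LCcongZ; exact: repr_pcls. Qed.

Fact paddA : associative padd.
Proof.
move=> x y z; have [s ->] := pcls_surj x; have [t ->] := pcls_surj y.
by have [u ->] := pcls_surj z; rewrite !padd_cls; apply/pclsP/LCaddA.
Qed.

Fact paddC : commutative padd.
Proof.
move=> x y; have [s ->] := pcls_surj x; have [t ->] := pcls_surj y.
by rewrite !padd_cls; apply/pclsP/LCaddC.
Qed.

Fact padd0 : left_id pzero padd.
Proof. by move=> x; have [s ->] := pcls_surj x; rewrite padd_cls; apply/pclsP/LCadd0. Qed.

Fact paddN : left_inverse pzero popp padd.
Proof.
move=> x; have [s ->] := pcls_surj x; rewrite /popp pscale_cls padd_cls.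
apply/pclsP/(LCtrans _ (LCscale0 s)); apply: LCsym.
rewrite -[in X in lcong X _](addNr 1); apply: LCtrans (LCscaleDl _ _ _) _.
by apply: LCcongD (LCrefl _) (LCscale1 _).
Qed.

HB.instance Definition _ :=
  GRing.isZmodule.Build pmod paddA paddC padd0 paddN.

Lemma pclsD s t : pcls (add s t) = pcls s + pcls t.
Proof. by rewrite -padd_cls. Qed.

Fact pscaleA a b x : pscale a (pscale b x) = pscale (a * b) x.
Proof. by have [s ->] := pcls_surj x; rewrite !pscale_cls; apply/pclsP/LCscaleA. Qed.

Fact pscale1 : left_id 1 pscale.
Proof. by move=> x; have [s ->] := pcls_surj x; rewrite pscale_cls; apply/pclsP/LCscale1. Qed.

Fact pscaleDr : right_distributive pscale +%R.
Proof.
move=> a x y; have [s ->] := pcls_surj x; have [t ->] := pcls_surj y.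
by rewrite -pclsD !pscale_cls -pclsD; apply/pclsP/LCscaleDr.
Qed.

Fact pscaleDl x : {morph pscale^~ x : a b / a + b}.
Proof.
move=> a b; have [s ->] := pcls_surj x; rewrite !pscale_cls -pclsD.
exact/pclsP/LCscaleDl.
Qed.

HB.instance Definition _ :=
  GRing.Zmodule_isLmodule.Build A pmod pscaleA pscale1 pscaleDr pscaleDl.

Definition pgen (g : G) : pmod := pcls (LCgen g).

Lemma pcls0 : pcls LCzero = 0. Proof. by []. Qed.
Lemma pclsZ a s : pcls (scl a s) = a *: pcls s.
Proof. by rewrite -pscale_cls. Qed.

Lemma pmod_ind (P : pmod -> Prop) :
  P 0 -> (forall x y, P x -> P y -> P (x + y)) ->
  (forall a x, P x -> P (a *: x)) -> (forall g, P (pgen g)) ->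
  forall x, P x.
Proof.
move=> P0 PD PZ Pg x; have [s ->] := pcls_surj x.
elim: s => [|s Ps t Pt|a s Ps|g]; rewrite ?pcls0 ?pclsD ?pclsZ //.
- exact: PD.
- exact: PZ.
- exact: Pg.
Qed.

Section Lift.
Variables (B : comPzRingType) (N : lmodType B) (rho : A -> B) (f : G -> N).

Fixpoint leval (s : L) : N :=
  match s with
  | LCzero => 0
  | LCadd s t => leval s + leval t
  | LCscale a s => rho a *: leval s
  | LCgen g => f g
  end.

Definition plift (x : pmod) : N := leval (repr x).

End Lift.

Section LiftTheory.
Variables (B : comPzRingType) (N : lmodType B) (rho : {rmorphism A -> B}).
Variable f : G -> N.
Hypothesis frel : forall s t, rel s t -> leval rho f s = leval rho f t.

Lemma leval_cong s t : lcong s t -> leval rho f s = leval rho f t.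
Proof.
elim=> //=.
- by move=> s' t' u _ -> _ ->.
- by move=> ? ? ? ? _ -> _ ->.
- by move=> ? ? ? _ ->.
- by move=> *; rewrite addrA.
- by move=> *; rewrite addrC.
- by move=> *; rewrite add0r.
- by move=> *; rewrite rmorph0 scale0r.
- by move=> *; rewrite rmorph1 scale1r.
- by move=> *; rewrite scalerA rmorphM.
- by move=> *; rewrite scalerDr.
- by move=> *; rewrite rmorphD scalerDl.
Qed.

Lemma plift_cls s : plift rho f (pcls s) = leval rho f s.
Proof. by apply/leval_cong/repr_pcls. Qed.

Lemma plift_gen g : plift rho f (pgen g) = f g.
Proof. exact: plift_cls. Qed.

Lemma plift0 : plift rho f 0 = 0.
Proof. exact: (plift_cls LCzero). Qed.

Lemma pliftD x y : plift rho f (x + y) = plift rho f x + plift rho f y.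
Proof.
have [s ->] := pcls_surj x; have [t ->] := pcls_surj y.
by rewrite -pclsD !plift_cls.
Qed.

Lemma pliftZ a x : plift rho f (a *: x) = rho a *: plift rho f x.
Proof. by have [s ->] := pcls_surj x; rewrite -pclsZ !plift_cls. Qed.

End LiftTheory.
End Presentation.
Arguments pgen {A G} rel g.

Lemma semilinear0 (A B : comPzRingType) (M : lmodType A) (M' : lmodType B)
    (rho : {rmorphism A -> B}) (r : M -> M') : semilinear rho r -> r 0 = 0.
Proof. by move=> rP; move: (rP (-1) 0 0); rewrite scaler0 addr0 rmorphN1 scaleN1r addNr. Qed.

Lemma semilinearD (A B : comPzRingType) (M : lmodType A) (M' : lmodType B)
    (rho : {rmorphism A -> B}) (r : M -> M') : semilinear rho r -> {morph r : x y / x + y}.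
Proof. by move=> rP x y; move: (rP 1 x y); rewrite rmorph1 !scale1r. Qed.

Lemma semilinearZ (A B : comPzRingType) (M : lmodType A) (M' : lmodType B)
    (rho : {rmorphism A -> B}) (r : M -> M') a x :
  semilinear rho r -> r (a *: x) = rho a *: r x.
Proof. by move=> rP; rewrite -[a *: x]addr0 rP (semilinear0 rP) addr0. Qed.

Lemma pmod_eq (A B : comPzRingType) G rel (N : lmodType B)
    (rho : {rmorphism A -> B}) (f g : @pmod A G rel -> N) :
  semilinear rho f -> semilinear rho g ->
  (forall x, f (pgen rel x) = g (pgen rel x)) -> f =1 g.
Proof.
move=> fP gP fg x; elim/pmod_ind: x => [|x y Hx Hy|a x Hx|t].
- by rewrite (semilinear0 fP) (semilinear0 gP).
- by rewrite (semilinearD fP) (semilinearD gP) Hx Hy.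
- by rewrite (semilinearZ _ _ fP) (semilinearZ _ _ gP) Hx.
- exact: fg.
Qed.

Definition upd n (M : Type) (t : 'I_n -> M) (i : 'I_n) (m : M) : 'I_n -> M :=
  fun k => if k == i then m else t k.

Inductive tens_rel (A : comPzRingType) (M : lmodType A) n :
    lcomb A ('I_n -> M) -> lcomb A ('I_n -> M) -> Prop :=
| TensLin t i a m m' :
    tens_rel (LCgen (upd t i (a *: m + m')))
             (LCadd (LCscale a (LCgen (upd t i m))) (LCgen (upd t i m'))).

Inductive sym_rel (A : comPzRingType) (M : lmodType A) n :
    lcomb A ('I_n -> M) -> lcomb A ('I_n -> M) -> Prop :=
| SymTens s t : tens_rel s t -> sym_rel s t
| SymPerm (t : 'I_n -> M) (p : 'S_n) : sym_rel (LCgen (t \o p)) (LCgen t).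

Inductive alt_rel (A : comPzRingType) (M : lmodType A) n :
    lcomb A ('I_n -> M) -> lcomb A ('I_n -> M) -> Prop :=
| AltTens s t : tens_rel s t -> alt_rel s t
| AltEq (t : 'I_n -> M) i j : i != j -> t i = t j -> alt_rel (LCgen t) LCzero.

Inductive otimes_rel (A : comPzRingType) (M N : lmodType A) :
    lcomb A (M * N) -> lcomb A (M * N) -> Prop :=
| OtimesLinL a m m' n :
    otimes_rel (LCgen (a *: m + m', n))
               (LCadd (LCscale a (LCgen (m, n))) (LCgen (m', n)))
| OtimesLinR a m n n' :
    otimes_rel (LCgen (m, a *: n + n'))
               (LCadd (LCscale a (LCgen (m, n))) (LCgen (m, n'))).

Section TensorModules.
Variables (A : comPzRingType) (M N : lmodType A).

Definition tens_mod n : lmodType A := pmod (@tens_rel A M n).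
Definition sym_mod n : lmodType A := pmod (@sym_rel A M n).
Definition alt_mod n : lmodType A := pmod (@alt_rel A M n).
Definition otimes_mod : lmodType A := pmod (@otimes_rel A M N).

Definition tens_gen n (t : 'I_n -> M) : tens_mod n := pgen (@tens_rel A M n) t.
Definition sym_gen n (t : 'I_n -> M) : sym_mod n := pgen (@sym_rel A M n) t.
Definition alt_gen n (t : 'I_n -> M) : alt_mod n := pgen (@alt_rel A M n) t.
Definition otimes (m : M) (n : N) : otimes_mod := pgen (@otimes_rel A M N) (m, n).

Definition catf i j n (e : (i + j = n)%N) (s : 'I_i -> M) (t : 'I_j -> M) :
    'I_n -> M :=
  fun k => match split (cast_ord (esym e) k) with
           | inl a => s a
           | inr b => t b
           end.

Definition sym_mul i j n (e : (i + j = n)%N) (x : sym_mod i) (y : sym_mod j) :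
    sym_mod n :=
  plift idfun (fun s => plift idfun (fun t => sym_gen (catf e s t)) y) x.

Definition tens_to_alt n : tens_mod n -> alt_mod n := plift idfun (@alt_gen n).

Lemma tens_gen_lin n (t : 'I_n -> M) i a m m' :
  tens_gen (upd t i (a *: m + m')) =
  a *: tens_gen (upd t i m) + tens_gen (upd t i m').
Proof. by rewrite -pclsZ -pclsD; apply/pclsP/LCrel/TensLin. Qed.

Lemma sym_gen_lin n (t : 'I_n -> M) i a m m' :
  sym_gen (upd t i (a *: m + m')) =
  a *: sym_gen (upd t i m) + sym_gen (upd t i m').
Proof. by rewrite -pclsZ -pclsD; apply/pclsP/LCrel/SymTens/TensLin. Qed.

Lemma sym_gen_perm n (t : 'I_n -> M) (p : 'S_n) : sym_gen (t \o p) = sym_gen t.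
Proof. exact/pclsP/LCrel/SymPerm. Qed.

Lemma alt_gen_lin n (t : 'I_n -> M) i a m m' :
  alt_gen (upd t i (a *: m + m')) =
  a *: alt_gen (upd t i m) + alt_gen (upd t i m').
Proof. by rewrite -pclsZ -pclsD; apply/pclsP/LCrel/AltTens/TensLin. Qed.

Lemma alt_gen_eq n (t : 'I_n -> M) i j : i != j -> t i = t j -> alt_gen t = 0.
Proof. by move=> ij tij; apply/pclsP/LCrel/(AltEq ij). Qed.

Lemma otimesDl a m m' n : otimes (a *: m + m') n = a *: otimes m n + otimes m' n.
Proof. by rewrite -pclsZ -pclsD; apply/pclsP/LCrel/OtimesLinL. Qed.

Lemma otimesDr a m n n' : otimes m (a *: n + n') = a *: otimes m n + otimes m n'.
Proof. by rewrite -pclsZ -pclsD; apply/pclsP/LCrel/OtimesLinR. Qed.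

Lemma catf_updl i j n (e : (i + j = n)%N) s t k m :
  catf e (upd s k m) t = upd (catf e s t) (cast_ord e (lshift j k)) m.
Proof.
case: n / e; apply/funext => l; rewrite /catf /upd !cast_ord_id.
case: (split_ordP l) => a ->.
  by rewrite eq_lshift.
by rewrite eq_rlshift.
Qed.

Lemma catf_updr i j n (e : (i + j = n)%N) s t k m :
  catf e s (upd t k m) = upd (catf e s t) (cast_ord e (rshift i k)) m.
Proof.
case: n / e; apply/funext => l; rewrite /catf /upd !cast_ord_id.
case: (split_ordP l) => a ->.
  by rewrite eq_lrshift.
by rewrite eq_rshift.
Qed.

Definition catp_fun i j (p : 'S_i) (q : 'S_j) (k : 'I_(i + j)) : 'I_(i + j) :=
  match split k with inl a => lshift j (p a) | inr b => rshift i (q b) end.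

Lemma catp_inj i j p q : injective (@catp_fun i j p q).
Proof.
move=> k l; rewrite /catp_fun.
case: (split_ordP k) => a ->; case: (split_ordP l) => b -> //.
- by move/lshift_inj/perm_inj ->.
- by move/eqP; rewrite eq_lrshift.
- by move/eqP; rewrite eq_rlshift.
- by move/rshift_inj/perm_inj ->.
Qed.

Lemma catf_perm i j n (e : (i + j = n)%N) s t (p : 'S_i) (q : 'S_j) :
  exists r : 'S_n, catf e (s \o p) (t \o q) = catf e s t \o r.
Proof.
case: n / e; exists (perm (@catp_inj i j p q)).
apply/funext => l; rewrite /catf /= !cast_ord_id permE /catp_fun.
case: (split_ordP l) => a _.
  by case: split_ordP => b; [move/lshift_inj-> | move/eqP; rewrite eq_lrshift].
by case: split_ordP => b; [move/eqP; rewrite eq_rlshift | move/rshift_inj->].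
Qed.

Section SymMul.
Variables (i j n : nat) (e : (i + j = n)%N).

Let inner_rel (s : 'I_i -> M) u v : sym_rel u v ->
  leval idfun (fun t : 'I_j -> M => sym_gen (catf e s t)) u =
  leval idfun (fun t : 'I_j -> M => sym_gen (catf e s t)) v.
Proof.
case=> [_ _ [] t k a m m'|t p] /=.
  by rewrite !catf_updr sym_gen_lin.
have [r] := catf_perm e s t 1%g p.
rewrite (_ : s \o _ = s); first by move=> ->; rewrite sym_gen_perm.
by apply/funext => k /=; rewrite perm1.
Qed.

Let outer_rel (y : sym_mod j) u v : sym_rel u v ->
  leval idfun (fun s : 'I_i -> M =>
    plift idfun (fun t => sym_gen (catf e s t)) y) u =
  leval idfun (fun s : 'I_i -> M =>
    plift idfun (fun t => sym_gen (catf e s t)) y) v.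
Proof.
move=> uv; elim/pmod_ind: y => [|x y|b x|t].
- by case: uv => [_ _ []|] *; rewrite /= !(plift0 (@inner_rel _)) ?scaler0 ?addr0.
- case: uv => [_ _ []|] * /=; rewrite !(pliftD (@inner_rel _)); last by congr +%R.
  by rewrite scalerDr addrACA; congr +%R.
- case: uv => [_ _ []|] * /=; rewrite !(pliftZ (@inner_rel _)); last by congr *:%R.
  rewrite scalerA mulrC -scalerA -scalerDr; congr *:%R; assumption.
- case: uv => [_ _ [] s k a m m'|s p] /=; rewrite !(plift_gen (@inner_rel _)).
    by rewrite !catf_updl sym_gen_lin.
  have [r] := catf_perm e s t p 1%g.
  rewrite (_ : t \o _ = t); first by move=> ->; rewrite sym_gen_perm.
  by apply/funext => k /=; rewrite perm1.
Qed.

Lemma sym_mul_gen s t : sym_mul e (sym_gen s) (sym_gen t) = sym_gen (catf e s t).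
Proof. by rewrite /sym_mul (plift_gen (@outer_rel _)) (plift_gen (@inner_rel _)). Qed.

Lemma sym_mulDl x x' y : sym_mul e (x + x') y = sym_mul e x y + sym_mul e x' y.
Proof. exact: (pliftD (@outer_rel _)). Qed.

Lemma sym_mulZl a x y : sym_mul e (a *: x) y = a *: sym_mul e x y.
Proof. exact: (pliftZ (@outer_rel _)). Qed.

Lemma sym_mulDr x y y' : sym_mul e x (y + y') = sym_mul e x y + sym_mul e x y'.
Proof.
elim/pmod_ind: x => [|x x' Hx Hx'|a x Hx|s].
- by rewrite -(scale0r 0) !sym_mulZl !scale0r addr0.
- by rewrite !sym_mulDl Hx Hx' addrACA.
- by rewrite !sym_mulZl Hx scalerDr.
- by rewrite /sym_mul !(plift_gen (@outer_rel _)) (pliftD (@inner_rel _)).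
Qed.

Lemma sym_mulZr a x y : sym_mul e x (a *: y) = a *: sym_mul e x y.
Proof.
elim/pmod_ind: x => [|x x' Hx Hx'|b x Hx|s].
- by rewrite -(scale0r 0) !sym_mulZl !scale0r scaler0.
- by rewrite !sym_mulDl Hx Hx' scalerDr.
- by rewrite !sym_mulZl Hx scalerA mulrC -scalerA.
- by rewrite /sym_mul !(plift_gen (@outer_rel _)) (pliftZ (@inner_rel _)).
Qed.

End SymMul.

Lemma tens_to_alt_rel n u v : tens_rel u v ->
  leval idfun (@alt_gen n) u = leval idfun (@alt_gen n) v.
Proof. by case=> t k a m m' /=; rewrite alt_gen_lin. Qed.

Lemma tens_to_altP n : semilinear idfun (@tens_to_alt n).
Proof.
by move=> a x y; rewrite /tens_to_alt (pliftD (@tens_to_alt_rel n)) (pliftZ (@tens_to_alt_rel n)).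
Qed.

Lemma tens_to_alt_gen n (t : 'I_n -> M) : tens_to_alt (tens_gen t) = alt_gen t.
Proof. exact: (plift_gen (@tens_to_alt_rel n)). Qed.

End TensorModules.

Section TensorMap.
Variables (A B : comPzRingType) (M N : lmodType A) (M' N' : lmodType B).
Variables (rho : A -> B) (r : M -> M') (r' : N -> N').

Definition tens_map n : tens_mod M n -> tens_mod M' n :=
  plift rho (fun t => tens_gen (r \o t)).
Definition sym_map n : sym_mod M n -> sym_mod M' n :=
  plift rho (fun t => sym_gen (r \o t)).
Definition alt_map n : alt_mod M n -> alt_mod M' n :=
  plift rho (fun t => alt_gen (r \o t)).
Definition otimes_map : otimes_mod M N -> otimes_mod M' N' :=
  plift rho (fun p => otimes (r p.1) (r' p.2)).

End TensorMap.

Section TensorMapTheory.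
Variables (A B : comPzRingType) (M N : lmodType A) (M' N' : lmodType B).
Variables (rho : {rmorphism A -> B}) (r : M -> M') (r' : N -> N').
Hypotheses (rZ : semilinear rho r) (rZ' : semilinear rho r').

Let comp_upd n (t : 'I_n -> M) i m : r \o upd t i m = upd (r \o t) i (r m).
Proof. by apply/funext => k; rewrite /upd /=; case: eqP. Qed.

Fact tens_map_rel n u v : tens_rel u v ->
  leval rho (fun t : 'I_n -> M => tens_gen (r \o t)) u =
  leval rho (fun t : 'I_n -> M => tens_gen (r \o t)) v.
Proof. by case=> t i a m m' /=; rewrite !comp_upd rZ tens_gen_lin. Qed.

Fact sym_map_rel n u v : sym_rel u v ->
  leval rho (fun t : 'I_n -> M => sym_gen (r \o t)) u =
  leval rho (fun t : 'I_n -> M => sym_gen (r \o t)) v.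
Proof.
case=> [_ _ [] t i a m m'|t p] /=; first by rewrite !comp_upd rZ sym_gen_lin.
exact: (sym_gen_perm (r \o t)).
Qed.

Fact alt_map_rel n u v : alt_rel u v ->
  leval rho (fun t : 'I_n -> M => alt_gen (r \o t)) u =
  leval rho (fun t : 'I_n -> M => alt_gen (r \o t)) v.
Proof.
case=> [_ _ [] t i a m m'|t i j ij tij] /=; first by rewrite !comp_upd rZ alt_gen_lin.
by rewrite (alt_gen_eq ij) //= tij.
Qed.

Fact otimes_map_rel u v : otimes_rel u v ->
  leval rho (fun p : M * N => otimes (r p.1) (r' p.2)) u =
  leval rho (fun p : M * N => otimes (r p.1) (r' p.2)) v.
Proof. by case=> [a m m' n|a m n n'] /=; rewrite ?rZ ?rZ' ?otimesDl ?otimesDr. Qed.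

Lemma tens_map_gen n (t : 'I_n -> M) : tens_map rho r (tens_gen t) = tens_gen (r \o t).
Proof. exact: (plift_gen (@tens_map_rel n)). Qed.
Lemma sym_map_gen n (t : 'I_n -> M) : sym_map rho r (sym_gen t) = sym_gen (r \o t).
Proof. exact: (plift_gen (@sym_map_rel n)). Qed.
Lemma alt_map_gen n (t : 'I_n -> M) : alt_map rho r (alt_gen t) = alt_gen (r \o t).
Proof. exact: (plift_gen (@alt_map_rel n)). Qed.
Lemma otimes_map_gen m n : otimes_map rho r r' (otimes m n) = otimes (r m) (r' n).
Proof. exact: (plift_gen otimes_map_rel). Qed.

Lemma tens_mapP n : semilinear rho (@tens_map A B M M' rho r n).
Proof. by move=> a x y; rewrite /tens_map (pliftD (@tens_map_rel n)) (pliftZ (@tens_map_rel n)). Qed.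
Lemma sym_mapP n : semilinear rho (@sym_map A B M M' rho r n).
Proof. by move=> a x y; rewrite /sym_map (pliftD (@sym_map_rel n)) (pliftZ (@sym_map_rel n)). Qed.
Lemma alt_mapP n : semilinear rho (@alt_map A B M M' rho r n).
Proof. by move=> a x y; rewrite /alt_map (pliftD (@alt_map_rel n)) (pliftZ (@alt_map_rel n)). Qed.
Lemma otimes_mapP : semilinear rho (otimes_map rho r r').
Proof. by move=> a x y; rewrite /otimes_map (pliftD otimes_map_rel) (pliftZ otimes_map_rel). Qed.

Lemma sym_map_mul i j n (e : (i + j = n)%N) x y :
  sym_map rho r (sym_mul e x y) = sym_mul e (sym_map rho r x) (sym_map rho r y).
Proof.
have mulP (C : comPzRingType) (P : lmodType C) (u : sym_mod P i) :
    semilinear idfun (sym_mul e u : sym_mod P j -> _).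
  by move=> a v w; rewrite sym_mulDr sym_mulZr.
have mulPl (C : comPzRingType) (P : lmodType C) (v : sym_mod P j) :
    semilinear idfun (fun u : sym_mod P i => sym_mul e u v).
  by move=> a u w; rewrite sym_mulDl sym_mulZl.
apply: (@pmod_eq _ _ _ _ _ rho (fun x => sym_map rho r (sym_mul e x y))
  (fun x => sym_mul e (sym_map rho r x) _)).
- by move=> a u v; rewrite mulPl sym_mapP.
- by move=> a u v; rewrite sym_mapP mulPl.
move=> s; apply: (@pmod_eq _ _ _ _ _ rho (fun y => sym_map rho r (sym_mul e _ y))
  (fun y => sym_mul e _ (sym_map rho r y))).
- by move=> a u v; rewrite mulP sym_mapP.
- by move=> a u v; rewrite sym_mapP mulP.
move=> t; rewrite -!/(sym_gen _) sym_mul_gen !sym_map_gen sym_mul_gen.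
by congr sym_gen; apply/funext => k; rewrite /catf /=; case: split.
Qed.

Lemma alt_map_tens n (x : tens_mod M n) :
  alt_map rho r (tens_to_alt x) = tens_to_alt (tens_map rho r x).
Proof.
apply: (@pmod_eq _ _ _ _ _ rho (fun x => alt_map rho r (tens_to_alt x))
  (fun x => tens_to_alt (tens_map rho r x))).
- by move=> a u v; rewrite tens_to_altP alt_mapP.
- by move=> a u v; rewrite tens_mapP tens_to_altP.
- by move=> t; rewrite -/(tens_gen _) tens_map_gen !tens_to_alt_gen alt_map_gen.
Qed.

End TensorMapTheory.

Record opens (X : topologicalType) := Opens { opset :> set X; opensP : open opset }.

Section Sheaves.
Variable X : topologicalType.
Implicit Types U V W : opens X.

Definition opsub V U : Prop := opset V `<=` opset U.

Definition opI U V : opens X := Opens (openI (opensP U) (opensP V)).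

Lemma opsub_refl U : opsub U U. Proof. by []. Qed.
Lemma opsub_trans U V W : opsub V U -> opsub W V -> opsub W U.
Proof. by move=> h k x /k /h. Qed.
Lemma opIl U V : opsub (opI U V) U. Proof. by move=> x []. Qed.
Lemma opIr U V : opsub (opI U V) V. Proof. by move=> x []. Qed.

Definition is_sheaf (F : opens X -> Type)
    (res : forall U V, opsub V U -> F U -> F V) : Prop :=
  forall (I : Type) U (V : I -> opens X)
    (VU : forall i, opsub (V i) U) (s : forall i, F (V i)),
  (forall x, opset U x -> exists i, opset (V i) x) ->
  (forall i j W (Wi : opsub W (V i)) (Wj : opsub W (V j)),
     res (V i) W Wi (s i) = res (V j) W Wj (s j)) ->
  exists! t : F U, forall i, res U (V i) (VU i) t = s i.

(* A sheaf of commutative Q-algebras. The rings are in comPzRingType, which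
   allows the zero ring: the sections over the empty set form the zero ring.
   The morphisms aQ are unique, hence compatible with the restrictions. *)
Record algSheaf := AlgSheaf {
  asec :> opens X -> comPzRingType;
  ares : forall U V, opsub V U -> {rmorphism asec U -> asec V};
  aQ : forall U, {rmorphism rat -> asec U};
  ares_id : forall U (h : opsub U U) a, ares h a = a;
  ares_comp : forall U V W (h : opsub V U) (k : opsub W V) (l : opsub W U) a,
    ares k (ares h a) = ares l a;
  ares_sheaf : is_sheaf (fun U V h => @ares U V h)
}.

Arguments ares_id {_} [U] h _.
Arguments ares_comp {_} [U V W] h k l _.

(* A sheaf O of B-algebras is given by its structure morphism B -> O. *)
Record algMor (B O : algSheaf) := AlgMor {
  amor :> forall U, {rmorphism B U -> O U};
  amor_res : forall U V (h : opsub V U) b, ares O h (amor U b) = amor V (ares B h b)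
}.

Section Modules.
Variable O : algSheaf.

Record preMod := PreMod {
  psec :> forall U, lmodType (O U);
  pres : forall U V, opsub V U -> psec U -> psec V;
  pres_lin : forall U V (h : opsub V U), semilinear (ares O h) (@pres U V h);
  pres_id : forall U (h : opsub U U) m, @pres U U h m = m;
  pres_comp : forall U V W (h : opsub V U) (k : opsub W V) (l : opsub W U) m,
    @pres V W k (@pres U V h m) = @pres U W l m
}.

Record modSheaf := ModSheaf {
  mpre :> preMod;
  mod_sheaf : is_sheaf (@pres mpre)
}.

Section PreModTheory.
Variable P : preMod.

Lemma presD U V (h : opsub V U) : {morph @pres P U V h : m n / m + n}.
Proof. exact: semilinearD (pres_lin h). Qed.
Lemma presZ U V (h : opsub V U) a (m : P U) : pres h (a *: m) = ares O h a *: pres h m.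
Proof. exact: semilinearZ (pres_lin h). Qed.
Lemma pres0 U V (h : opsub V U) : pres h (0 : P U) = 0.
Proof. exact: semilinear0 (pres_lin h). Qed.

End PreModTheory.

Section Sheafification.
Variable P : preMod.

Definition local_sec := {V : opens X & P V}.
Definition lsec V (p : P V) : local_sec := existT _ V p.

Definition germ_eq (x : X) (w w' : local_sec) : Prop :=
  exists W (h : opsub W (projT1 w)) (h' : opsub W (projT1 w')),
    opset W x /\ pres h (projT2 w) = pres h' (projT2 w').

Definition germ (x : X) V (p : P V) : set local_sec :=
  [set w | germ_eq x w (lsec p)].

(* Sections over U of the associated sheaf: families of germs at the points of
   U (completed by the empty set elsewhere) that are locally given by sections
   of P. *)
Record shsec U := ShSec {
  shval :> X -> set local_sec;
  shout : forall x, ~ opset U x -> shval x = set0;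
  shloc : forall x, opset U x ->
    exists V (h : opsub V U) (p : P V),
      opset V x /\ forall y, opset V y -> shval y = germ y p
}.

HB.instance Definition _ U := gen_eqMixin (shsec U).
HB.instance Definition _ U := gen_choiceMixin (shsec U).

Lemma shsec_ext U (s t : shsec U) : (forall x, opset U x -> shval s x = shval t x) -> s = t.
Proof.
move=> st; have {}st : shval s = shval t.
  apply/funext => x; have [/st //|xU] := pselect (opset U x).
  by rewrite !shout.
case: s t st => [s s1 s2] [t t1 t2] /= st; case: t / st t1 t2 => t1 t2.
by congr ShSec; exact: Prop_irrelevance.
Qed.

Lemma germ_eq_refl x w : opset (projT1 w) x -> germ_eq x w w.
Proof. by exists (projT1 w), (@opsub_refl _), (@opsub_refl _). Qed.

Lemma germ_eq_sym x w w' : germ_eq x w w' -> germ_eq x w' w.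
Proof. by move=> [W [h [h' [Wx e]]]]; exists W, h', h. Qed.

Lemma germ_eq_trans x w1 w2 w3 : germ_eq x w1 w2 -> germ_eq x w2 w3 -> germ_eq x w1 w3.
Proof.
move=> [W [h1 [h2 [Wx e]]]] [W' [h2' [h3 [Wx' e']]]].
exists (opI W W'), (opsub_trans h1 (@opIl _ _)), (opsub_trans h3 (@opIr _ _)).
split=> //.
rewrite -(pres_comp h1 (@opIl _ _)) e (pres_comp h2 _ (opsub_trans h2 (@opIl _ _))).
rewrite -(pres_comp h3 (@opIr _ _)) -e' (pres_comp h2' _ (opsub_trans h2' (@opIr _ _))).
by congr pres; exact: Prop_irrelevance.
Qed.

Lemma germP x V (p : P V) V' (p' : P V') : opset V x ->
  germ x p = germ x p' <-> germ_eq x (lsec p) (lsec p').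
Proof.
move=> Vx; split=> [e|e].
  have : germ x p (lsec p) by exact: germ_eq_refl.
  by rewrite e.
apply/seteqP; split=> w /= we; apply: germ_eq_trans we _ => //.
exact: germ_eq_sym.
Qed.

Lemma germ_pres x V W (h : opsub W V) (p : P V) : opset W x ->
  germ x (pres h p) = germ x p.
Proof.
move=> Wx; apply/germP => //; exists W, (@opsub_refl _), h.
by split=> //=; rewrite pres_id.
Qed.

Definition represents U (s : shsec U) V (p : P V) : Prop :=
  forall x, opset V x -> shval s x = germ x p.

Lemma represents_pres U (s : shsec U) V W (h : opsub W V) (p : P V) :
  represents s p -> represents s (pres h p).
Proof. by move=> sp x Wx; rewrite germ_pres //; apply/sp/h. Qed.

Lemma shloc2 U (s t : shsec U) x : opset U x ->
  exists V (h : opsub V U) (p q : P V),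
    [/\ opset V x, represents s p & represents t q].
Proof.
move=> Ux; have [V [h [p [Vx sp]]]] := shloc s Ux.
have [V' [h' [q [Vx' tq]]]] := shloc t Ux.
exists (opI V V'), (opsub_trans h (@opIl _ _)), (pres (@opIl _ _) p), (pres (@opIr _ _) q).
by split=> //; exact: represents_pres.
Qed.

Lemma shloc3 U (s t u : shsec U) x : opset U x ->
  exists V (h : opsub V U) (p q r : P V),
    [/\ opset V x, represents s p, represents t q & represents u r].
Proof.
move=> Ux; have [V [h [p [q [Vx sp tq]]]]] := shloc2 s t Ux.
have [V' [h' [r [Vx' tr]]]] := shloc u Ux.
exists (opI V V'), (opsub_trans h (@opIl _ _)), (pres (@opIl _ _) p),
  (pres (@opIl _ _) q), (pres (@opIr _ _) r).
by split=> //; exact: represents_pres.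
Qed.

Definition sheta_val U (p : P U) (x : X) : set local_sec :=
  [set w | opset U x /\ germ x p w].

Fact sheta_in U (p : P U) x : opset U x -> sheta_val p x = germ x p.
Proof. by move=> Ux; apply/seteqP; split=> w // []. Qed.

Fact sheta_out U (p : P U) x : ~ opset U x -> sheta_val p x = set0.
Proof. by move=> Ux; apply/seteqP; split=> w // []. Qed.

Fact sheta_loc U (p : P U) x : opset U x ->
  exists V (h : opsub V U) (q : P V),
    opset V x /\ forall y, opset V y -> sheta_val p y = germ y q.
Proof.
by move=> Ux; exists U, (@opsub_refl U), p; split=> // y Uy; rewrite sheta_in.
Qed.

Definition sheta U (p : P U) : shsec U := ShSec (@sheta_out U p) (@sheta_loc U p).

Lemma represents_sheta U (p : P U) : represents (sheta p) p.
Proof. by move=> x Ux /=; rewrite sheta_in. Qed.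

Definition shres_val U V (s : shsec U) (x : X) : set local_sec :=
  [set w | opset V x /\ shval s x w].

Fact shres_in U V (s : shsec U) x : opset V x -> shres_val V s x = shval s x.
Proof. by move=> Ux; apply/seteqP; split=> w // []. Qed.

Fact shres_out U V (s : shsec U) x : ~ opset V x -> shres_val V s x = set0.
Proof. by move=> Ux; apply/seteqP; split=> w // []. Qed.

Fact shres_loc U V (h : opsub V U) (s : shsec U) x : opset V x ->
  exists W (k : opsub W V) (q : P W),
    opset W x /\ forall y, opset W y -> shres_val V s y = germ y q.
Proof.
move=> Vx; have [W [k [p [Wx sp]]]] := shloc s (h _ Vx).
exists (opI V W), (@opIl _ _), (pres (@opIr _ _) p); split=> // y [Vy Wy].
by rewrite shres_in // germ_pres // sp.
Qed.

Definition shres U V (h : opsub V U) (s : shsec U) : shsec V :=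
  ShSec (@shres_out U V s) (shres_loc h s).

(* Binary operations induced on the associated sheaf by operations f on the
   sections of P over the open subsets of U. *)
Section Operation.
Variables (U : opens X) (f : forall V, opsub V U -> P V -> P V -> P V).
Hypothesis fres : forall V W (h : opsub V U) (k : opsub W V) (l : opsub W U) p q,
  pres k (f h p q) = f l (pres k p) (pres k q).

Definition shop_val (s t : shsec U) (x : X) : set local_sec :=
  [set w | exists V (h : opsub V U) (p q : P V),
     [/\ opset V x, shval s x = germ x p, shval t x = germ x q & germ x (f h p q) w]].

Fact shop_in s t V (h : opsub V U) (p q : P V) x : opset V x ->
  shval s x = germ x p -> shval t x = germ x q -> shop_val s t x = germ x (f h p q).
Proof.
move=> Vx sp tq; apply/seteqP; split=> w; last by exists V, h, p, q.
move=> [V' [h' [p' [q' [Vx' sp' tq']]]]].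
have /germP : germ x p = germ x p' by rewrite -sp.
move=> /(_ Vx) [W [k [k' [Wx /= e]]]].
have /germP : germ x q = germ x q' by rewrite -tq.
move=> /(_ Vx) [Z [j [j' [Zx /= e']]]].
suff -> : germ x (f h p q) = germ x (f h' p' q') by [].
pose l := @opIl W Z; pose r := @opIr W Z.
rewrite -(germ_pres (opsub_trans k l)) //.
rewrite -[RHS](germ_pres (opsub_trans k' l)) //.
pose hU := opsub_trans h (opsub_trans k l).
rewrite (fres _ _ hU) (fres _ _ hU); congr (germ x (f _ _ _)).
  by rewrite -(pres_comp k l) e (pres_comp k' l (opsub_trans k' l)).
rewrite (_ : opsub_trans k l = opsub_trans j r); last exact: Prop_irrelevance.
rewrite -(pres_comp j r) e' (pres_comp j' r (opsub_trans j' r)).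
by congr pres; exact: Prop_irrelevance.
Qed.

Fact shop_out s t x : ~ opset U x -> shop_val s t x = set0.
Proof. by move=> Ux; apply/seteqP; split=> w //= [V [h [p [q [/h /Ux]]]]]. Qed.

Fact shop_loc s t x : opset U x ->
  exists V (h : opsub V U) (p : P V),
    opset V x /\ forall y, opset V y -> shop_val s t y = germ y p.
Proof.
move=> Ux; have [V [h [p [q [Vx sp tq]]]]] := shloc2 s t Ux.
exists V, h, (f h p q); split=> // y Vy.
by apply: shop_in => //; [exact: sp | exact: tq].
Qed.

Definition shop (s t : shsec U) : shsec U := ShSec (@shop_out s t) (@shop_loc s t).

Lemma represents_shop s t V (h : opsub V U) (p q : P V) :
  represents s p -> represents t q -> represents (shop s t) (f h p q).
Proof. by move=> sp tq x Vx; apply: shop_in => //; [exact: sp | exact: tq]. Qed.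

End Operation.

Definition shadd U : shsec U -> shsec U -> shsec U :=
  @shop U (fun _ _ p q => p + q) (fun _ _ _ k _ p q => presD k p q).

Fact shscale_res U a V W (h : opsub V U) (k : opsub W V) (l : opsub W U) (p q : P V) :
  pres k (ares O h a *: p) = ares O l a *: pres k p.
Proof. by rewrite presZ (ares_comp h k l). Qed.

Definition shscale U a (s : shsec U) : shsec U :=
  @shop U (fun _ h p _ => ares O h a *: p) (@shscale_res U a) s s.

Definition shzero U : shsec U := sheta 0.

Lemma represents_eq U (s t : shsec U) V (p : P V) x :
  opset V x -> represents s p -> represents t p -> shval s x = shval t x.
Proof. by move=> Vx sp tp; rewrite sp ?tp. Qed.

Lemma represents_add U (s t : shsec U) V (h : opsub V U) (p q : P V) :
  represents s p -> represents t q -> represents (shadd s t) (p + q).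
Proof. exact: (@represents_shop U (fun _ _ p q => p + q)). Qed.

Lemma represents_scale U a (s : shsec U) V (h : opsub V U) (p : P V) :
  represents s p -> represents (shscale a s) (ares O h a *: p).
Proof.
by move=> sp; apply: (@represents_shop U (fun _ h p _ => ares O h a *: p) _ _ _ _ _ p p).
Qed.

Lemma represents_zero U V (h : opsub V U) : represents (shzero U) (0 : P V).
Proof. by rewrite -(pres0 P h); apply/represents_pres/represents_sheta. Qed.

Fact shaddA U : associative (@shadd U).
Proof.
move=> s t u; apply: shsec_ext => x Ux.
have [V [h [p [q [r [Vx sp tq ur]]]]]] := shloc3 s t u Ux.
apply: (@represents_eq _ _ _ V (p + (q + r))) => //; last rewrite addrA.
  by do ![apply: represents_add].
by do ![apply: represents_add].
Qed.

Fact shaddC U : commutative (@shadd U).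
Proof.
move=> s t; apply: shsec_ext => x Ux; have [V [h [p [q [Vx sp tq]]]]] := shloc2 s t Ux.
apply: (@represents_eq _ _ _ V (p + q)) => //; last rewrite addrC.
  exact: represents_add.
exact: represents_add.
Qed.

Fact shadd0 U : left_id (shzero U) (@shadd U).
Proof.
move=> s; apply: shsec_ext => x Ux; have [V [h [p [Vx sp]]]] := shloc s Ux.
apply: (@represents_eq _ _ _ V p) => //; rewrite -[p]add0r.
by apply: represents_add => //; exact: represents_zero.
Qed.

Fact shaddN U : left_inverse (shzero U) (@shscale U (-1)) (@shadd U).
Proof.
move=> s; apply: shsec_ext => x Ux; have [V [h [p [Vx sp]]]] := shloc s Ux.
apply: (@represents_eq _ _ _ V 0) => //; last exact: represents_zero.
rewrite -(addNr p) -scaleN1r -(rmorphN1 (ares O h)).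
by apply: represents_add => //; exact: represents_scale.
Qed.

HB.instance Definition _ U :=
  GRing.isZmodule.Build (shsec U) (@shaddA U) (@shaddC U) (@shadd0 U) (@shaddN U).

Fact shscaleA U a b (s : shsec U) : shscale a (shscale b s) = shscale (a * b) s.
Proof.
apply: shsec_ext => x Ux; have [V [h [p [Vx sp]]]] := shloc s Ux.
apply: (@represents_eq _ _ _ V (ares O h (a * b) *: p)) => //.
  by rewrite rmorphM -scalerA; do 2 apply: represents_scale.
exact: represents_scale.
Qed.

Fact shscale1 U : left_id 1 (@shscale U).
Proof.
move=> s; apply: shsec_ext => x Ux; have [V [h [p [Vx sp]]]] := shloc s Ux.
apply: (@represents_eq _ _ _ V (ares O h 1 *: p)) => //; last by rewrite rmorph1 scale1r.
exact: represents_scale.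
Qed.

Fact shscaleDr U : right_distributive (@shscale U) +%R.
Proof.
move=> a s t; apply: shsec_ext => x Ux.
have [V [h [p [q [Vx sp tq]]]]] := shloc2 s t Ux.
apply: (@represents_eq _ _ _ V (ares O h a *: (p + q))) => //.
  by apply/represents_scale/represents_add.
by rewrite scalerDr; apply: represents_add => //; exact: represents_scale.
Qed.

Fact shscaleDl U (s : shsec U) : {morph (@shscale U)^~ s : a b / a + b}.
Proof.
move=> a b; apply: shsec_ext => x Ux; have [V [h [p [Vx sp]]]] := shloc s Ux.
apply: (@represents_eq _ _ _ V (ares O h (a + b) *: p)) => //.
  exact: represents_scale.
by rewrite rmorphD scalerDl; apply: represents_add => //; exact: represents_scale.
Qed.

HB.instance Definition _ U := GRing.Zmodule_isLmodule.Build (O U) (shsec U)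
  (@shscaleA U) (@shscale1 U) (@shscaleDr U) (@shscaleDl U).

Lemma represents_shres U V (h : opsub V U) (s : shsec U) W (k : opsub W V) (p : P W) :
  represents (shres h s) p <-> represents s p.
Proof.
split=> sp x Wx; have Vx := k _ Wx; first by rewrite -sp //= shres_in.
by rewrite /= shres_in // sp.
Qed.

Fact shres_lin U V (h : opsub V U) : semilinear (ares O h) (shres h).
Proof.
move=> a s t; apply: shsec_ext => x Vx.
have [W [k [p [q [Wx sp tq]]]]] := shloc2 s t (h _ Vx).
pose l : opsub (opI V W) V := @opIl _ _.
have hl := opsub_trans h l.
have {}sp := represents_pres (@opIr V W) sp.
have {}tq := represents_pres (@opIr V W) tq.
apply: (@represents_eq _ _ _ (opI V W)
  (ares O hl a *: pres (@opIr V W) p + pres (@opIr V W) q)) => //.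
  by apply/represents_shres => //; apply/represents_add/tq => //; apply: represents_scale.
rewrite -(ares_comp h l); apply: represents_add => //; last exact/represents_shres.
by apply: represents_scale; exact/represents_shres.
Qed.

Fact shres_id U (h : opsub U U) (s : shsec U) : shres h s = s.
Proof. by apply: shsec_ext => x Ux /=; rewrite shres_in. Qed.

Fact shres_comp U V W (h : opsub V U) (k : opsub W V) (l : opsub W U) (s : shsec U) :
  shres k (shres h s) = shres l s.
Proof. by apply: shsec_ext => x Wx; rewrite /= shres_in //= !shres_in //; exact: k. Qed.

Definition shpre : preMod := PreMod shres_lin shres_id shres_comp.

Fact shpre_sheaf : is_sheaf (@pres shpre).
Proof.
move=> I U V VU s cov comp.
have agree i j x : opset (V i) x -> opset (V j) x -> shval (s i) x = shval (s j) x.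
  move=> Vi Vj; have /(congr1 (fun t : shsec _ => shval t x)) :=
    comp i j (opI (V i) (V j)) (@opIl _ _) (@opIr _ _).
  by rewrite /= !shres_in.
pose g x : set local_sec := [set w | exists2 i, opset (V i) x & shval (s i) x w].
have gE i x : opset (V i) x -> g x = shval (s i) x.
  move=> Vi; apply/seteqP; split=> w; last by exists i.
  by move=> [j Vj]; rewrite (agree i j).
have gout x : ~ opset U x -> g x = set0.
  by move=> Ux; apply/seteqP; split=> w //= [i /VU /Ux].
have gloc x : opset U x -> exists W (h : opsub W U) (p : P W),
    opset W x /\ forall y, opset W y -> g y = germ y p.
  move=> /cov [i Vx]; have [W [h [p [Wx sp]]]] := shloc (s i) Vx.
  exists W, (opsub_trans (VU i) h), p; split=> // y Wy.
  by rewrite (gE i) ?sp //; exact: h.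
exists (ShSec gout gloc); split=> [i|t tE].
  by apply: shsec_ext => x Vx; rewrite /= shres_in //; exact: gE.
apply: shsec_ext => x /cov [i Vx]; rewrite [LHS](gE i x Vx) -(tE i) /= shres_in //.
Qed.

Definition sheafify : modSheaf := ModSheaf shpre_sheaf.

Definition eta U (p : P U) : sheafify U := sheta p.

Lemma etaP U (p q : P U) : eta p = eta q <->
  forall x, opset U x -> exists W (h : opsub W U), opset W x /\ pres h p = pres h q.
Proof.
split=> [e x Ux|pq].
  have /germP : germ x p = germ x q.
    rewrite -(represents_sheta p Ux) -(represents_sheta q Ux).
    by rewrite (e : sheta p = sheta q).
  move=> /(_ Ux) [W [h [k [Wx e']]]]; exists W, h; split=> //; rewrite /= in e'.
  by rewrite e'; congr pres; exact: Prop_irrelevance.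
apply: shsec_ext => x Ux; rewrite !represents_sheta //; apply/germP => //.
by have [W [h [Wx e]]] := pq x Ux; exists W, h, h.
Qed.

Lemma eta_res U V (h : opsub V U) (p : P U) : pres h (eta p) = eta (pres h p).
Proof.
apply: shsec_ext => x Vx; have Ux := h _ Vx.
by rewrite /= shres_in //= !sheta_in // germ_pres.
Qed.

Lemma eta_lin U : semilinear idfun (@eta U).
Proof.
move=> a p q; apply: shsec_ext => x Ux.
apply: (@represents_eq _ _ _ U (a *: p + q)) => //; first exact: represents_sheta.
rewrite -[in X in X *: p](ares_id (@opsub_refl U) a).
apply: represents_add => //; last exact: represents_sheta.
by apply: represents_scale; exact: represents_sheta.
Qed.

Lemma eta_loc U (s : sheafify U) x : opset U x ->
  exists V (h : opsub V U) (p : P V), opset V x /\ pres h s = eta p.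
Proof.
move=> Ux; have [V [h [p [Vx sp]]]] := shloc (s : shsec U) Ux.
exists V, h, p; split=> //; apply: shsec_ext => y Vy /=.
by rewrite shres_in // sp // sheta_in.
Qed.

End Sheafification.

Section Gluing.
Variable G : modSheaf.

Lemma sheaf_sep U (s t : G U) :
  (forall x, opset U x -> exists V (h : opsub V U), opset V x /\ pres h s = pres h t) ->
  s = t.
Proof.
move=> st; pose I := {V : opens X | exists h : opsub V U, pres h s = pres h t}.
have VU (i : I) : opsub (sval i) U by case: i => V [].
have E (i : I) : pres (VU i) s = pres (VU i) t.
  by case: (svalP i) => h; rewrite (Prop_irrelevance h (VU i)).
have [||u [_ uU]] := @mod_sheaf G I U sval VU (fun i => pres (VU i) s).
- by move=> x /st [V [h [Vx e]]]; exists (exist _ V (ex_intro _ h e)).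
- move=> i j W Wi Wj; have h := opsub_trans (VU i) Wi.
  by rewrite (pres_comp _ _ h) (pres_comp _ _ h).
by rewrite -(uU s) // -(uU t).
Qed.

Lemma sheaf_glue U (C : forall V, G V -> Prop) :
  (forall x, opset U x -> exists V (h : opsub V U) g, opset V x /\ C V g) ->
  (forall V V' (h : opsub V U) (h' : opsub V' U) g g', C V g -> C V' g' ->
    forall W (k : opsub W V) (k' : opsub W V'), pres k g = pres k' g') ->
  exists t : G U, forall V (h : opsub V U) g, C V g -> pres h t = g.
Proof.
move=> cov agree.
pose I := {V : opens X & {g : G V | opsub V U /\ C V g}}.
have VU (i : I) : opsub (projT1 i) U by case: i => V [g []].
have [||t [tE _]] := @mod_sheaf G I U (@projT1 _ _) VU (fun i => sval (projT2 i)).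
- by move=> x /cov [V [h [g [Vx Cg]]]]; exists (existT _ V (exist _ g (conj h Cg))).
- by move=> [V [g [h Cg]]] [V' [g' [h' Cg']]] W k k' /=; exact: agree.
exists t => V h g Cg.
have := tE (existT _ V (exist _ g (conj h Cg))) => /= <-.
by congr pres; exact: Prop_irrelevance.
Qed.

(* The unique extension of f to the associated sheaf, given by definite
   description; see shliftP and shlift_unique. *)
Section Lift1.
Variables (P : preMod) (f : forall U, P U -> G U).

Definition shlift U (s : sheafify P U) : G U :=
  xget 0 [set t | forall V (h : opsub V U) (p : P V),
                    pres h s = eta p -> pres h t = f p].

Hypothesis fres : forall U V (h : opsub V U) p, pres h (f p) = f (pres h p).

Lemma shliftP U (s : sheafify P U) V (h : opsub V U) (p : P V) :
  pres h s = eta p -> pres h (shlift s) = f p.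
Proof.
suff [t tP] : exists t : G U, forall V (h : opsub V U) (p : P V),
    pres h s = eta p -> pres h t = f p.
  rewrite /shlift; case: xgetP => [u _ uP|/(_ t) //]; exact: uP.
clear V h p; have [||t tP] := @sheaf_glue U
    (fun V g => exists (h : opsub V U) p, pres h s = eta p /\ g = f p).
- move=> x Ux; have [V [h [p [Vx sp]]]] := eta_loc s Ux.
  by exists V, h, (f p); split=> //; exists h, p.
- move=> V V' _ _ g g' [h [p [sp ->]]] [h' [p' [sp' ->]]] W k k'.
  rewrite !fres; apply: sheaf_sep => x Wx.
  have hk := opsub_trans h k.
  have /etaP : eta (pres k p) = eta (pres k' p').
    by rewrite -!eta_res -sp -sp' !(pres_comp _ _ hk).
  by move=> /(_ x Wx) [Z [z [Zx e]]]; exists Z, z; rewrite !fres e.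
- by exists t => V h p sp; apply: tP; exists h, p.
Qed.

Lemma shlift_eta U (p : P U) : shlift (eta p) = f p.
Proof. by rewrite -(pres_id (@opsub_refl U) (shlift _)); apply: shliftP; rewrite pres_id. Qed.

Lemma shlift_unique (g : forall U, sheafify P U -> G U) :
  (forall U V (h : opsub V U) s, pres h (g U s) = g V (pres h s)) ->
  (forall U p, g U (eta p) = f p) -> forall U s, g U s = shlift s.
Proof.
move=> gres gf U s; apply: sheaf_sep => x Ux.
have [V [h [p [Vx sp]]]] := eta_loc s Ux.
by exists V, h; split=> //; rewrite gres sp gf (shliftP sp).
Qed.

Lemma shlift_res U V (h : opsub V U) (s : sheafify P U) :
  pres h (shlift s) = shlift (pres h s).
Proof.
apply: sheaf_sep => x Vx; have [W [k [p [Wx sp]]]] := eta_loc (pres h s) Vx.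
exists W, k; split=> //; rewrite (shliftP sp).
rewrite (pres_comp _ _ (opsub_trans h k)); apply: shliftP.
by rewrite -sp (pres_comp _ _ (opsub_trans h k)).
Qed.

Lemma shlift_lin : (forall U, semilinear idfun (f (U := U))) ->
  forall U, semilinear idfun (@shlift U).
Proof.
move=> fl U a s t; apply: sheaf_sep => x Ux.
have [V [h [p [Vx sp]]]] := eta_loc s Ux.
have [W [k [q [Wx tq]]]] := eta_loc t Ux.
pose l := @opIl V W; pose r := @opIr V W.
have hl := opsub_trans h l.
have {}sp : pres hl s = eta (pres l p) by rewrite -eta_res -sp (pres_comp _ _ hl).
have {}tq : pres hl t = eta (pres r q) by rewrite -eta_res -tq (pres_comp _ _ hl).
exists (opI V W), hl; split=> //.
rewrite [RHS]pres_lin (shliftP sp) (shliftP tq).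
have /shliftP -> : pres hl (a *: s + t) = eta (ares O hl a *: pres l p + pres r q).
  by rewrite pres_lin eta_lin sp tq.
by rewrite fl.
Qed.

End Lift1.

Section Lift2.
Variables (P Q : preMod) (f : forall U, P U -> Q U -> G U).

Definition shlift2 U (s : sheafify P U) (t : sheafify Q U) : G U :=
  xget 0 [set u | forall V (h : opsub V U) (p : P V) (q : Q V),
                    pres h s = eta p -> pres h t = eta q -> pres h u = f p q].

Hypothesis fres : forall U V (h : opsub V U) p q,
  pres h (f p q) = f (pres h p) (pres h q).

Lemma eta_loc2 U (s : sheafify P U) (t : sheafify Q U) x : opset U x ->
  exists V (h : opsub V U) (p : P V) (q : Q V),
    [/\ opset V x, pres h s = eta p & pres h t = eta q].
Proof.
move=> Ux; have [V [h [p [Vx sp]]]] := eta_loc s Ux.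
have [W [k [q [Wx tq]]]] := eta_loc t Ux.
pose l := @opIl V W; pose r := @opIr V W.
have hl := opsub_trans h l.
exists (opI V W), hl, (pres l p), (pres r q).
by split=> //; rewrite -eta_res -?sp -?tq (pres_comp _ _ hl).
Qed.

Lemma shlift2P U (s : sheafify P U) (t : sheafify Q U) V (h : opsub V U) p q :
  pres h s = eta p -> pres h t = eta q -> pres h (shlift2 s t) = f p q.
Proof.
suff [u uP] : exists u : G U, forall V (h : opsub V U) (p : P V) (q : Q V),
    pres h s = eta p -> pres h t = eta q -> pres h u = f p q.
  rewrite /shlift2; case: xgetP => [v _ vP|/(_ u) //]; exact: vP.
clear V h p q; have [||u uP] := @sheaf_glue U (fun V g => exists (h : opsub V U) p q,
    [/\ pres h s = eta p, pres h t = eta q & g = f p q]).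
- move=> x Ux; have [V [h [p [q [Vx sp tq]]]]] := eta_loc2 s t Ux.
  by exists V, h, (f p q); split=> //; exists h, p, q.
- move=> V V' _ _ g g' [h [p [q [sp tq ->]]]] [h' [p' [q' [sp' tq' ->]]]] W k k'.
  rewrite !fres; apply: sheaf_sep => x Wx.
  have hk := opsub_trans h k.
  have /etaP : eta (pres k p) = eta (pres k' p').
    by rewrite -!eta_res -sp -sp' !(pres_comp _ _ hk).
  have /etaP : eta (pres k q) = eta (pres k' q').
    by rewrite -!eta_res -tq -tq' !(pres_comp _ _ hk).
  move=> /(_ x Wx) [Z [z [Zx e]]] /(_ x Wx) [Z' [z' [Zx' e']]].
  pose l := @opIl Z Z'; pose r := @opIr Z Z'.
  have zl := opsub_trans z l.
  exists (opI Z Z'), zl; split=> //; rewrite !fres -!(pres_comp z l zl) e.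
  by rewrite !(pres_comp z l zl) -!(pres_comp z' r zl) e'.
- by exists u => V h p q sp tq; apply: uP; exists h, p, q.
Qed.

Lemma shlift2_eta U (p : P U) (q : Q U) : shlift2 (eta p) (eta q) = f p q.
Proof.
rewrite -(pres_id (@opsub_refl U) (shlift2 _ _)).
by apply: shlift2P; rewrite pres_id.
Qed.

Lemma shlift2_res U V (h : opsub V U) (s : sheafify P U) (t : sheafify Q U) :
  pres h (shlift2 s t) = shlift2 (pres h s) (pres h t).
Proof.
apply: sheaf_sep => x Vx.
have [W [k [p [q [Wx sp tq]]]]] := eta_loc2 (pres h s) (pres h t) Vx.
exists W, k; split=> //; rewrite (shlift2P sp tq).
rewrite (pres_comp _ _ (opsub_trans h k)); apply: shlift2P.
  by rewrite -sp (pres_comp _ _ (opsub_trans h k)).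
by rewrite -tq (pres_comp _ _ (opsub_trans h k)).
Qed.

Lemma shlift2_linl : (forall U q, semilinear idfun (fun p : P U => f p q)) ->
  forall U t, semilinear idfun (fun s : sheafify P U => shlift2 s t).
Proof.
move=> fl U t a s s'; apply: sheaf_sep => x Ux.
have [V [h [p [q [Vx sp tq]]]]] := eta_loc2 s t Ux.
have [W [k [p' [Wx sp']]]] := eta_loc s' Ux.
pose l := @opIl V W; pose r := @opIr V W.
have hl := opsub_trans h l.
have {}sp : pres hl s = eta (pres l p) by rewrite -eta_res -sp (pres_comp _ _ hl).
have {}tq : pres hl t = eta (pres l q) by rewrite -eta_res -tq (pres_comp _ _ hl).
have {}sp' : pres hl s' = eta (pres r p') by rewrite -eta_res -sp' (pres_comp _ _ hl).
exists (opI V W), hl; split=> //.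
rewrite [RHS]pres_lin (shlift2P sp tq) (shlift2P sp' tq).
rewrite (@shlift2P _ _ _ _ hl (ares O hl a *: pres l p + pres r p') (pres l q)) //.
  exact: fl.
by rewrite pres_lin eta_lin sp sp'.
Qed.

Lemma shlift2_linr : (forall U p, semilinear idfun (fun q : Q U => f p q)) ->
  forall U s, semilinear idfun (fun t : sheafify Q U => shlift2 s t).
Proof.
move=> fl U s a t t'; apply: sheaf_sep => x Ux.
have [V [h [p [q [Vx sp tq]]]]] := eta_loc2 s t Ux.
have [W [k [q' [Wx tq']]]] := eta_loc t' Ux.
pose l := @opIl V W; pose r := @opIr V W.
have hl := opsub_trans h l.
have {}sp : pres hl s = eta (pres l p) by rewrite -eta_res -sp (pres_comp _ _ hl).
have {}tq : pres hl t = eta (pres l q) by rewrite -eta_res -tq (pres_comp _ _ hl).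
have {}tq' : pres hl t' = eta (pres r q') by rewrite -eta_res -tq' (pres_comp _ _ hl).
exists (opI V W), hl; split=> //.
rewrite [RHS]pres_lin (shlift2P sp tq) (shlift2P sp tq').
rewrite (@shlift2P _ _ _ _ hl (pres l p) (ares O hl a *: pres l q + pres r q')) //.
  exact: fl.
by rewrite pres_lin eta_lin tq tq'.
Qed.

End Lift2.
End Gluing.

Fact self_lin U V (h : opsub V U) :
  @semilinear (O U) (O V) (O U)^o (O V)^o (ares O h) (ares O h).
Proof. by move=> a m n; rewrite rmorphD [X in X + _]rmorphM. Qed.

Definition selfpre : preMod :=
  @PreMod (fun U => (O U)^o) (fun U V h => ares O h)
    self_lin (@ares_id O) (@ares_comp O).

Definition selfMod : modSheaf := @ModSheaf selfpre (@ares_sheaf O).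

End Modules.
End Sheaves.

Definition dprod (A : comPzRingType) (I : Type) (M : I -> lmodType A) : Type :=
  forall i, M i.

Section DProd.
Variables (A : comPzRingType) (I : Type) (M : I -> lmodType A).
Local Notation P := (dprod M).

HB.instance Definition _ := gen_eqMixin P.
HB.instance Definition _ := gen_choiceMixin P.

Definition dadd (u v : P) : P := fun i => u i + v i.
Definition dzero : P := fun i => 0.
Definition dopp (u : P) : P := fun i => - u i.
Definition dscale (a : A) (u : P) : P := fun i => a *: u i.

Fact daddA : associative dadd.
Proof. by move=> u v w; apply: functional_extensionality_dep => i; exact: addrA. Qed.
Fact daddC : commutative dadd.
Proof. by move=> u v; apply: functional_extensionality_dep => i; exact: addrC. Qed.
Fact dadd0 : left_id dzero dadd.
Proof. by move=> u; apply: functional_extensionality_dep => i; exact: add0r. Qed.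
Fact daddN : left_inverse dzero dopp dadd.
Proof. by move=> u; apply: functional_extensionality_dep => i; exact: addNr. Qed.

HB.instance Definition _ := GRing.isZmodule.Build P daddA daddC dadd0 daddN.

Fact dscaleA a b u : dscale a (dscale b u) = dscale (a * b) u.
Proof. by apply: functional_extensionality_dep => i; exact: scalerA. Qed.
Fact dscale1 : left_id 1 dscale.
Proof. by move=> u; apply: functional_extensionality_dep => i; exact: scale1r. Qed.
Fact dscaleDr : right_distributive dscale +%R.
Proof. by move=> a u v; apply: functional_extensionality_dep => i; exact: scalerDr. Qed.
Fact dscaleDl u : {morph dscale^~ u : a b / a + b}.
Proof. by move=> a b; apply: functional_extensionality_dep => i; exact: scalerDl. Qed.

HB.instance Definition _ :=
  GRing.Zmodule_isLmodule.Build A P dscaleA dscale1 dscaleDr dscaleDl.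

End DProd.

Section ProdSheaf.
Variables (X : topologicalType) (O : algSheaf X) (I : Type) (M : I -> modSheaf O).

Definition dprod_at (U : opens X) : lmodType (O U) := dprod (fun i => M i U).

Definition dprod_res (U V : opens X) (h : opsub V U) (u : dprod_at U) : dprod_at V :=
  fun i => pres h (u i).

Fact dprod_lin U V (h : opsub V U) : semilinear (ares O h) (dprod_res h).
Proof. by move=> a u v; apply: functional_extensionality_dep => i; exact: pres_lin. Qed.

Fact dprod_id U (h : opsub U U) u : dprod_res h u = u.
Proof. by apply: functional_extensionality_dep => i; exact: pres_id. Qed.

Fact dprod_comp U V W (h : opsub V U) (k : opsub W V) (l : opsub W U) u :
  dprod_res k (dprod_res h u) = dprod_res l u.
Proof. by apply: functional_extensionality_dep => i; exact: pres_comp. Qed.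

Definition prodpre : preMod O := PreMod dprod_lin dprod_id dprod_comp.

Fact prodpre_sheaf : is_sheaf (@pres X O prodpre).
Proof.
move=> J U V VU s cov comp.
have gl i : exists! t : M i U, forall j, pres (VU j) t = s j i.
  apply: (@mod_sheaf _ _ (M i) J U V VU (fun j => s j i)) => // j k W Wj Wk.
  exact: (f_equal (fun u : forall i, M i W => u i) (comp j k W Wj Wk)).
have glP i := svalP (cid (gl i)); exists (fun i => sval (cid (gl i))); split.
  by move=> j; apply: functional_extensionality_dep => i; exact: (glP i).1.
move=> t tE; apply: functional_extensionality_dep => i; apply: (glP i).2 => j.
by rewrite -tE.
Qed.

Definition prodSheaf : modSheaf O := ModSheaf prodpre_sheaf.

End ProdSheaf.

Section TensorSheaves.
Variables (X : topologicalType) (O : algSheaf X).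
Implicit Types U V : opens X.

Section Presheaves.
Variables (P Q : preMod O).

Definition tenspre_res n U V (h : opsub V U) : tens_mod (P U) n -> tens_mod (P V) n :=
  fun x => tens_map (ares O h) (pres h) x.

Fact tenspre_lin n U V (h : opsub V U) : semilinear (ares O h) (@tenspre_res n U V h).
Proof. exact/tens_mapP/pres_lin. Qed.

Fact tenspre_id n U (h : opsub U U) m : @tenspre_res n U U h m = m.
Proof.
apply: (@pmod_eq _ _ _ _ _ idfun _ id) m => // [a x y|t].
  by rewrite tenspre_lin ares_id.
rewrite -/(tens_gen t) /tenspre_res (tens_map_gen (pres_lin h)); congr tens_gen.
by apply/funext => k /=; rewrite pres_id.
Qed.

Fact tenspre_comp n U V W (h : opsub V U) (k : opsub W V) (l : opsub W U) m :
  @tenspre_res n V W k (@tenspre_res n U V h m) = tenspre_res l m.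
Proof.
apply: (@pmod_eq _ _ _ _ _ (ares O l) (fun x => tenspre_res k (tenspre_res h x))) m.
- by move=> a x y; rewrite !tenspre_lin (ares_comp h k l).
- exact: tenspre_lin.
move=> t; rewrite -/(tens_gen t) /tenspre_res !(tens_map_gen (pres_lin _)).
by congr tens_gen; apply/funext => i /=; rewrite (pres_comp h k l).
Qed.

Definition tenspre n : preMod O := PreMod (@tenspre_lin n) (@tenspre_id n) (@tenspre_comp n).

Definition sympre_res n U V (h : opsub V U) : sym_mod (P U) n -> sym_mod (P V) n :=
  fun x => sym_map (ares O h) (pres h) x.

Fact sympre_lin n U V (h : opsub V U) : semilinear (ares O h) (@sympre_res n U V h).
Proof. exact/sym_mapP/pres_lin. Qed.

Fact sympre_id n U (h : opsub U U) m : @sympre_res n U U h m = m.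
Proof.
apply: (@pmod_eq _ _ _ _ _ idfun _ id) m => // [a x y|t].
  by rewrite sympre_lin ares_id.
rewrite -/(sym_gen t) /sympre_res (sym_map_gen (pres_lin h)); congr sym_gen.
by apply/funext => k /=; rewrite pres_id.
Qed.

Fact sympre_comp n U V W (h : opsub V U) (k : opsub W V) (l : opsub W U) m :
  @sympre_res n V W k (@sympre_res n U V h m) = sympre_res l m.
Proof.
apply: (@pmod_eq _ _ _ _ _ (ares O l) (fun x => sympre_res k (sympre_res h x))) m.
- by move=> a x y; rewrite !sympre_lin (ares_comp h k l).
- exact: sympre_lin.
move=> t; rewrite -/(sym_gen t) /sympre_res !(sym_map_gen (pres_lin _)).
by congr sym_gen; apply/funext => i /=; rewrite (pres_comp h k l).
Qed.

Definition sympre n : preMod O := PreMod (@sympre_lin n) (@sympre_id n) (@sympre_comp n).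

Definition altpre_res n U V (h : opsub V U) : alt_mod (P U) n -> alt_mod (P V) n :=
  fun x => alt_map (ares O h) (pres h) x.

Fact altpre_lin n U V (h : opsub V U) : semilinear (ares O h) (@altpre_res n U V h).
Proof. exact/alt_mapP/pres_lin. Qed.

Fact altpre_id n U (h : opsub U U) m : @altpre_res n U U h m = m.
Proof.
apply: (@pmod_eq _ _ _ _ _ idfun _ id) m => // [a x y|t].
  by rewrite altpre_lin ares_id.
rewrite -/(alt_gen t) /altpre_res (alt_map_gen (pres_lin h)); congr alt_gen.
by apply/funext => k /=; rewrite pres_id.
Qed.

Fact altpre_comp n U V W (h : opsub V U) (k : opsub W V) (l : opsub W U) m :
  @altpre_res n V W k (@altpre_res n U V h m) = altpre_res l m.
Proof.
apply: (@pmod_eq _ _ _ _ _ (ares O l) (fun x => altpre_res k (altpre_res h x))) m.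
- by move=> a x y; rewrite !altpre_lin (ares_comp h k l).
- exact: altpre_lin.
move=> t; rewrite -/(alt_gen t) /altpre_res !(alt_map_gen (pres_lin _)).
by congr alt_gen; apply/funext => i /=; rewrite (pres_comp h k l).
Qed.

Definition altpre n : preMod O := PreMod (@altpre_lin n) (@altpre_id n) (@altpre_comp n).

Definition otimespre_res U V (h : opsub V U) :
    otimes_mod (P U) (Q U) -> otimes_mod (P V) (Q V) :=
  otimes_map (ares O h) (pres h) (pres h).

Fact otimespre_lin U V (h : opsub V U) : semilinear (ares O h) (otimespre_res h).
Proof. by apply: otimes_mapP; exact: pres_lin. Qed.

Fact otimespre_gen U V (h : opsub V U) m n :
  otimespre_res h (otimes m n) = otimes (pres h m) (pres h n).
Proof. by apply: otimes_map_gen; exact: pres_lin. Qed.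

Fact otimespre_id U (h : opsub U U) m : otimespre_res h m = m.
Proof.
apply: (@pmod_eq _ _ _ _ _ idfun _ id) m => // [a x y|[m n]].
  by rewrite otimespre_lin ares_id.
by rewrite -/(otimes m n) otimespre_gen !pres_id.
Qed.

Fact otimespre_comp U V W (h : opsub V U) (k : opsub W V) (l : opsub W U) m :
  otimespre_res k (otimespre_res h m) = otimespre_res l m.
Proof.
apply: (@pmod_eq _ _ _ _ _ (ares O l) (fun x => otimespre_res k (otimespre_res h x))) m.
- by move=> a x y; rewrite !otimespre_lin (ares_comp h k l).
- exact: otimespre_lin.
by move=> [m n]; rewrite -/(otimes m n) !otimespre_gen !(pres_comp h k l).
Qed.

Definition otimespre : preMod O := PreMod otimespre_lin otimespre_id otimespre_comp.

End Presheaves.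

Definition Otimes (F G : modSheaf O) : modSheaf O := sheafify (otimespre F G).

Definition otimesS (F G : modSheaf O) U (m : F U) (n : G U) : Otimes F G U :=
  eta (otimes m n : otimespre F G U).

Variable F : modSheaf O.

Definition Tpow n : modSheaf O := sheafify (tenspre F n).
Definition Spow n : modSheaf O := sheafify (sympre F n).
Definition Apow n : modSheaf O := sheafify (altpre F n).

Definition Tgen n U (t : 'I_n -> F U) : Tpow n U := eta (tens_gen t : tenspre F n U).
Definition Sgen n U (t : 'I_n -> F U) : Spow n U := eta (sym_gen t : sympre F n U).
Definition Agen n U (t : 'I_n -> F U) : Apow n U := eta (alt_gen t : altpre F n U).

Definition tens2 U (m m' : F U) : Tpow 2 U :=
  Tgen (fun k : 'I_2 => if k == ord0 then m else m').

(* The identifications of O with S^0 and of F with S^1. *)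
Definition Sone U : Spow 0 U := Sgen (fun _ => 0).
Definition S0 U (a : O U) : Spow 0 U := a *: Sone U.
Definition S1 U (m : F U) : Spow 1 U := Sgen (fun _ => m).

Definition T_to_A n U : Tpow n U -> Apow n U :=
  shlift (fun V (x : tenspre F n V) => eta (tens_to_alt x : altpre F n V)) (U := U).

Definition Smul i j n (e : (i + j = n)%N) U : Spow i U -> Spow j U -> Spow n U :=
  shlift2 (fun V (x : sympre F i V) (y : sympre F j V) =>
             eta (sym_mul e x y : sympre F n V)) (U := U).

Definition Rpow n : modSheaf O :=
  if n is k.+1 then Otimes (Spow k) F else selfMod O.

Definition R1 U (m : F U) : Rpow 1 U := otimesS (Sone U) m.

(* Products in R are needed in positive degrees only: R^0 = O acts by scalars.
   The quotient map T^(n+1) -> S^n (x) F sends x_0 (x) ... (x) x_n to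
   (x_0 ... x_(n-1)) (x) x_n, so the product of R inherited from the tensor
   algebra is (s (x) m) (s' (x) m') = (s m s') (x) m'. *)
Definition Rmul_pre i j n (e : (i.+1 + j = n)%N) U
    (x : otimespre (Spow i) F U) (y : otimespre (Spow j) F U) :
    otimespre (Spow n) F U :=
  plift idfun (fun p => plift idfun (fun q =>
    otimes (Smul e (Smul (addn1 i) p.1 (S1 p.2)) q.1) q.2) y) x.

Lemma Rmul_deg i j n : (i.+1 + j.+1 = n.+1)%N -> (i.+1 + j = n)%N.
Proof. by rewrite addnS => -[]. Qed.

Definition Rmul i j n (e : (i.+1 + j.+1 = n.+1)%N) U :
    Rpow i.+1 U -> Rpow j.+1 U -> Rpow n.+1 U :=
  shlift2 (G := Rpow n.+1) (fun V x y => eta (Rmul_pre (Rmul_deg e) x y)) (U := U).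

(* The quotient map R^n -> S^n for n = i.+1, s (x) m |-> s m. *)
Definition R_to_S i U : Rpow i.+1 U -> Spow i.+1 U :=
  shlift (fun V (x : otimespre (Spow i) F V) =>
    plift idfun (fun p => Smul (addn1 i) p.1 (S1 p.2)) x) (U := U).

Lemma T_to_A_gen n U (t : 'I_n -> F U) : T_to_A (Tgen t) = Agen t.
Proof.
rewrite /T_to_A shlift_eta ?tens_to_alt_gen // => V W h x; rewrite eta_res /=.
by rewrite /altpre_res (alt_map_tens (pres_lin h)).
Qed.

Fact Smul_pre_res i j n (e : (i + j = n)%N) U V (h : opsub V U)
    (x : sympre F i U) (y : sympre F j U) :
  pres h (eta (sym_mul e x y : sympre F n U)) =
  eta (sym_mul e (pres h x) (pres h y) : sympre F n V).
Proof. by rewrite eta_res /= /sympre_res (sym_map_mul (pres_lin h)). Qed.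

Lemma Smul_gen i j n (e : (i + j = n)%N) U (s : 'I_i -> F U) (t : 'I_j -> F U) :
  Smul e (Sgen s) (Sgen t) = Sgen (catf e s t).
Proof. by rewrite /Smul (shlift2_eta (Smul_pre_res e)) sym_mul_gen. Qed.

Lemma Smul_res i j n (e : (i + j = n)%N) U V (h : opsub V U)
    (x : Spow i U) (y : Spow j U) :
  pres h (Smul e x y) = Smul e (pres h x) (pres h y).
Proof. exact/shlift2_res/Smul_pre_res. Qed.

Lemma Smul_linl i j n (e : (i + j = n)%N) U (y : Spow j U) :
  semilinear idfun (fun x : Spow i U => Smul e x y).
Proof.
apply: shlift2_linl (Smul_pre_res e) _ _ _ => V q a p p'.
by rewrite sym_mulDl sym_mulZl eta_lin.
Qed.

Lemma Smul_linr i j n (e : (i + j = n)%N) U (x : Spow i U) :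
  semilinear idfun (@Smul i j n e U x).
Proof.
apply: shlift2_linr (Smul_pre_res e) _ _ _ => V q a p p'.
by rewrite sym_mulDr sym_mulZr eta_lin.
Qed.

Lemma S1_lin U : semilinear idfun (@S1 U).
Proof.
move=> a m m'; rewrite /S1 /Sgen -eta_lin; congr eta.
have E (x : F U) : (fun _ : 'I_1 => x) = upd (fun _ : 'I_1 => 0) ord0 x.
  by apply/funext => k; rewrite /upd ord1.
by rewrite (E (a *: m + m')) (E m) (E m') sym_gen_lin.
Qed.

Lemma S1_res U V (h : opsub V U) (m : F U) : pres h (S1 m) = S1 (pres h m).
Proof. by rewrite /S1 /Sgen eta_res /= /sympre_res (sym_map_gen (pres_lin h)). Qed.

Definition R_to_S_pre i U (p : Spow i U * F U) : Spow i.+1 U :=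
  Smul (addn1 i) p.1 (S1 p.2).

Fact R_to_S_rel i U s t : otimes_rel s t ->
  leval idfun (@R_to_S_pre i U) s = leval idfun (@R_to_S_pre i U) t.
Proof.
by case=> [a m m' n|a m n n']; rewrite /= /R_to_S_pre /= ?S1_lin (Smul_linl, Smul_linr).
Qed.

Fact R_to_S_res i U V (h : opsub V U) (x : otimespre (Spow i) F U) :
  pres h (plift idfun (@R_to_S_pre i U) x) = plift idfun (@R_to_S_pre i V) (pres h x).
Proof.
apply: (@pmod_eq _ _ _ _ _ (ares O h)
  (fun x => pres h (plift idfun (@R_to_S_pre i U) x))
  (fun x => plift idfun (@R_to_S_pre i V) (otimespre_res h x))) x.
- by move=> a x y; rewrite (pliftD (@R_to_S_rel _ _)) (pliftZ (@R_to_S_rel _ _)) pres_lin.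
- move=> a x y; rewrite otimespre_lin.
  by rewrite (pliftD (@R_to_S_rel _ _)) (pliftZ (@R_to_S_rel _ _)).
move=> [s m]; rewrite -/(otimes s m) otimespre_gen !(plift_gen (@R_to_S_rel _ _)).
by rewrite /R_to_S_pre Smul_res S1_res.
Qed.

Lemma R_to_S_otimes i U (s : Spow i U) (m : F U) :
  R_to_S (otimesS s m : Rpow i.+1 U) = Smul (addn1 i) s (S1 m).
Proof. by rewrite /R_to_S (shlift_eta (@R_to_S_res i)) (plift_gen (@R_to_S_rel _ _)). Qed.

Section RmulPre.
Variables (i j n : nat) (e : (i.+1 + j = n)%N) (U : opens X).

Let g (p : Spow i U * F U) (q : Spow j U * F U) : otimespre (Spow n) F U :=
  otimes (Smul e (R_to_S_pre p) q.1) q.2.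

Let inner_rel p s t : otimes_rel s t -> leval idfun (g p) s = leval idfun (g p) t.
Proof.
by case=> [a m m' q|a m q q']; rewrite /= /g /= ?Smul_linr ?(otimesDl, otimesDr).
Qed.

Let outer_rel (y : otimes_mod (Spow j U) (F U)) s t : otimes_rel s t ->
  leval idfun (fun p => plift idfun (g p) y) s =
  leval idfun (fun p => plift idfun (g p) y) t.
Proof.
have gl p p' p'' (a : O U) : R_to_S_pre p = a *: R_to_S_pre p' + R_to_S_pre p'' ->
    plift idfun (g p) y = a *: plift idfun (g p') y + plift idfun (g p'') y.
  move=> E; elim/pmod_ind: y => [|x y Hx Hy|b x Hx|q].
  - by rewrite !(plift0 (@inner_rel _)) scaler0 addr0.
  - by rewrite !(pliftD (@inner_rel _)) Hx Hy scalerDr addrACA.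
  - by rewrite !(pliftZ (@inner_rel _)) Hx scalerDr !scalerA mulrC.
  - by rewrite !(plift_gen (@inner_rel _)) /g E Smul_linl otimesDl.
by move=> st; have := R_to_S_rel st; case: st => [a m m' q|a m q q'] /= /gl.
Qed.

Lemma Rmul_pre_otimes (s : Spow i U) (m : F U) (s' : Spow j U) (m' : F U) :
  Rmul_pre e (otimes s m) (otimes s' m') =
  otimes (Smul e (Smul (addn1 i) s (S1 m)) s') m'.
Proof. by rewrite /Rmul_pre (plift_gen (@outer_rel _)) (plift_gen (@inner_rel _)). Qed.

Lemma Rmul_pre_linl y : semilinear idfun (fun x => @Rmul_pre i j n e U x y).
Proof.
by move=> a x x'; rewrite /Rmul_pre (pliftD (@outer_rel _)) (pliftZ (@outer_rel _)).
Qed.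

Lemma Rmul_pre_linr x : semilinear idfun (@Rmul_pre i j n e U x).
Proof.
move=> a y y'; elim/pmod_ind: x => [|x x' Hx Hx'|b x Hx|p].
- by rewrite /Rmul_pre !(plift0 (@outer_rel _)) scaler0 addr0.
- have E z := semilinearD (Rmul_pre_linl z) x x'.
  by rewrite !E Hx Hx' scalerDr addrACA.
- have E z := semilinearZ b x (Rmul_pre_linl z).
  by rewrite !E Hx scalerDr !scalerA mulrC.
rewrite /Rmul_pre !(plift_gen (@outer_rel _)).
by rewrite (pliftD (@inner_rel _)) (pliftZ (@inner_rel _)).
Qed.

End RmulPre.

Fact Rmul_pre_res i j n (e : (i.+1 + j = n)%N) U V (h : opsub V U)
    (x : otimespre (Spow i) F U) (y : otimespre (Spow j) F U) :
  pres h (Rmul_pre e x y) = Rmul_pre e (pres h x) (pres h y).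
Proof.
apply: (@pmod_eq _ _ _ _ _ (ares O h)
  (fun x => otimespre_res h (Rmul_pre e x y))
  (fun x => Rmul_pre e (otimespre_res h x) (pres h y))) x.
- by move=> a x x'; rewrite Rmul_pre_linl otimespre_lin.
- by move=> a x x'; rewrite otimespre_lin Rmul_pre_linl.
move=> [s m]; rewrite -/(otimes s m).
apply: (@pmod_eq _ _ _ _ _ (ares O h)
  (fun y => otimespre_res h (Rmul_pre e (otimes s m) y))
  (fun y => Rmul_pre e (otimespre_res h (otimes s m)) (otimespre_res h y))) y.
- by move=> a y y'; rewrite Rmul_pre_linr otimespre_lin.
- by move=> a y y'; rewrite otimespre_lin Rmul_pre_linr.
move=> [s' m']; rewrite -/(otimes s' m') Rmul_pre_otimes !otimespre_gen.
by rewrite Rmul_pre_otimes !Smul_res S1_res.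
Qed.

Lemma Rmul_otimes i j n (e : (i.+1 + j.+1 = n.+1)%N) U
    (s : Spow i U) (m : F U) (s' : Spow j U) (m' : F U) :
  Rmul e (otimesS s m : Rpow i.+1 U) (otimesS s' m' : Rpow j.+1 U) =
  otimesS (Smul (Rmul_deg e) (Smul (addn1 i) s (S1 m)) s') m' :> Rpow n.+1 U.
Proof.
rewrite /Rmul [LHS]shlift2_eta ?Rmul_pre_otimes // => V W h x y.
by rewrite -Rmul_pre_res; exact: eta_res.
Qed.

End TensorSheaves.

Definition Rprod (X : topologicalType) (O : algSheaf X) (F : modSheaf O) : modSheaf O :=
  prodSheaf (fun i : nat => Rpow F i.+1).
Definition Sprod (X : topologicalType) (O : algSheaf X) (F : modSheaf O) : modSheaf O :=
  prodSheaf (fun i : nat => Spow F i).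

Section Definitions.
Variables (X : topologicalType) (B O : algSheaf X) (iota : algMor B O).
Variable F : modSheaf O.
Implicit Types U V : opens X.

Definition natural_map (M N : modSheaf O) (f : forall U, M U -> N U) : Prop :=
  forall U V (h : opsub V U) m, pres h (f U m) = f V (pres h m).

Definition O_linear (M N : modSheaf O) (f : forall U, M U -> N U) : Prop :=
  natural_map f /\
  forall U (a : O U) m m', f U (a *: m + m') = a *: f U m + f U m'.

Definition B_linear (M N : modSheaf O) (f : forall U, M U -> N U) : Prop :=
  natural_map f /\
  forall U (b : B U) m m', f U (iota U b *: m + m') = iota U b *: f U m + f U m'.

Definition derivation (D : forall U, O U -> F U) : Prop :=
  @B_linear (selfMod O) F D /\
  forall U (a b : O U), D U (a * b) = a *: D U b + b *: D U a.

Variable D : forall U, O U -> F U.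

Definition connection (g : forall U, F U -> Tpow F 2 U) : Prop :=
  B_linear g /\
  forall U (a : O U) (m : F U), g U (a *: m) = tens2 (D a) m + a *: g U m.

Definition flat (g : forall U, F U -> Tpow F 2 U) : Prop :=
  forall U (a : O U), T_to_A (g U (D a)) = 0.

Definition integrable : Prop := exists g, connection g /\ flat g.

Lemma ext_deg i (j : 'I_i) : (j.+1 + (i - j.+1).+1 = i.+1)%N.
Proof. by rewrite addnS subnKC. Qed.

(* With k = j.+1, the summand is (1/k) T_(k-1) D(a) T_(i-k)(m), 1 <= k <= i. *)
Definition ext_connection (T : forall U, F U -> Rprod F U) : Prop :=
  [/\ B_linear T,
      forall U (m : F U), T U m 0%N = R1 m
    & forall i U (a : O U) (m : F U), (0 < i)%N ->
        T U (a *: m) i = a *: T U m i +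
          \sum_(j < i) aQ O U (j.+1%:R^-1) *:
            Rmul (ext_deg j) (T U (D a) j) (T U m (i - j.+1)%N)].

Definition Sprod_one U : Sprod F U :=
  fun n => match n return Spow F n U with 0 => Sone F U | _.+1 => 0 end.

Lemma Smul_deg n (i : 'I_n.+1) : (i + (n - i) = n)%N.
Proof. by rewrite subnKC // -ltnS. Qed.

Definition Sprod_mul U (u v : Sprod F U) : Sprod F U :=
  fun n => \sum_(i < n.+1) Smul (Smul_deg i) (u i) (v (n - i)%N).

Definition hasse_derivation (h : forall U, O U -> Sprod F U) : Prop :=
  [/\ @B_linear (selfMod O) (Sprod F) h,
      forall U, h U 1 = Sprod_one U,
      forall U a b, h U (a * b) = Sprod_mul (h U a) (h U b)
    & forall U a, h U a 0%N = S0 F a].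

Definition hasse_extends (h : forall U, O U -> Sprod F U) : Prop :=
  forall U (a : O U), h U a 1%N = S1 (D a).

Definition hasse_iterated (h : forall U, O U -> Sprod F U) : Prop :=
  exists2 T, ext_connection T &
    forall i U (a : O U),
      h U a i.+1 = R_to_S (aQ O U (i.+1%:R^-1) *: T U (D a) i).

Definition algebra_automorphism (phi : forall U, Sprod F U -> Sprod F U) : Prop :=
  [/\ O_linear phi,
      forall U, phi U (Sprod_one U) = Sprod_one U,
      forall U u v, phi U (Sprod_mul u v) = Sprod_mul (phi U u) (phi U v)
    & forall U, bijective (phi U)].

(* phi is the sum of homogeneous parts of degrees q >= 0, the one of degree 0
   inducing the identity on F = S^1. The part of degree q = n - p on S^p is
   phi_ p n, for p <= n. *)
Definition graded_unipotent (phi : forall U, Sprod F U -> Sprod F U) : Prop :=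
  exists phi_ : forall p n U, Spow F p U -> Spow F n U,
    [/\ forall p n, (p <= n)%N -> O_linear (phi_ p n),
        forall U (w : Sprod F U) n,
          phi U w n = \sum_(p < n.+1) phi_ p n U (w p)
      & forall U (m : F U), phi_ 1%N 1%N U (S1 m) = S1 m].

Definition equivalence_of (h h' : forall U, O U -> Sprod F U)
    (phi : forall U, Sprod F U -> Sprod F U) : Prop :=
  [/\ algebra_automorphism phi, graded_unipotent phi
    & forall U a, h' U a = phi U (h U a)].

Definition hasse_equivalent (h h' : forall U, O U -> Sprod F U) : Prop :=
  exists phi, equivalence_of h h' phi.

Definition canonically_equivalent (h h' : forall U, O U -> Sprod F U) : Prop :=
  exists! phi, equivalence_of h h' phi.

End Definitions.

(* Main.v *)
Require Import Defs.
From HB Require Import structures.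
From mathcomp Require Import all_boot perm all_algebra.
From mathcomp Require Import boolp classical_sets topology_structure.

Set Implicit Arguments.
Unset Strict Implicit.
Unset Printing Implicit Defensive.

Import GRing.Theory.
Local Open Scope ring_scope.

(** Work in S(F + F), writing x and y for the two copies of F; its part linear in
    y is S(F) (x) F, and d denotes the derivation x |-> y, y |-> 0.

    Call a map h from O to S(F), with leading term the identity, a base if
    d (h a) = H (D a) for an h-semilinear map H from F to S(F + F) with leading
    term y.  If h is a base and h' is iterated, and T' is the symmetrization of its
    extended connection, then h' = phi h for an automorphism phi: let Theta be the
    algebra map x |-> phi x, y |-> E (phi y), where E is the Euler derivation
    (multiplication by the degree); then Theta (d u) = E (phi u), so that E (phi h) = Theta H D, whereas
    E h' = T' D.  One therefore solves Theta H = T' for phi, degree by degree; the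
    two sides have the same Leibniz rule modulo lower degrees, which makes the
    corrections O-linear.  Moreover phi h is again a base.

    A flat connection gives a base: it extends to a derivation nabla of S(F + F)
    and h = exp(nabla).  With K = [d, nabla] and C = [K, nabla], flatness means
    that C kills O, so that C = c d on the x-part for an S(F)-linear map c, and
    (d, K) intertwines nabla with (u, v) |-> (nabla u + v, nabla v + c u).  This is
    the Jacobi equation along geodesics, and its solution with initial value (0, y)
    is H.

    Hence the two given Hasse derivations are related through exp(nabla).  If phi
    and phi' both map h to h', their lowest-degree difference on F kills D(O). *)

(** * The completed symmetric algebra as a sheaf of rings *)

(** The equation h' = phi h constrains phi only on D(O), which need not generate F, whereas phi is
    given by an O-linear map on all of F. The comparison is therefore made on F, where H and T' are
    both defined: Theta H = T' gives h' = phi h after substitution of D(a), because E is injective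
    in positive degrees over a Q-algebra.

    Setting y = x turns d into E, so the condition d (h a) = H (D a) is a polarized form of E h' =
    T' D, and the latter is just the definition of an iterated Hasse derivation with denominators
    cleared. The polarized form is not part of the data of an iterated derivation; integrability is
    what produces a first instance of it.

    Flatness is weaker than vanishing curvature: C kills O but not the generators x, so K and nabla
    do not commute. This is why the iteration for H runs on pairs (u, v) and carries the term c
    u. *)

Lemma nth_codom_ord (A : comPzRingType) (M : lmodType A) n (s : 'I_n -> M) (k : 'I_n) :
  nth 0 (codom s) k = s k.
Proof. by rewrite codomE (nth_map k) ?size_enum_ord // nth_ord_enum. Qed.

(** Reading a generator as the list of its values turns [catf] into concatenation, so that
    commutativity and associativity of the product need no casts between ordinals. *)
Lemma codom_catf (A : comPzRingType) (M : lmodType A) i j n (e : (i + j = n)%N)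
    (s : 'I_i -> M) (t : 'I_j -> M) :
  codom (catf e s t) = codom s ++ codom t.
Proof.
case: n / e; apply: (@eq_from_nth _ 0); first by rewrite size_cat !size_codom !card_ord.
move=> k; rewrite size_codom card_ord => lt_k.
rewrite (nth_codom_ord _ (Ordinal lt_k)) nth_cat size_codom card_ord.
rewrite /catf cast_ord_id; case: splitP => a /= -> .
  by rewrite ltn_ord nth_codom_ord.
by rewrite ltnNge leq_addr addKn nth_codom_ord.
Qed.

Lemma sym_gen_perm_eq (A : comPzRingType) (M : lmodType A) n (s t : 'I_n -> M) :
  perm_eq (codom s) (codom t) -> sym_gen s = sym_gen t.
Proof.
rewrite (codomE t).
have -> : [seq t x | x <- enum 'I_n] = [tuple t x | x < n] by [].
case/tuple_permP => p E; rewrite -(sym_gen_perm t p); congr sym_gen.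
apply/funext => k; rewrite -nth_codom_ord E -(nth_codom_ord (t \o p)); congr (nth _ _ _).
by rewrite codomE /=; apply: eq_map => x; rewrite tnth_mktuple.
Qed.

Section SymPowers.
Variables (X : topologicalType) (O : algSheaf X) (E : modSheaf O).
Implicit Types (U V : opens X).

Lemma Sgen_perm_eq n U (s t : 'I_n -> E U) :
  perm_eq (codom s) (codom t) -> Sgen s = Sgen t.
Proof. by move=> st; rewrite /Sgen (sym_gen_perm_eq st). Qed.

(** Sections of the associated sheaf come from the presheaf only locally, hence a predicate over all
    open sets together with a locality hypothesis. *)
Lemma Spow_ind n (P : forall U, Spow E n U -> Prop) :
  (forall U (w : Spow E n U), (forall x, opset U x -> exists V (h : opsub V U),
     opset V x /\ P V (pres h w)) -> P U w) ->
  (forall U, P U 0) ->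
  (forall U u v, P U u -> P U v -> P U (u + v)) ->
  (forall U (a : O U) u, P U u -> P U (a *: u)) ->
  (forall U (t : 'I_n -> E U), P U (Sgen t)) ->
  forall U w, P U w.
Proof.
move=> Ploc P0 PD PZ Pg U w; apply: Ploc => x Ux.
have [V [h [p [Vx wp]]]] := eta_loc w Ux; exists V, h; split=> //.
rewrite wp {wp Vx h x Ux w U}.
have H := @eta_lin _ _ (sympre E n) V; have eta0 := semilinear0 H.
elim/pmod_ind: p => [|p q Pp Pq|a p Pp|t].
- by rewrite eta0.
- by rewrite (semilinearD H); exact: PD.
- by rewrite (semilinearZ _ _ H); exact: PZ.
- exact: Pg.
Qed.

(** A morphism of sheaves over U only: multiplication by a section over U is not defined on larger
    open sets. *)
Definition loc_linear (M N : modSheaf O) U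
    (S : forall V, opsub V U -> M V -> N V) : Prop :=
  (forall V W (h : opsub V U) (k : opsub W V) (l : opsub W U) m,
     pres k (S V h m) = S W l (pres k m)) /\
  forall V (h : opsub V U), Defs.semilinear idfun (S V h).

Lemma Spow_lin_eq n (N : modSheaf O) U (S T : forall V, opsub V U -> Spow E n V -> N V) :
  loc_linear S -> loc_linear T ->
  (forall V h t, S V h (Sgen t) = T V h (Sgen t)) ->
  forall V h w, S V h w = T V h w.
Proof.
move=> [Sr Sl] [Tr Tl] ST V h w; move: V w h.
apply: Spow_ind => [V w Pw h|V h|V u v Pu Pv h|V a u Pu h|V t h].
- apply: sheaf_sep => x /Pw [W [k [Wx Pw']]]; exists W, k; split=> //.
  by rewrite (Sr _ _ _ _ (opsub_trans h k)) (Tr _ _ _ _ (opsub_trans h k)).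
- by rewrite (semilinear0 (Sl _ _)) (semilinear0 (Tl _ _)).
- by rewrite (semilinearD (Sl _ _)) (semilinearD (Tl _ _)) Pu Pv.
- by rewrite (semilinearZ _ _ (Sl _ _)) (semilinearZ _ _ (Tl _ _)) Pu.
- exact: ST.
Qed.

Lemma Sgen_res n U V (h : opsub V U) (t : 'I_n -> E U) :
  pres h (Sgen t) = Sgen (fun i => pres h (t i)).
Proof. by rewrite /Sgen eta_res /= /sympre_res (sym_map_gen (pres_lin h)). Qed.

Lemma loc_linear_Smull i j n (e : (i + j = n)%N) U (y : Spow E j U) :
  loc_linear (fun V (h : opsub V U) (x : Spow E i V) => Smul e x (pres h y)).
Proof.
split=> [V W h k l m|V h]; last exact: Smul_linl.
by rewrite Smul_res (pres_comp h k l).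
Qed.

Lemma loc_linear_Smulr i j n (e : (i + j = n)%N) U (x : Spow E i U) :
  loc_linear (fun V (h : opsub V U) (y : Spow E j V) => Smul e (pres h x) y).
Proof.
split=> [V W h k l m|V h]; last exact: Smul_linr.
by rewrite Smul_res (pres_comp h k l).
Qed.

Lemma loc_linear_comp (M N N' : modSheaf O) U (S : forall V, opsub V U -> M V -> N V)
    (T : forall V, opsub V U -> N V -> N' V) :
  loc_linear S -> loc_linear T -> loc_linear (fun V h m => T V h (S V h m)).
Proof.
move=> [Sr Sl] [Tr Tl]; split=> [V W h k l m|V h a m m'].
  by rewrite (Tr _ _ _ _ l) (Sr _ _ _ _ l).
by rewrite Sl Tl.
Qed.

Lemma SmulC i j n (e : (i + j = n)%N) (e' : (j + i = n)%N) U (s : Spow E i U) (t : Spow E j U) :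
  Smul e s t = Smul e' t s.
Proof.
have H V (h : opsub V U) (g : 'I_i -> E V) :
    Smul e (Sgen g) (pres h t) = Smul e' (pres h t) (Sgen g).
  have := @Spow_lin_eq _ _ V _ _ (loc_linear_Smulr e (Sgen g)) (loc_linear_Smull e' (Sgen g)).
  move=> /(_ _ V (@opsub_refl _ _) (pres h t)); rewrite !pres_id; apply=> W k g'.
  by rewrite Sgen_res !Smul_gen; apply: Sgen_perm_eq; rewrite !codom_catf perm_catC.
have := @Spow_lin_eq _ _ U _ _ (loc_linear_Smull e t) (loc_linear_Smulr e' t).
by move=> /(_ H U (@opsub_refl _ _) s); rewrite !pres_id.
Qed.

Lemma SmulA i j k n m l (e1 : (i + j = m)%N) (e2 : (m + k = n)%N) (e3 : (j + k = l)%N)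
    (e4 : (i + l = n)%N) U (s : Spow E i U) (t : Spow E j U) (u : Spow E k U) :
  Smul e2 (Smul e1 s t) u = Smul e4 s (Smul e3 t u).
Proof.
have H1 V (h : opsub V U) (g : 'I_i -> E V) (g' : 'I_j -> E V) :
    Smul e2 (Smul e1 (Sgen g) (Sgen g')) (pres h u) =
    Smul e4 (Sgen g) (Smul e3 (Sgen g') (pres h u)).
  have := @Spow_lin_eq _ _ V _ _ (loc_linear_Smulr e2 (Smul e1 (Sgen g) (Sgen g')))
    (loc_linear_comp (loc_linear_Smulr e3 (Sgen g')) (loc_linear_Smulr e4 (Sgen g))).
  move=> /(_ _ V (@opsub_refl _ _) (pres h u)); rewrite !pres_id; apply=> W q g''.
  rewrite Smul_res !Sgen_res !Smul_gen; apply: Sgen_perm_eq.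
  by rewrite !codom_catf catA perm_refl.
have H2 V (h : opsub V U) (g : 'I_i -> E V) :
    Smul e2 (Smul e1 (Sgen g) (pres h t)) (pres h u) =
    Smul e4 (Sgen g) (Smul e3 (pres h t) (pres h u)).
  have := @Spow_lin_eq _ _ V _ _
    (loc_linear_comp (loc_linear_Smulr e1 (Sgen g)) (loc_linear_Smull e2 (pres h u)))
    (loc_linear_comp (loc_linear_Smull e3 (pres h u)) (loc_linear_Smulr e4 (Sgen g))).
  move=> /(_ _ V (@opsub_refl _ _) (pres h t)); rewrite !pres_id; apply=> W q g'.
  by rewrite Sgen_res (pres_comp _ _ (opsub_trans h q)) H1.
have := @Spow_lin_eq _ _ U _ _
  (loc_linear_comp (loc_linear_Smull e1 t) (loc_linear_Smull e2 u))
  (loc_linear_Smull e4 (Smul e3 t u)).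
move=> /(_ _ U (@opsub_refl _ _) s); rewrite !pres_id; apply=> W q g.
by rewrite H2 Smul_res.
Qed.

Lemma Smul1 n (e : (0 + n = n)%N) U (s : Spow E n U) : Smul e (Sone E U) s = s.
Proof.
have lid : loc_linear (fun V (h : opsub V U) (x : Spow E n V) => x) by [].
have := @Spow_lin_eq _ _ U _ _ (loc_linear_Smulr e (Sone E U)) lid.
move=> /(_ _ U (@opsub_refl _ _) s); rewrite !pres_id; apply=> W q g.
rewrite /Sone Sgen_res Smul_gen; apply: Sgen_perm_eq.
rewrite codom_catf (_ : codom _ = [::]) ?cat0s //.
by apply/nilP; rewrite /nilp size_codom card_ord.
Qed.

End SymPowers.

(* An alias of Sprod that carries the ring structure. *)
Definition Salg (X : topologicalType) (O : algSheaf X) (E : modSheaf O) (U : opens X) : Type :=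
  Sprod E U.

Section SymRing.
Variables (X : topologicalType) (O : algSheaf X) (E : modSheaf O).
Implicit Types (U V : opens X).

HB.instance Definition _ U := GRing.Lmodule.copy (Salg E U) (psec (Sprod E) U).

Lemma Salg_ext U (u v : Salg E U) : (forall n, u n = v n) -> u = v.
Proof. by move=> uv; apply: functional_extensionality_dep. Qed.

Lemma Salg_D U (u v : Salg E U) n : (u + v) n = u n + v n. Proof. by []. Qed.
Lemma Salg_N U (u : Salg E U) n : (- u) n = - u n. Proof. by []. Qed.
Lemma Salg_Z U a (u : Salg E U) n : (a *: u) n = a *: u n. Proof. by []. Qed.
Lemma Salg_sum U I (r : seq I) (P : pred I) (F : I -> Salg E U) n :
  (\sum_(i <- r | P i) F i) n = \sum_(i <- r | P i) F i n.
Proof. by elim/big_rec2: _ => // i u v _ <-. Qed.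

(** The transport along [n = k] is independent of the chosen equality proof, so it disappears at
    [k = n] ([homog_id]). *)
Definition homog n U (s : Spow E n U) : Salg E U :=
  fun k => if pselect (n = k) is left e then ecast k (Spow E k U) e s else 0.

Lemma homog_id n U (s : Spow E n U) : homog s n = s.
Proof. by rewrite /homog; case: pselect => // e; rewrite (Prop_irrelevance e erefl). Qed.

Lemma homog_neq n k U (s : Spow E n U) : n != k -> homog s k = 0.
Proof. by move=> /eqP nk; rewrite /homog; case: pselect. Qed.

Lemma homog_lin n U a (s t : Spow E n U) : homog (a *: s + t) = a *: homog s + homog t.
Proof.
apply: Salg_ext => k; rewrite Salg_D Salg_Z; have [<-|nk] := eqVneq n k.
  by rewrite !homog_id.
by rewrite !homog_neq // scaler0 addr0.
Qed.

Lemma homogD n U : {morph @homog n U : s t / s + t}.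
Proof. by move=> s t; rewrite -[s]scale1r homog_lin !scale1r. Qed.
Lemma homog0 n U : homog (0 : Spow E n U) = 0.
Proof. by apply: (addrI (homog (0 : Spow E n U))); rewrite -homogD !addr0. Qed.
Lemma homogZ n U a (s : Spow E n U) : homog (a *: s) = a *: homog s.
Proof. by rewrite -[a *: s]addr0 homog_lin homog0 addr0. Qed.
Lemma homog_sum n U I (r : seq I) (P : pred I) (F : I -> Spow E n U) :
  homog (\sum_(i <- r | P i) F i) = \sum_(i <- r | P i) homog (F i).
Proof. exact: (big_morph _ (@homogD n U) (@homog0 n U)). Qed.

Definition hpart n U (w : Salg E U) : Salg E U := homog (w n).

Lemma hpart_eq n U (u v : Salg E U) : hpart n u = hpart n v -> u n = v n.
Proof. by move/(congr1 (fun w : Salg E U => w n)); rewrite /hpart !homog_id. Qed.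

Lemma hpartP U (u v : Salg E U) : (forall n, hpart n u = hpart n v) -> u = v.
Proof. by move=> uv; apply: Salg_ext => n; exact: hpart_eq. Qed.

Definition fil n U (w : Salg E U) : Prop := forall k, (k < n)%N -> w k = 0.

Lemma fil0 n U : fil n (0 : Salg E U). Proof. by []. Qed.
Lemma filD n U (u v : Salg E U) : fil n u -> fil n v -> fil n (u + v).
Proof. by move=> un vn k kn; rewrite Salg_D un ?vn ?addr0. Qed.
Lemma filN n U (u : Salg E U) : fil n u -> fil n (- u).
Proof. by move=> un k kn; rewrite Salg_N un ?oppr0. Qed.
Lemma filB n U (u v : Salg E U) : fil n u -> fil n v -> fil n (u - v).
Proof. by move=> un vn; apply/filD/filN. Qed.
Lemma filZ n U a (u : Salg E U) : fil n u -> fil n (a *: u).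
Proof. by move=> un k kn; rewrite Salg_Z un ?scaler0. Qed.
Lemma filW m n U (u : Salg E U) : (m <= n)%N -> fil n u -> fil m u.
Proof. by move=> mn un k km; apply/un/(leq_trans km). Qed.
Lemma fil_homog n U (s : Spow E n U) : fil n (homog s).
Proof. by move=> k kn; rewrite homog_neq // neq_ltn kn orbT. Qed.
Lemma filS n U (u : Salg E U) : fil n u -> u n = 0 -> fil n.+1 u.
Proof. by move=> un u0 k; rewrite ltnS leq_eqVlt => /predU1P[->|/un]. Qed.
Lemma fil_eq0 U (u : Salg E U) : (forall n, fil n u) -> u = 0.
Proof. by move=> un; apply: Salg_ext => n; apply: (un n.+1). Qed.

Definition trunc n U (u : Salg E U) : Salg E U := \sum_(i < n) hpart i u.

Lemma fil_trunc n U (u : Salg E U) : fil n (u - trunc n u).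
Proof.
move=> k kn; rewrite Salg_D Salg_N /trunc Salg_sum (bigD1 (Ordinal kn)) //= /hpart homog_id.
by rewrite big1 ?addr0 ?subrr // => i ik; rewrite homog_neq.
Qed.

End SymRing.

(** * Additive maps compatible with the degree filtration *)

Section Filtered.
Variables (X : topologicalType) (O : algSheaf X) (E E' : modSheaf O) (U : opens X).

(** This is the continuity used throughout. It makes a map determined by its values on homogeneous
    elements ([filtered_eq]), and without O-linearity it also covers derivations that act on
    scalars. *)
Definition filtered (S : Salg E U -> Salg E' U) : Prop :=
  {morph S : u v / u + v} /\ forall n u, fil n u -> fil n (S u).

Variable S : Salg E U -> Salg E' U.
Hypothesis Sf : filtered S.

Lemma filtered0 : S 0 = 0.
Proof. by apply: (addrI (S 0)); rewrite -Sf.1 !addr0. Qed.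
Lemma filteredN : {morph S : u / - u}.
Proof. by move=> u; apply: (addrI (S u)); rewrite -Sf.1 !subrr filtered0. Qed.
Lemma filteredB : {morph S : u v / u - v}.
Proof. by move=> u v; rewrite Sf.1 filteredN. Qed.
Lemma filtered_sum I (r : seq I) (P : pred I) (F : I -> Salg E U) :
  S (\sum_(i <- r | P i) F i) = \sum_(i <- r | P i) S (F i).
Proof. exact: (big_morph _ Sf.1 filtered0). Qed.

Lemma filtered_trunc n u : S u n = S (trunc n.+1 u) n.
Proof.
have := Sf.2 _ _ (@fil_trunc _ _ _ n.+1 _ u) n (ltnSn n).
by rewrite filteredB Salg_D Salg_N => /eqP; rewrite subr_eq0 => /eqP.
Qed.

End Filtered.

Lemma filtered_comp (X : topologicalType) (O : algSheaf X) (E E' E'' : modSheaf O) (U : opens X)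
    (S : Salg E U -> Salg E' U) (T : Salg E' U -> Salg E'' U) :
  filtered S -> filtered T -> filtered (fun u => T (S u)).
Proof. by move=> [SD Sf] [TD Tf]; split=> [u v|n u un] /=; rewrite ?SD ?TD //; exact/Tf/Sf. Qed.

Lemma filtered_eq (X : topologicalType) (O : algSheaf X) (E E' : modSheaf O) (U : opens X)
    (S T : Salg E U -> Salg E' U) : filtered S -> filtered T ->
  (forall n (s : Spow E n U), S (homog s) = T (homog s)) -> S =1 T.
Proof.
move=> Sf Tf ST u; apply: Salg_ext => n.
rewrite (filtered_trunc Sf) (filtered_trunc Tf) /trunc !filtered_sum //.
by rewrite (eq_bigr _ (fun i _ => ST _ _)).
Qed.

(** * The ring structure *)

Section Mul.
Variables (X : topologicalType) (O : algSheaf X) (E : modSheaf O).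
Implicit Types (U V : opens X).

Definition smul U (u v : Salg E U) : Salg E U := Sprod_mul u v.

Lemma smulDl U : left_distributive (@smul U) +%R.
Proof.
move=> u v w; apply: Salg_ext => n; rewrite Salg_D /smul /Sprod_mul -big_split /=.
by apply: eq_bigr => i _; rewrite Salg_D (semilinearD (Smul_linl _ _)).
Qed.

Lemma smulDr U : right_distributive (@smul U) +%R.
Proof.
move=> u v w; apply: Salg_ext => n; rewrite Salg_D /smul /Sprod_mul -big_split /=.
by apply: eq_bigr => i _; rewrite Salg_D (semilinearD (Smul_linr _ _)).
Qed.

Lemma Smul0l i j n (e : (i + j = n)%N) U (x : Spow E j U) : Smul e (0 : Spow E i U) x = 0.
Proof. exact: (semilinear0 (Smul_linl e x)). Qed.
Lemma Smul0r i j n (e : (i + j = n)%N) U (x : Spow E i U) : Smul e x (0 : Spow E j U) = 0.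
Proof. exact: (semilinear0 (Smul_linr e x)). Qed.

Lemma fil_smul i j U (u v : Salg E U) : fil i u -> fil j v -> fil (i + j) (smul u v).
Proof.
move=> ui vj n nij; rewrite /smul /Sprod_mul big1 // => k _.
have [ki|ik] := ltnP k i; first by rewrite ui // Smul0l.
by rewrite (vj (n - k)%N) ?Smul0r // ltn_subLR ?(leq_trans nij) ?leq_add2r // -ltnS.
Qed.

Lemma smul_homog i j n (e : (i + j = n)%N) U (s : Spow E i U) (t : Spow E j U) :
  smul (homog s) (homog t) = homog (Smul e s t).
Proof.
apply: Salg_ext => m; rewrite /smul /Sprod_mul; case: n / e.
(* The degrees are made variables so that the equations can be substituted, which removes the
   transport hidden in [homog]. *)
have H (k l p : nat) (e : (k + l = p)%N) : k = i -> l = j ->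
    Smul e (homog s k) (homog t l) = homog (Smul erefl s t) p.
  by move=> ki lj; subst k l p; rewrite !homog_id.
have [<-|nm] := eqVneq (i + j)%N m.
  have il : (i < (i + j).+1)%N by rewrite ltnS leq_addr.
  rewrite (bigD1 (Ordinal il)) //= H ?addKn // big1 ?addr0 // => k.
  by move=> ki; rewrite homog_neq ?Smul0l // eq_sym.
rewrite homog_neq // big1 // => k _; have [ki|ki] := eqVneq i k; last first.
  by rewrite homog_neq // Smul0l.
rewrite [X in Smul _ _ X]homog_neq ?Smul0r //.
by apply: contra nm => /eqP ->; rewrite ki subnKC // -ltnS.
Qed.

Lemma filtered_smull U (v : Salg E U) : filtered (fun u => smul u v).
Proof.
split=> [u w|n u un]; first exact: smulDl.
by rewrite -[n]addn0; apply: fil_smul.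
Qed.

Lemma filtered_smulr U (v : Salg E U) : filtered (fun u => smul v u).
Proof.
split=> [u w|n u un]; first exact: smulDr.
by rewrite -[n]add0n; apply: fil_smul.
Qed.

Lemma hpart_smul n U (u v : Salg E U) :
  hpart n (smul u v) = \sum_(i < n.+1) smul (hpart i u) (hpart (n - i) v).
Proof.
by rewrite /hpart homog_sum; apply: eq_bigr => i _; rewrite (smul_homog (Smul_deg i)).
Qed.

Lemma smulC U : commutative (@smul U).
Proof.
move=> u v; apply: hpartP => n; rewrite !hpart_smul (reindex_inj rev_ord_inj) /=.
apply: eq_bigr => i _; rewrite subSS subKn; last by rewrite -ltnS.
by rewrite /hpart (smul_homog erefl) (SmulC _ (addnC i _)) (smul_homog (addnC i (n - i)%N)).
Qed.

(** Both sides are additive and continuous in each variable, so homogeneous factors suffice. *)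
Lemma smulA U : associative (@smul U).
Proof.
move=> u v w.
have fl (a : Salg E U) : filtered ((@smul U)^~ a) by exact: filtered_smull.
have fr (a : Salg E U) : filtered (smul a) by exact: filtered_smulr.
apply: (filtered_eq (fl _) (filtered_comp (fl v) (fl w))) u => i s.
apply: (filtered_eq (filtered_comp (fl w) (fr _)) (filtered_comp (fr _) (fl w))) v => j t.
apply: (filtered_eq (filtered_comp (fr _) (fr _)) (fr _)) w => k x /=.
rewrite (smul_homog (erefl (j + k)%N)) (smul_homog (addnA i j k)).
rewrite (smul_homog (erefl (i + j)%N)) (smul_homog (erefl (i + j + k)%N)).
by rewrite (SmulA _ _ erefl (addnA i j k)).
Qed.

Lemma sone_homog U : Sprod_one E U = homog (Sone E U).
Proof. by apply: Salg_ext => -[|n]; rewrite ?homog_id // homog_neq. Qed.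

Lemma smul1 U : left_id (Sprod_one E U : Salg E U) (@smul U).
Proof.
have f1 : filtered (@smul U (Sprod_one E U)) by exact: filtered_smulr.
have f2 : @filtered _ _ E E U idfun by [].
by apply: (filtered_eq f1 f2) => n s; rewrite sone_homog (smul_homog (add0n n)) Smul1.
Qed.

HB.instance Definition _ U := GRing.Zmodule_isComPzRing.Build (Salg E U)
  (@smulA U) (@smulC U) (@smul1 U) (@smulDl U).

Lemma Salg_mulE U (u v : Salg E U) : u * v = Sprod_mul u v. Proof. by []. Qed.

Lemma Salg_scaleAl U a (u v : Salg E U) : a *: u * v = a *: (u * v).
Proof.
apply: Salg_ext => n; rewrite Salg_Z !Salg_mulE /Sprod_mul scaler_sumr.
by apply: eq_bigr => i _; rewrite Salg_Z (semilinearZ _ _ (Smul_linl _ _)).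
Qed.

Lemma Salg_scaleAr U a (u v : Salg E U) : u * (a *: v) = a *: (u * v).
Proof. by rewrite mulrC Salg_scaleAl mulrC. Qed.

End Mul.

(** * Restrictions, scalars and generators of degree one *)

Section Gen.
Variables (X : topologicalType) (O : algSheaf X) (E : modSheaf O).
Implicit Types (U V : opens X).

Definition sres U V (h : opsub V U) (w : Salg E U) : Salg E V := pres h w.

Lemma sresE U V (h : opsub V U) (w : Salg E U) n : sres h w n = pres h (w n).
Proof. by []. Qed.
Lemma sres_comp U V W (h : opsub V U) (k : opsub W V) (l : opsub W U) w :
  sres k (sres h w) = sres l w.
Proof. exact: pres_comp. Qed.
Lemma sres_id U (h : opsub U U) w : sres h w = w.
Proof. exact: pres_id. Qed.
Lemma sresD U V (h : opsub V U) : {morph @sres U V h : u v / u + v}.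
Proof. exact: presD. Qed.
Lemma sres0 U V (h : opsub V U) : sres h 0 = 0.
Proof. exact: pres0. Qed.
Lemma sresZ U V (h : opsub V U) a (u : Salg E U) : sres h (a *: u) = ares O h a *: sres h u.
Proof. exact: presZ. Qed.
Lemma sresN U V (h : opsub V U) : {morph @sres U V h : u / - u}.
Proof. by move=> u; apply: (addrI (sres h u)); rewrite -sresD !subrr sres0. Qed.
Lemma sres_sum U V (h : opsub V U) I (r : seq I) (P : pred I) (F : I -> Salg E U) :
  sres h (\sum_(i <- r | P i) F i) = \sum_(i <- r | P i) sres h (F i).
Proof. exact: (big_morph _ (@sresD U V h) (@sres0 U V h)). Qed.
Lemma sres_homog U V (h : opsub V U) n (s : Spow E n U) : sres h (homog s) = homog (pres h s).
Proof.
apply: Salg_ext => k; rewrite sresE; have [<-|nk] := eqVneq n k; first by rewrite !homog_id.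
by rewrite !homog_neq // pres0.
Qed.
Lemma sresM U V (h : opsub V U) : {morph @sres U V h : u v / u * v}.
Proof.
move=> u v; apply: Salg_ext => n; rewrite sresE !Salg_mulE /Sprod_mul.
rewrite (big_morph _ (presD (P := Spow E n) h) (pres0 (Spow E n) h)).
by apply: eq_bigr => i _; rewrite Smul_res.
Qed.
Lemma sres1 U V (h : opsub V U) : sres h 1 = 1.
Proof.
rewrite [LHS](_ : _ = sres h (homog (Sone E U))); last by congr sres; exact: sone_homog.
rewrite sres_homog [RHS]sone_homog; congr homog; rewrite /Sone Sgen_res; congr Sgen.
by apply/funext => i; rewrite pres0.
Qed.

Lemma sres_sep U (u v : Salg E U) :
  (forall x, opset U x -> exists V (h : opsub V U), opset V x /\ sres h u = sres h v) -> u = v.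
Proof. exact: sheaf_sep. Qed.

Lemma fil_loc n U (u : Salg E U) :
  (forall x, opset U x -> exists V (h : opsub V U), opset V x /\ fil n (sres h u)) -> fil n u.
Proof.
move=> H k kn; apply: sheaf_sep => x /H [V [h [Vx Hu]]]; exists V, h; split=> //.
by rewrite pres0 -sresE Hu.
Qed.

Definition scal U (a : O U) : Salg E U := a *: (1 : Salg E U).

Lemma scale_scal U a (u : Salg E U) : a *: u = scal a * u.
Proof. by rewrite /scal Salg_scaleAl mul1r. Qed.
Lemma scalD U : {morph @scal U : a b / a + b}. Proof. exact: scalerDl. Qed.
Lemma scalM U : {morph @scal U : a b / a * b}.
Proof. by move=> a b; rewrite /scal Salg_scaleAl mul1r scalerA. Qed.
Lemma scal1 U : scal (1 : O U) = 1. Proof. exact: scale1r. Qed.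
Lemma scal0 U : scal (0 : O U) = 0. Proof. exact: scale0r. Qed.
Lemma scalN U : {morph @scal U : a / - a}. Proof. by move=> a; rewrite /scal scaleNr. Qed.
Lemma sres_scal U V (h : opsub V U) a : sres h (scal a) = scal (ares O h a).
Proof. by rewrite /scal sresZ sres1. Qed.

Lemma scal_homog U (a : O U) : scal a = homog (S0 E a).
Proof. by rewrite /S0 homogZ -sone_homog. Qed.

Definition deg1 U (m : E U) : Salg E U := homog (S1 m).

Lemma deg1_lin U a (m m' : E U) : deg1 (a *: m + m') = scal a * deg1 m + deg1 m'.
Proof. by rewrite /deg1 S1_lin homog_lin scale_scal. Qed.
Lemma deg1D U : {morph @deg1 U : m m' / m + m'}.
Proof. by move=> m m'; rewrite -[m]scale1r deg1_lin scal1 mul1r scale1r. Qed.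
Lemma sres_deg1 U V (h : opsub V U) m : sres h (deg1 m) = deg1 (pres h m).
Proof. by rewrite /deg1 sres_homog S1_res. Qed.
Lemma fil_deg1 U (m : E U) : fil 1 (deg1 m). Proof. exact: fil_homog. Qed.

Lemma homogM i j n (e : (i + j = n)%N) U (s : Spow E i U) (t : Spow E j U) :
  homog s * homog t = homog (Smul e s t).
Proof. exact: smul_homog. Qed.

Lemma filM i j U (u v : Salg E U) : fil i u -> fil j v -> fil (i + j) (u * v).
Proof. exact: fil_smul. Qed.

Lemma filMl i U (u v : Salg E U) : fil i v -> fil i (u * v).
Proof. by move=> vi; rewrite -[i]add0n; apply: filM. Qed.
Lemma filMr i U (u v : Salg E U) : fil i u -> fil i (u * v).
Proof. by rewrite mulrC; exact: filMl. Qed.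

Lemma homog_Sgen n U (t : 'I_n -> E U) : homog (Sgen t) = \prod_(i < n) deg1 (t i).
Proof.
have -> : \prod_(i < n) deg1 (t i) = \prod_(x <- codom t) deg1 x.
  by rewrite codomE big_map big_enum.
(* Induction on the list of values lets [n] vary with its length. *)
have [l] : exists l, codom t = l by exists (codom t).
elim: l n t => [|x l IHl] n t tl.
  have n0 : n = 0%N by rewrite -(card_ord n) -(size_codom t) tl.
  subst n; rewrite tl big_nil [RHS]sone_homog; congr homog; apply: Sgen_perm_eq.
  by rewrite tl (_ : codom _ = [::]) //; apply/nilP; rewrite /nilp size_codom card_ord.
have n0 : (1 + size l = n)%N by rewrite -(card_ord n) -(size_codom t) tl.
pose t' (i : 'I_(size l)) := nth 0 l i.
have t'l : codom t' = l.
  apply: (@eq_from_nth _ 0); rewrite size_codom card_ord // => i il.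
  by rewrite (nth_codom_ord _ (Ordinal il)).
rewrite tl big_cons -{1}t'l -IHl // /deg1 (homogM n0) /S1 Smul_gen; congr homog.
apply: Sgen_perm_eq; rewrite tl codom_catf t'l.
rewrite (_ : codom _ = [:: x]) // codomE.
have H (I : Type) (r : seq I) : [seq x | _ <- r] = nseq (size r) x by elim: r => //= a r ->.
by rewrite H size_enum_ord.
Qed.

Lemma gen_ind (P : nat -> forall U, Salg E U -> Prop) :
  (forall n U (w : Salg E U), (forall x, opset U x -> exists V (h : opsub V U),
     opset V x /\ P n V (sres h w)) -> P n U w) ->
  (forall n U u v, P n U u -> P n U v -> P n U (u + v)) ->
  (forall U a, P 0%N U (scal a)) -> (forall U m, P 1%N U (deg1 m)) ->
  (forall i j U u v, P i U u -> P j U v -> P (i + j)%N U (u * v)) ->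
  forall n U (s : Spow E n U), P n U (homog s).
Proof.
move=> Ploc PD Po P1 PM n.
have PZ k U a u : P k U u -> P k U (a *: u).
  by move=> Pu; rewrite scale_scal -[k]add0n; apply: PM.
have Pgen U (t : 'I_n -> E U) : P n U (homog (Sgen t)).
  rewrite homog_Sgen (_ : \prod_i _ = \prod_(x <- codom t) deg1 x); last first.
    by rewrite codomE big_map big_enum.
  rewrite -{1}(card_ord n) -(size_codom t); elim: (codom t) => [|x l IHl] /=.
    by rewrite big_nil -scal1; exact: Po.
  by rewrite big_cons -add1n; apply: PM.
apply: Spow_ind => [U w Pw|U|U u v Pu Pv|U a u Pu|U t].
- apply: Ploc => x /Pw [V [h [Vx Pw']]]; exists V, h; split=> //.
  by rewrite sres_homog.
(* The case of 0 is not among the hypotheses on [P]; it is zero times a generator of degree [n]. *)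
- by have := PZ _ _ 0 _ (Pgen U (fun=> 0)); rewrite scale0r homog0.
- by rewrite homogD; exact: PD.
- by rewrite homogZ; exact: PZ.
- exact: Pgen.
Qed.

(* The index n tracks a bound on the degree; P is meant to be closed for the
   topology of the filtration. *)
Lemma gen_ind_fil (P : nat -> forall U, Salg E U -> Prop) :
  (forall n U (w : Salg E U), (forall x, opset U x -> exists V (h : opsub V U),
     opset V x /\ P n V (sres h w)) -> P n U w) ->
  (forall n U u v, P n U u -> P n U v -> P n U (u + v)) ->
  (forall U a, P 0%N U (scal a)) -> (forall U m, P 1%N U (deg1 m)) ->
  (forall i j U u v, P i U u -> P j U v -> P (i + j)%N U (u * v)) ->
  (forall m n U u, (m <= n)%N -> P n U u -> P m U u) ->
  (forall n U u, (forall k, exists2 v, P n U v & fil k (u - v)) -> P n U u) ->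
  forall n U (u : Salg E U), fil n u -> P n U u.
Proof.
move=> Ploc PD Po P1 PM Ple Pcl n U u un; apply: Pcl => k.
have Ph := gen_ind Ploc PD Po P1 PM.
exists (trunc k u); last exact: fil_trunc.
have P0 : P n U 0 by rewrite -(homog0 E n); exact: Ph.
rewrite /trunc; elim/big_ind: _ => [//|v w|i _]; first exact: PD.
have [ni|lt_in] := leqP n i; first exact/(Ple _ _ _ _ ni)/Ph.
by rewrite /hpart un // homog0.
Qed.

End Gen.

(** * Algebra maps and derivations given on generators *)

(* Dual numbers over R: (a, b) stands for a + b eps. *)
Definition dual (R : comPzRingType) : Type := (R * R)%type.

Section Dual.
Variable R : comPzRingType.
HB.instance Definition _ := GRing.Zmodule.copy (dual R) (R * R)%type.
Definition dual1 : dual R := (1, 0).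
Definition dualM (x y : dual R) : dual R := (x.1 * y.1, x.1 * y.2 + x.2 * y.1).

Fact dualA : associative dualM.
Proof.
move=> [a b] [c d] [e f]; rewrite /dualM /= !mulrA; congr pair.
by rewrite mulrDr mulrDl !mulrA addrA.
Qed.
Fact dualC : commutative dualM.
Proof. by move=> [a b] [c d]; rewrite /dualM /= addrC ![_ * a]mulrC ![_ * b]mulrC. Qed.
Fact dual1M : left_id dual1 dualM.
Proof. by move=> [a b]; rewrite /dualM /= !mul1r mul0r addr0. Qed.
Fact dualDl : left_distributive dualM +%R.
Proof. by move=> [a b] [c d] [e f]; congr pair; rewrite /= !mulrDl // addrACA. Qed.

HB.instance Definition _ := GRing.Zmodule_isComPzRing.Build (dual R) dualA dualC dual1M dualDl.

Lemma dual_mulE (x y : dual R) : x * y = (x.1 * y.1, x.1 * y.2 + x.2 * y.1).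
Proof. by []. Qed.
End Dual.

Section Extend.
Variables (X : topologicalType) (O : algSheaf X) (E E' : modSheaf O).
Implicit Types (U V : opens X).
Variables (D : forall U, O U -> Salg E' U) (f g : forall U, E U -> Salg E' U).

(* A morphism to the dual numbers, semilinear along a |-> a + D(a) eps, is a pair
   consisting of an algebra map and a derivation over it.  The derivation need not
   be O-linear, yet it comes from the universal property of the symmetric power. *)
Let B U : comPzRingType := dual (Salg E' U).

Definition ext_rho U (a : O U) : B U := (scal E' a, D a).
Definition ext_gen n U (t : 'I_n -> E U) : (B U)^o := \prod_(i < n) ((f (t i), g (t i)) : B U).
Definition ext_pre n U (x : sympre E n U) : (B U)^o := plift (@ext_rho U) (@ext_gen n U) x.
Definition ext_hom n U : Spow E n U -> Salg E' U :=
  shlift (G := Sprod E') (fun V (x : sympre E n V) => (ext_pre x).1) (U := U).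
Definition ext_der n U : Spow E n U -> Salg E' U :=
  shlift (G := Sprod E') (fun V (x : sympre E n V) => (ext_pre x).2) (U := U).

(** The sum of the images of all components of [w], read in degree [n]. Components of degree above
    [n] may be left out because their images lie in a deeper step of the filtration
    ([pairv_fil]). *)
Definition Hom U (w : Salg E U) : Salg E' U :=
  fun n => (\sum_(i < n.+1) ext_hom (w i)) n.
Definition Der U (w : Salg E U) : Salg E' U :=
  fun n => (\sum_(i < n.+1) ext_der (w i)) n.

(** [ed_flin] and [ed_glin] together say that m |-> f(m) + g(m) eps is semilinear along a |-> a +
    D(a) eps; [ed_f1] and [ed_g1] ensure convergence on the direct product. *)
Record ext_data : Prop := ExtData {
  ed_Dres : forall U V (h : opsub V U) a, sres h (D a) = D (ares O h a);
  ed_DD : forall U, {morph @D U : a b / a + b};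
  ed_DM : forall U (a b : O U), D (a * b) = scal E' a * D b + scal E' b * D a;
  ed_fres : forall U V (h : opsub V U) m, sres h (f m) = f (pres h m);
  ed_flin : forall U a (m m' : E U), f (a *: m + m') = scal E' a * f m + f m';
  ed_f1 : forall U (m : E U), fil 1 (f m);
  ed_gres : forall U V (h : opsub V U) m, sres h (g m) = g (pres h m);
  ed_glin : forall U a (m m' : E U),
    g (a *: m + m') = scal E' a * g m + D a * f m + g m';
  ed_g1 : forall U (m : E U), fil 1 (g m)
}.

Hypothesis H : ext_data.

Fact ext_D0 U : D (0 : O U) = 0.
Proof. by apply: (addrI (D (0 : O U))); rewrite -ed_DD // !addr0. Qed.
Fact ext_D1 U : D (1 : O U) = 0.
Proof.
have := ed_DM H (1 : O U) 1; rewrite mulr1 scal1 mul1r => E1.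
by apply: (addrI (D (1 : O U))); rewrite -E1 addr0.
Qed.

Fact ext_rho_additive U : zmod_morphism (@ext_rho U).
Proof.
move=> a b; rewrite /ext_rho scalD scalN ed_DD //; congr pair.
by congr (_ + _); apply: (addrI (D b)); rewrite -ed_DD // !subrr ext_D0.
Qed.
Fact ext_rho_mult U : monoid_morphism (@ext_rho U).
Proof.
split=> [|a b]; first by rewrite /ext_rho scal1 ext_D1.
by rewrite /ext_rho dual_mulE scalM ed_DM //= [D a * _]mulrC.
Qed.

Let rho U : {rmorphism O U -> B U} :=
  HB.pack (@ext_rho U) (GRing.isZmodMorphism.Build _ _ _ (@ext_rho_additive U))
    (GRing.isMonoidMorphism.Build _ _ _ (@ext_rho_mult U)).

Fact ext_gen_upd n U (t : 'I_n -> E U) i m :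
  ext_gen (upd t i m) = ((f m, g m) : B U) * \prod_(j < n | j != i) ((f (t j), g (t j)) : B U).
Proof.
rewrite /ext_gen (bigD1 i) //= /upd eqxx; congr (_ * _).
by apply: eq_bigr => j /negbTE ->.
Qed.

(** Products in a commutative ring are symmetric, and they are multilinear by [ed_flin] in the first
    component and [ed_glin] in the second. *)
Fact ext_rel n U (s t : lcomb (O U) ('I_n -> E U)) : sym_rel s t ->
  leval (rho U) (@ext_gen n U) s = leval (rho U) (@ext_gen n U) t.
Proof.
case=> [_ _ [] {s}t i a m m'|{s}t p] /=; last first.
  by rewrite /ext_gen /= [RHS](reindex_inj (@perm_inj _ p)).
rewrite !ext_gen_upd [RHS](_ : _ = (ext_rho a * ((f m, g m) : B U) + (f m', g m')) *
  \prod_(j < n | j != i) ((f (t j), g (t j)) : B U)); last by rewrite mulrDl -mulrA.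
by congr (_ * _); congr pair; rewrite /= ?ed_flin // ed_glin.
Qed.

Fact ext_pre_gen n U (t : 'I_n -> E U) :
  ext_pre (sym_gen t : sympre E n U) = ext_gen t.
Proof. exact: (plift_gen (@ext_rel n U)). Qed.

Fact ext_pre_lin n U : Defs.semilinear (@ext_rho U) (@ext_pre n U).
Proof.
by move=> a x y; rewrite /ext_pre (pliftD (@ext_rel n U)) (pliftZ (@ext_rel n U)).
Qed.

Let prs U V (h : opsub V U) (x : B U) : B V := (sres h x.1, sres h x.2).
Fact prsM U V (h : opsub V U) : {morph prs h : x y / x * y}.
Proof. by move=> x y; congr pair; rewrite /= ?sresD !sresM. Qed.
Fact prsD U V (h : opsub V U) : {morph prs h : x y / x + y}.
Proof. by move=> x y; congr pair; rewrite /= !sresD. Qed.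
Fact prs1 U V (h : opsub V U) : prs h 1 = 1.
Proof. by congr pair; rewrite /= ?sres1 ?sres0. Qed.

Fact ext_pre_res n U V (h : opsub V U) (x : sympre E n U) :
  ext_pre (pres h x) = prs h (ext_pre x).
Proof.
have prs_rho a : prs h (ext_rho a) = ext_rho (ares O h a).
  by congr pair; rewrite /= ?sres_scal ?ed_Dres.
apply: (@pmod_eq _ _ _ _ (B V)^o (rho V \o ares O h) (fun x : sympre E n U => ext_pre (pres h x))
  (fun x : sympre E n U => prs h (ext_pre x))).
- by move=> a y z; rewrite pres_lin ext_pre_lin.
- by move=> a y z; rewrite ext_pre_lin prsD [X in X + _]prsM prs_rho.
move=> t; rewrite -/(sym_gen t) ext_pre_gen /= /sympre_res (sym_map_gen (pres_lin h)) ext_pre_gen.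
rewrite /ext_gen (big_morph _ (@prsM _ _ h) (@prs1 _ _ h)).
by apply: eq_bigr => i _; congr pair; rewrite /= (ed_fres, ed_gres).
Qed.

Fact ext_pre_mul i j n (e : (i + j = n)%N) U (x : sympre E i U) (y : sympre E j U) :
  ext_pre (sym_mul e x y : sympre E n U) = (ext_pre x : B U) * ext_pre y.
Proof.
apply: (@pmod_eq _ _ _ _ (B U)^o (rho U)
  (fun x : sympre E i U => ext_pre (sym_mul e x y : sympre E n U))
  (fun x : sympre E i U => (ext_pre x : B U) * ext_pre y)).
- by move=> a u v; rewrite sym_mulDl sym_mulZl ext_pre_lin.
- by move=> a u v; rewrite ext_pre_lin [LHS]mulrDl -[in LHS]mulrA.
move=> s; rewrite -/(sym_gen s).
apply: (@pmod_eq _ _ _ _ (B U)^o (rho U)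
  (fun y : sympre E j U => ext_pre (sym_mul e (sym_gen s) y : sympre E n U))
  (fun y : sympre E j U => (ext_pre (sym_gen s : sympre E i U) : B U) * ext_pre y)).
- by move=> a u v; rewrite sym_mulDr sym_mulZr ext_pre_lin.
- by move=> a u v; rewrite ext_pre_lin [LHS]mulrDr [in LHS]mulrCA.
move=> t; rewrite -/(sym_gen t) sym_mul_gen !ext_pre_gen /ext_gen.
case: n / e; rewrite big_split_ord /=; congr (_ * _); apply: eq_bigr => k _.
  rewrite /catf cast_ord_id; case: split_ordP => l; first by move/lshift_inj->.
  by move/eqP; rewrite eq_lrshift.
rewrite /catf cast_ord_id; case: split_ordP => l; last by move/rshift_inj->.
by move/eqP; rewrite eq_rlshift.
Qed.

Let pairv n U (s : Spow E n U) : B U := (ext_hom s, ext_der s).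

Fact pairv_loc n U (s : Spow E n U) V (h : opsub V U) (p : sympre E n V) :
  pres h s = @Defs.eta X O (sympre E n) V p -> prs h (pairv s) = ext_pre p.
Proof.
move=> sp; rewrite [RHS]surjective_pairing; congr pair; rewrite /=.
- apply: (shliftP (G := Sprod E') (f := fun V (x : sympre E n V) => (ext_pre x).1)) sp.
  by move=> W W' k q; rewrite ext_pre_res.
- apply: (shliftP (G := Sprod E') (f := fun V (x : sympre E n V) => (ext_pre x).2)) sp.
  by move=> W W' k q; rewrite ext_pre_res.
Qed.

Fact prs_sep U (x y : B U) :
  (forall z, opset U z -> exists V (h : opsub V U), opset V z /\ prs h x = prs h y) -> x = y.
Proof.
move=> xy; rewrite [x]surjective_pairing [y]surjective_pairing; congr pair.
  by apply: sres_sep => z /xy [V [h [Vz [e _]]]]; exists V, h.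
by apply: sres_sep => z /xy [V [h [Vz [_ e]]]]; exists V, h.
Qed.

Fact prs_comp U V W (h : opsub V U) (k : opsub W V) (l : opsub W U) (x : B U) :
  prs k (prs h x) = prs l x.
Proof. by rewrite /prs /= !(sres_comp h k l). Qed.

Fact pairv_res n U V (h : opsub V U) (s : Spow E n U) : prs h (pairv s) = pairv (pres h s).
Proof.
apply: prs_sep => x Vx; have [W [k [p [Wx sp]]]] := eta_loc (pres h s) Vx.
exists W, k; split=> //; rewrite (pairv_loc sp).
rewrite (prs_comp _ _ (opsub_trans h k)); apply: pairv_loc.
by rewrite -sp (pres_comp _ _ (opsub_trans h k)).
Qed.

Fact pairv_eta n U (p : sympre E n U) :
  pairv (@Defs.eta X O (sympre E n) U p : Spow E n U) = ext_pre p.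
Proof.
have := @pairv_loc n U (@Defs.eta X O (sympre E n) U p) U (@opsub_refl _ _) p.
rewrite pres_id => /(_ erefl) <-.
by rewrite /prs !sres_id.
Qed.

Fact pairv_lin n U a (s t : Spow E n U) :
  pairv (a *: s + t) = ext_rho a * pairv s + pairv t.
Proof.
apply: prs_sep => x Ux; have [V [h [p [q [Vx sp tq]]]]] := eta_loc2 s t Ux.
exists V, h; split=> //; rewrite prsD prsM (pairv_loc sp) (pairv_loc tq).
have prs_rho : prs h (ext_rho a) = ext_rho (ares O h a).
  by congr pair; rewrite /= ?sres_scal ?ed_Dres.
have /pairv_loc -> : pres h (a *: s + t) = @Defs.eta X O (sympre E n) V (ares O h a *: p + q).
  by rewrite pres_lin eta_lin sp tq.
by rewrite prs_rho ext_pre_lin.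
Qed.

Fact ext_rho1 U : ext_rho (1 : O U) = 1.
Proof. by congr pair; rewrite ?scal1 ?ext_D1. Qed.

Fact pairv0 n U : pairv (0 : Spow E n U) = 0.
Proof.
have := pairv_lin 1 (0 : Spow E n U) 0; rewrite scaler0 add0r ext_rho1 mul1r.
by move=> /(canLR (addrK _)); rewrite subrr.
Qed.

Fact pairv_Smul i j n (e : (i + j = n)%N) U (s : Spow E i U) (t : Spow E j U) :
  pairv (Smul e s t) = pairv s * pairv t.
Proof.
apply: prs_sep => x Ux; have [V [h [p [q [Vx sp tq]]]]] := eta_loc2 s t Ux.
exists V, h; split=> //; rewrite prsM (pairv_loc sp) (pairv_loc tq) -(ext_pre_mul e).
apply: pairv_loc; rewrite Smul_res sp tq /Smul (shlift2_eta (f := _)) //.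
exact: Smul_pre_res.
Qed.

Fact pairv_Sgen n U (t : 'I_n -> E U) : pairv (Sgen t) = ext_gen t.
Proof. by rewrite /Sgen pairv_eta ext_pre_gen. Qed.

Fact pairv_S0 U (a : O U) : pairv (S0 E a) = ext_rho a.
Proof.
rewrite /S0 -[a *: _]addr0 pairv_lin pairv_Sgen.
by rewrite pairv0 addr0 /ext_gen big_ord0 mulr1.
Qed.

Fact pairv_S1 U (m : E U) : pairv (S1 m) = (f m, g m).
Proof. by rewrite pairv_Sgen /ext_gen big_ord1. Qed.

Let pfil n U (x : B U) := fil n x.1 /\ fil n x.2.

Fact pfilM i j U (x y : B U) : pfil i x -> pfil j y -> pfil (i + j) (x * y).
Proof.
move=> [x1 x2] [y1 y2]; split; first exact: filM.
by apply: filD; exact: filM.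
Qed.

Fact pairv_fil n U (s : Spow E n U) : pfil n (pairv s).
Proof.
move: U s; apply: Spow_ind => [U w Pw|U|U u v Pu Pv|U a u Pu|U t].
- split; apply: fil_loc => x /Pw [V [h [Vx [P1 P2]]]]; exists V, h; split=> //.
    by have [-> _] := pairv_res h w.
  by have [_ ->] := pairv_res h w.
- by rewrite pairv0.
- rewrite -[u]scale1r pairv_lin ext_rho1 mul1r.
  by case: Pu Pv => [? ?] [? ?]; split; apply: filD.
- have -> : a *: u = a *: u + 0 by rewrite addr0.
  rewrite pairv_lin.
  by rewrite pairv0 addr0; apply: (@pfilM 0 n).
rewrite pairv_Sgen /ext_gen; elim: n t => [|n IHn] t; first by rewrite big_ord0.
rewrite big_ord_recl; apply: (@pfilM 1 n); last exact: IHn.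
by split=> /=; [exact: ed_f1|exact: ed_g1].
Qed.

Let pairf U (w : Salg E U) : B U := (Hom w, Der w).

Fact Hom_filtered U : filtered (@Hom U).
Proof.
split=> [u v|n u un k kn]; last first.
  rewrite /Hom Salg_sum big1 // => i _; rewrite un ?(leq_ltn_trans _ kn) -1?ltnS //.
  by have [-> _] := pairv0 i U.
apply: Salg_ext => n; rewrite Salg_D /Hom -Salg_D -big_split /=.
rewrite (eq_bigr (fun i : 'I_n.+1 => ext_hom (u i) + ext_hom (v i))) // => i _.
by have := pairv_lin 1 (u i) (v i); rewrite scale1r ext_rho1 mul1r => -[].
Qed.

Fact Der_filtered U : filtered (@Der U).
Proof.
split=> [u v|n u un k kn]; last first.
  rewrite /Der Salg_sum big1 // => i _; rewrite un ?(leq_ltn_trans _ kn) -1?ltnS //.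
  by have [_ ->] := pairv0 i U.
apply: Salg_ext => n; rewrite Salg_D /Der -Salg_D -big_split /=.
rewrite (eq_bigr (fun i : 'I_n.+1 => ext_der (u i) + ext_der (v i))) // => i _.
by have := pairv_lin 1 (u i) (v i); rewrite scale1r ext_rho1 mul1r => -[].
Qed.

Fact pair_homog n U (s : Spow E n U) : pairf (homog s) = pairv s.
Proof.
have p0 k : k != n -> pairv (homog s k) = 0.
  by move=> kn; rewrite homog_neq ?pairv0 // eq_sym.
congr pair; apply: Salg_ext => k; rewrite /Hom /Der Salg_sum.
- have [nk|kn] := leqP n k.
    rewrite (bigD1 (Ordinal (nk : (n < k.+1)%N))) //= homog_id big1 ?addr0 // => i ni.
    exact: (congr1 (fun x : B U => x.1 k) (p0 i ni)).
  have [s1 _] := pairv_fil s; rewrite [RHS]s1 // big1 // => i _.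
  by apply: (congr1 (fun x : B U => x.1 k) (p0 i _)); rewrite neq_ltn (leq_ltn_trans _ kn) -1?ltnS.
- have [nk|kn] := leqP n k.
    rewrite (bigD1 (Ordinal (nk : (n < k.+1)%N))) //= homog_id big1 ?addr0 // => i ni.
    exact: (congr1 (fun x : B U => x.2 k) (p0 i ni)).
  have [_ s2] := pairv_fil s; rewrite [RHS]s2 // big1 // => i _.
  by apply: (congr1 (fun x : B U => x.2 k) (p0 i _)); rewrite neq_ltn (leq_ltn_trans _ kn) -1?ltnS.
Qed.

Lemma Hom_res U V (h : opsub V U) (w : Salg E U) : sres h (Hom w) = Hom (sres h w).
Proof.
apply: Salg_ext => n; rewrite sresE /Hom -sresE sres_sum.
rewrite (eq_bigr (fun i : 'I_n.+1 => ext_hom (sres h w i))) // => i _.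
by have [] := pairv_res h (w i).
Qed.

Lemma Der_res U V (h : opsub V U) (w : Salg E U) : sres h (Der w) = Der (sres h w).
Proof.
apply: Salg_ext => n; rewrite sresE /Der -sresE sres_sum.
rewrite (eq_bigr (fun i : 'I_n.+1 => ext_der (sres h w i))) // => i _.
by have [] := pairv_res h (w i).
Qed.

Lemma Hom_homog n U (s : Spow E n U) : Hom (homog s) = ext_hom s.
Proof. exact: (congr1 (fun x : B U => x.1) (pair_homog s)). Qed.

Lemma Der_homog n U (s : Spow E n U) : Der (homog s) = ext_der s.
Proof. exact: (congr1 (fun x : B U => x.2) (pair_homog s)). Qed.

Lemma Hom_scal U (a : O U) : Hom (scal E a) = scal E' a.
Proof. by rewrite scal_homog Hom_homog; have [] := pairv_S0 a. Qed.
Lemma Der_scal U (a : O U) : Der (scal E a) = D a.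
Proof. by rewrite scal_homog Der_homog; have [] := pairv_S0 a. Qed.
Lemma Hom_deg1 U (m : E U) : Hom (deg1 m) = f m.
Proof. by rewrite /deg1 Hom_homog; have [] := pairv_S1 m. Qed.
Lemma Der_deg1 U (m : E U) : Der (deg1 m) = g m.
Proof. by rewrite /deg1 Der_homog; have [] := pairv_S1 m. Qed.

End Extend.

Section FilteredOps.
Variables (X : topologicalType) (O : algSheaf X) (E E' : modSheaf O) (U : opens X).

Lemma filteredD (S T : Salg E U -> Salg E' U) :
  filtered S -> filtered T -> filtered (fun u => S u + T u).
Proof.
move=> [SD Sf] [TD Tf]; split=> [u v|n u un]; first by rewrite SD TD addrACA.
by apply: filD; [exact: Sf|exact: Tf].
Qed.

Lemma filtered_opp (S : Salg E U -> Salg E' U) : filtered S -> filtered (fun u => - S u).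
Proof.
move=> [SD Sf]; split=> [u v|n u un]; first by rewrite SD opprD.
exact/filN/Sf.
Qed.

Lemma filtered_mull (S : Salg E U -> Salg E' U) w : filtered S -> filtered (fun u => w * S u).
Proof.
move=> [SD Sf]; split=> [u v|n u un]; first by rewrite SD mulrDr.
exact/filMl/Sf.
Qed.

Lemma filtered_mulr (S : Salg E U -> Salg E' U) w : filtered S -> filtered (fun u => S u * w).
Proof.
move=> [SD Sf]; split=> [u v|n u un]; first by rewrite SD mulrDl.
exact/filMr/Sf.
Qed.

End FilteredOps.

Record is_hom (X : topologicalType) (O : algSheaf X) (E E' : modSheaf O)
    (P : forall U, Salg E U -> Salg E' U) : Prop := IsHom {
  hom_res : forall U V (h : opsub V U) w, sres h (P U w) = P V (sres h w);
  hom_fil : forall U, filtered (P U);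
  hom_M : forall U, {morph P U : u v / u * v};
  hom_scal : forall U a, P U (scal E a) = scal E' a
}.

(** A derivation along the algebra map [P]. It may act on scalars, as [nabla] does through D. *)
Record is_der (X : topologicalType) (O : algSheaf X) (E E' : modSheaf O)
    (P d : forall U, Salg E U -> Salg E' U) : Prop := IsDer {
  der_res : forall U V (h : opsub V U) w, sres h (d U w) = d V (sres h w);
  der_fil : forall U, filtered (d U);
  der_M : forall U u v, d U (u * v) = P U u * d U v + d U u * P U v
}.

Section Extend2.
Variables (X : topologicalType) (O : algSheaf X) (E E' : modSheaf O).
Variables (D : forall U, O U -> Salg E' U) (f g : forall U, E U -> Salg E' U).
Hypothesis H : ext_data D f g.

Lemma Hom_is_hom : is_hom (Hom D f g).
Proof.
split=> [U V h w|U|U|U a]; [exact: Hom_res|exact: Hom_filtered| |exact: Hom_scal].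
have HF := Hom_filtered H U => u v.
apply: (@filtered_eq _ _ E E' U (fun u => Hom D f g (u * v))
  (fun u => Hom D f g u * Hom D f g v)) u => [||i s].
- by apply: filtered_comp HF; exact: (filtered_mulr v (S := id)).
- exact: filtered_mulr.
apply: (@filtered_eq _ _ E E' U (fun v => Hom D f g (homog s * v))
  (fun v => Hom D f g (homog s) * Hom D f g v)) v => [||j t].
- by apply: filtered_comp HF; exact: (filtered_mull _ (S := id)).
- exact: filtered_mull.
rewrite (homogM (erefl (i + j)%N)) !Hom_homog //.
by have [] := pairv_Smul H (erefl (i + j)%N) s t.
Qed.

Lemma Der_is_der : is_der (Hom D f g) (Der D f g).
Proof.
split=> [U V h w|U|U]; [exact: Der_res|exact: Der_filtered|].
have HF := Hom_filtered H U; have DF := Der_filtered H U => u v.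
apply: (@filtered_eq _ _ E E' U (fun u => Der D f g (u * v))
  (fun u => Hom D f g u * Der D f g v + Der D f g u * Hom D f g v)) u => [||i s].
- by apply: filtered_comp DF; exact: (filtered_mulr v (S := id)).
- by apply: filteredD; exact: filtered_mulr.
apply: (@filtered_eq _ _ E E' U (fun v => Der D f g (homog s * v))
  (fun v => Hom D f g (homog s) * Der D f g v + Der D f g (homog s) * Hom D f g v)) v => [||j t].
- by apply: filtered_comp DF; exact: (filtered_mull _ (S := id)).
- by apply: filteredD; exact: filtered_mull.
rewrite (homogM (erefl (i + j)%N)) !Hom_homog // !Der_homog //.
by have [] := pairv_Smul H (erefl (i + j)%N) s t.
Qed.

End Extend2.

(** The mixed terms of the two Leibniz expansions in a commutator of derivations cancel. *)
Lemma addr_cancel (V : zmodType) (a b c d a' d' : V) :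
  a + b + (c + d) - (a' + c + (b + d')) = a - a' + (d - d').
Proof.
rewrite [a + b]addrC addrACA [a' + c]addrC [c + a' + _]addrACA [c + b]addrC.
by rewrite [b + c + (a + d)]addrC addrKA opprD addrACA.
Qed.

(** * Identities and degree bounds checked on generators *)

Section Maps.
Variables (X : topologicalType) (O : algSheaf X).
Implicit Types (U V : opens X) (E : modSheaf O).

Record is_map E E' (S : forall U, Salg E U -> Salg E' U) : Prop := IsMap {
  map_res : forall U V (h : opsub V U) w, sres h (S U w) = S V (sres h w);
  map_fil : forall U, filtered (S U)
}.

Lemma hom_map E E' P : @is_hom X O E E' P -> is_map P.
Proof. by case. Qed.
Lemma der_map E E' P d : @is_der X O E E' P d -> is_map d.
Proof. by case. Qed.

Lemma comp_is_map E E' E'' (S : forall U, Salg E U -> Salg E' U)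
    (T : forall U, Salg E' U -> Salg E'' U) :
  is_map S -> is_map T -> is_map (fun U u => T U (S U u)).
Proof.
move=> Sm Tm; split=> [U V h w|U]; first by rewrite (map_res Tm) (map_res Sm).
by apply: filtered_comp; exact: map_fil.
Qed.

Lemma sub_is_map E E' (S T : forall U, Salg E U -> Salg E' U) :
  is_map S -> is_map T -> is_map (fun U u => S U u - T U u).
Proof.
move=> Sm Tm; split=> [U V h w|U]; first by rewrite sresD sresN (map_res Tm) (map_res Sm).
by apply: filteredD; [|apply: filtered_opp]; exact: map_fil.
Qed.

(** Only stability of the bound under products is required, so the lemma serves derivations as well
    as differences of algebra maps. *)
Lemma map_shift E E' (S : forall U, Salg E U -> Salg E' U) s : is_map S ->
  (forall U a, fil s (S U (scal E a))) -> (forall U m, fil (1 + s) (S U (deg1 m))) ->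
  (forall i j U u v, fil i u -> fil j v -> fil (i + s) (S U u) -> fil (j + s) (S U v) ->
     fil (i + j + s) (S U (u * v))) ->
  forall n U u, fil n u -> fil (n + s) (S U u).
Proof.
move=> Sm So S1 SM n U u un.
(* The first conjunct keeps the degrees of both factors available in the product step. *)
suff [] : fil n u /\ fil (n + s) (S U u) by [].
apply: (@gen_ind_fil _ _ E (fun n U u => fil n u /\ fil (n + s) (S U u))) un.
- move=> {u}n {}U u H; split; apply: fil_loc => x /H [V [h [Vx [H1 H2]]]]; exists V, h => //.
  by rewrite (map_res Sm).
- move=> {u}n {}U u v [u1 u2] [v1 v2]; rewrite (map_fil Sm U).1.
  by split; exact: filD.
- by move=> {u}U a; split=> //; rewrite add0n.
- by move=> {u}U m; split=> //; exact: fil_deg1.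
- move=> i j {u}U u v [u1 u2] [v1 v2]; split; first exact: filM.
  exact: SM.
- move=> m {u}n {}U u mn [u1 u2]; split; first exact: filW u1.
  by apply: filW u2; rewrite leq_add2r.
- move=> {u}n {}U u H; split=> k kn.
    have [v [v1 v2]] := H k.+1 => /(_ k (ltnSn k)).
    by rewrite Salg_D Salg_N (v1 k kn) subr0.
  have [v [v1 v2]] := H k.+1 => /((map_fil Sm U).2) /(_ k (ltnSn k)).
  by rewrite (filteredB (map_fil Sm U)) Salg_D Salg_N (v2 k kn) subr0.
Qed.

(** The product step is left as a hypothesis so that composites not known in advance to be
    derivations are covered too, as in [curv_killy]. *)
Lemma eq_on_generators E E' (S T : forall U, Salg E U -> Salg E' U) : is_map S -> is_map T ->
  (forall U a, S U (scal E a) = T U (scal E a)) -> (forall U m, S U (deg1 m) = T U (deg1 m)) ->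
  (forall U u v, S U u = T U u -> S U v = T U v -> S U (u * v) = T U (u * v)) ->
  forall U u, S U u = T U u.
Proof.
move=> Sm Tm So S1 SM U u; apply: (filtered_eq (map_fil Sm U) (map_fil Tm U)) => n s.
apply: (@gen_ind _ _ E (fun n U u => S U u = T U u)) => //.
- move=> k W w H; apply: sres_sep => x /H [V [h [Vx Hw]]]; exists V, h; split=> //.
  by rewrite (map_res Sm) (map_res Tm).
- by move=> k W v w Sv Sw; rewrite (map_fil Sm W).1 (map_fil Tm W).1 Sv Sw.
Qed.

Lemma hom1 E E' P U : @is_hom X O E E' P -> P U 1 = 1.
Proof. by move=> Ph; rewrite -(scal1 E U) (hom_scal Ph) scal1. Qed.

Lemma hom_eq E E' (P Q : forall U, Salg E U -> Salg E' U) : is_hom P -> is_hom Q ->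
  (forall U m, P U (deg1 m) = Q U (deg1 m)) -> forall U u, P U u = Q U u.
Proof.
move=> Ph Qh PQ; apply: eq_on_generators => //.
- exact: hom_map.
- exact: hom_map.
- by move=> U a; rewrite (hom_scal Ph) (hom_scal Qh).
- by move=> U u v Pu Pv; rewrite (hom_M Ph) (hom_M Qh) Pu Pv.
Qed.

Lemma der_eq E E' (P d e : forall U, Salg E U -> Salg E' U) : is_der P d -> is_der P e ->
  (forall U a, d U (scal E a) = e U (scal E a)) ->
  (forall U m, d U (deg1 m) = e U (deg1 m)) -> forall U u, d U u = e U u.
Proof.
move=> dP eP d0 d1; apply: eq_on_generators => //; [exact: der_map dP|exact: der_map eP|].
by move=> U u v Pu Pv; rewrite (der_M dP) (der_M eP) Pu Pv.
Qed.

Lemma hom_id E : is_hom (fun U (u : Salg E U) => u).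
Proof. by []. Qed.

Lemma hom_comp E E' E'' (P : forall U, Salg E U -> Salg E' U)
    (Q : forall U, Salg E' U -> Salg E'' U) :
  is_hom P -> is_hom Q -> is_hom (fun U u => Q U (P U u)).
Proof.
move=> Ph Qh; have [r f] := comp_is_map (hom_map Ph) (hom_map Qh); split=> // [U u v|U a].
  by rewrite (hom_M Ph) (hom_M Qh).
by rewrite (hom_scal Ph) (hom_scal Qh).
Qed.

Lemma der_homl E E' E'' (P d : forall U, Salg E U -> Salg E' U)
    (Q : forall U, Salg E' U -> Salg E'' U) :
  is_der P d -> is_hom Q -> is_der (fun U u => Q U (P U u)) (fun U u => Q U (d U u)).
Proof.
move=> dP Qh; have [r f] := comp_is_map (der_map dP) (hom_map Qh); split=> // U u v.
by rewrite (der_M dP) (hom_fil Qh U).1 !(hom_M Qh).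
Qed.

Lemma der_homr E E' E'' (P d : forall U, Salg E' U -> Salg E'' U)
    (Q : forall U, Salg E U -> Salg E' U) :
  is_der P d -> is_hom Q -> is_der (fun U u => P U (Q U u)) (fun U u => d U (Q U u)).
Proof.
move=> dP Qh; have [r f] := comp_is_map (hom_map Qh) (der_map dP); split=> // U u v.
by rewrite (hom_M Qh) (der_M dP).
Qed.

Lemma der_comm E (d e : forall U, Salg E U -> Salg E U) :
  is_der (fun U u => u) d -> is_der (fun U u => u) e ->
  is_der (fun U u => u) (fun U u => d U (e U u) - e U (d U u)).
Proof.
move=> dP eP; have [dm em] := (der_map dP, der_map eP).
have [r f] := sub_is_map (comp_is_map em dm) (comp_is_map dm em); split=> // U u v.
rewrite (der_M dP) (der_M eP) (map_fil dm U).1 (map_fil em U).1 !(der_M dP) !(der_M eP).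
by rewrite mulrBr mulrBl addr_cancel.
Qed.

End Maps.

(** * Linear and twisted maps on generators, and their extensions *)

Section LinearMaps.
Variables (X : topologicalType) (O : algSheaf X).
Implicit Types (U V : opens X) (E : modSheaf O).

Record is_lin E E' (p : forall U, E U -> Salg E' U) : Prop := IsLin {
  lin_res : forall U V (h : opsub V U) m, sres h (p U m) = p V (pres h m);
  linP : forall U a m m', p U (a *: m + m') = scal E' a * p U m + p U m';
  lin_fil : forall U m, fil 1 (p U m)
}.

Section LinTheory.
Variables (E E' : modSheaf O) (p : forall U, E U -> Salg E' U).
Hypothesis pl : is_lin p.
Lemma linD U : {morph @p U : m m' / m + m'}.
Proof. by move=> m m'; rewrite -[m]scale1r (linP pl) scal1 mul1r scale1r. Qed.
Lemma lin0 U : p (0 : E U) = 0.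
Proof. by apply: (addrI (p (0 : E U))); rewrite -linD !addr0. Qed.
Lemma linZ U a (m : E U) : p (a *: m) = scal E' a * p m.
Proof. by rewrite -[a *: m]addr0 (linP pl) lin0 addr0. Qed.
End LinTheory.

Lemma lin_deg1 E : is_lin (@deg1 X O E).
Proof. by split=> [U V h m|U a m m'|U m]; [exact: sres_deg1|exact: deg1_lin|exact: fil_deg1]. Qed.

Lemma lin_zero E E' : is_lin (fun U (_ : psec E U) => 0 : Salg E' U).
Proof.
by split=> [U V h m|U a m m'|U m]; [exact: sres0|rewrite mulr0 addr0|exact: fil0].
Qed.

Lemma lin_comp E E' (p : forall U, E U -> Salg E' U) E'' (S : forall U, Salg E' U -> Salg E'' U) :
  is_lin p -> is_map S -> (forall U a u, S U (scal E' a * u) = scal E'' a * S U u) ->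
  is_lin (fun U m => S U (p U m)).
Proof.
move=> pl Sm SZ; split=> [U V h m|U a m m'|U m].
- by rewrite (map_res Sm) (lin_res pl).
- by rewrite (linP pl) (map_fil Sm U).1 SZ.
- exact/(map_fil Sm U).2/lin_fil.
Qed.

Definition hom_ext E E' (f : forall U, E U -> Salg E' U) : forall U, Salg E U -> Salg E' U :=
  Hom (fun _ _ => 0) f (fun _ _ => 0).

Section HomExt.
Variables (E E' : modSheaf O) (f : forall U, E U -> Salg E' U).
Hypothesis fl : is_lin f.

Fact hom_ext_data : ext_data (fun _ _ => 0) f (fun _ _ => 0).
Proof.
split=> //= [U V h a|U a b|U a b|||||].
- exact: sres0.
- by rewrite addr0.
- by rewrite !mulr0 addr0.
- exact: lin_res.
- exact: linP.
- exact: lin_fil.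
- by move=> *; exact: sres0.
- by move=> *; rewrite mulr0 mul0r !addr0.
Qed.

Lemma hom_extP : is_hom (hom_ext f).
Proof. exact: Hom_is_hom hom_ext_data. Qed.

Lemma hom_ext_deg1 U m : hom_ext f (deg1 m) = f m :> Salg E' U.
Proof. exact: Hom_deg1 hom_ext_data _ _. Qed.
End HomExt.

(** The compatibility needed for a derivation that acts by D on scalars, along an algebra map given
    by f on generators, to take the values g there. *)
Record is_twisted E E' (D : forall U, O U -> Salg E' U) (f g : forall U, E U -> Salg E' U) : Prop :=
  IsTwisted {
  tw_res : forall U V (h : opsub V U) m, sres h (g U m) = g V (pres h m);
  twP : forall U a m m', g U (a *: m + m') = scal E' a * g U m + D U a * f U m + g U m';
  tw_fil : forall U m, fil 1 (g U m)
}.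

Record is_derO E (D : forall U, O U -> Salg E U) : Prop := IsDerO {
  derO_res : forall U V (h : opsub V U) a, sres h (D U a) = D V (ares O h a);
  derO_D : forall U, {morph D U : a b / a + b};
  derO_M : forall U (a b : O U), D U (a * b) = scal E a * D U b + scal E b * D U a
}.

Definition der_ext E (D : forall U, O U -> Salg E U) (g : forall U, E U -> Salg E U) :
  forall U, Salg E U -> Salg E U := Der D (@deg1 X O E) g.

Section DerExt.
Variables (E : modSheaf O) (D : forall U, O U -> Salg E U) (g : forall U, E U -> Salg E U).
Hypotheses (Dd : is_derO D) (gt : is_twisted D (@deg1 X O E) g).

Fact der_ext_data : ext_data D (@deg1 X O E) g.
Proof.
case: Dd gt => [? ? ?] [? ? ?]; split=> //.
- exact: sres_deg1.
- exact: deg1_lin.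
- exact: fil_deg1.
Qed.

Lemma der_extP : is_der (fun U u => u) (der_ext D g).
Proof.
have [r f M] := Der_is_der der_ext_data; split=> // U u v.
have HH := Hom_is_hom der_ext_data.
(* The algebra map underlying the derivation fixes the generators, hence is the identity. *)
have E0 : forall V w, Hom D (@deg1 X O E) g w = w :> Salg E V.
  by apply: (hom_eq HH (@hom_id _ _ _)) => V m; exact: Hom_deg1 der_ext_data _ _.
by rewrite /der_ext M !E0.
Qed.

Lemma der_ext_scal U a : der_ext D g (scal E a) = D a :> Salg E U.
Proof. exact: Der_scal der_ext_data _ _. Qed.
Lemma der_ext_deg1 U m : der_ext D g (deg1 m) = g m :> Salg E U.
Proof. exact: Der_deg1 der_ext_data _ _. Qed.
End DerExt.

Lemma derO0 E : is_derO (fun U (_ : O U) => (0 : Salg E U)).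
Proof.
split=> [U V h a|U a b|U a b]; first exact: sres0.
  by rewrite addr0.
by rewrite !mulr0 addr0.
Qed.

Lemma twisted_lin E E' (f g : forall U, E U -> Salg E' U) :
  is_lin g -> is_twisted (fun U (_ : O U) => 0) f g.
Proof. by case=> r l t; split=> // U a m m'; rewrite l mul0r addr0. Qed.

End LinearMaps.

(** * The algebra S(F + F) *)

Section Two.
Variables (X : topologicalType) (O : algSheaf X) (F : modSheaf O).
Implicit Types (U V : opens X) (E : modSheaf O).

Definition FF : modSheaf O := prodSheaf (fun _ : bool => F).

Definition inj b U (m : F U) : FF U := fun c => if c == b then m else 0.

Lemma inj_lin b U a (m m' : F U) : inj b (a *: m + m') = a *: inj b m + inj b m'.
Proof.
apply: functional_extensionality_dep => c; rewrite /inj.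
transitivity (a *: (if c == b then m else 0) + (if c == b then m' else 0)) => //.
by case: eqP; rewrite // scaler0 addr0.
Qed.

Lemma inj_res b U V (h : opsub V U) (m : F U) : pres h (inj b m) = inj b (pres h m).
Proof.
apply: functional_extensionality_dep => c.
transitivity (pres h (if c == b then m else 0)) => //.
by rewrite /inj; case: eqP; rewrite // pres0.
Qed.

Lemma inj_sum U (e : FF U) : e = inj true (e true) + inj false (e false).
Proof.
apply: functional_extensionality_dep => c.
transitivity ((if c == true then e true else 0) + (if c == false then e false else 0)) => //.
by case: c; rewrite ?addr0 ?add0r.
Qed.

Definition vx U (m : F U) : Salg FF U := deg1 (inj true m).
Definition vy U (m : F U) : Salg FF U := deg1 (inj false m).

Lemma vx_lin : is_lin vx.
Proof.
split=> [U V h m|U a m m'|U m]; last exact: fil_deg1.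
  by rewrite sres_deg1 inj_res.
by rewrite /vx inj_lin deg1_lin.
Qed.
Lemma vy_lin : is_lin vy.
Proof.
split=> [U V h m|U a m m'|U m]; last exact: fil_deg1.
  by rewrite sres_deg1 inj_res.
by rewrite /vy inj_lin deg1_lin.
Qed.

Lemma deg1_FF U (e : FF U) : deg1 e = vx (e true) + vy (e false).
Proof. by rewrite {1}(inj_sum e) deg1D. Qed.

Definition copair E (p q : forall U, F U -> Salg E U) U (e : FF U) : Salg E U :=
  p U (e true) + q U (e false).

Lemma copair_lin E (p q : forall U, F U -> Salg E U) : is_lin p -> is_lin q -> is_lin (copair p q).
Proof.
move=> pl ql; split=> [U V h m|U a m m'|U m].
- by rewrite /copair sresD (lin_res pl) (lin_res ql).
- by rewrite /copair (linP pl) (linP ql) mulrDr addrACA.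
- by apply: filD; exact: lin_fil.
Qed.

Lemma copair_twisted E D (p q p' q' : forall U, F U -> Salg E U) :
  is_twisted D p p' -> is_twisted D q q' -> is_twisted D (copair p q) (copair p' q').
Proof.
move=> pl ql; split=> [U V h m|U a m m'|U m].
- by rewrite /copair sresD (tw_res pl) (tw_res ql).
- by rewrite /copair (twP pl) (twP ql) addrACA; congr (_ + _); rewrite addrACA !mulrDr.
- by apply: filD; [exact: tw_fil pl _ _|exact: tw_fil ql _ _].
Qed.

Lemma copair_xy_twisted D (p' q' : forall U, F U -> Salg FF U) :
  is_twisted D vx p' -> is_twisted D vy q' -> is_twisted D (@deg1 X O FF) (copair p' q').
Proof.
move=> pt qt; have [r l f] := copair_twisted pt qt; split=> // U a m m'.
by rewrite l /copair -deg1_FF.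
Qed.

Definition hom_FF E (p q : forall U, F U -> Salg E U) : forall U, Salg FF U -> Salg E U :=
  hom_ext (copair p q).

Section Hom2.
Variables (E : modSheaf O) (p q : forall U, F U -> Salg E U).
Hypotheses (pl : is_lin p) (ql : is_lin q).

Lemma hom_FFP : is_hom (hom_FF p q).
Proof. exact/hom_extP/copair_lin. Qed.
Lemma hom_FF_x U m : hom_FF p q (vx m) = p m :> Salg E U.
Proof.
by rewrite /hom_FF hom_ext_deg1 /copair /inj /= ?(lin0 ql) ?addr0 //; exact: copair_lin.
Qed.
Lemma hom_FF_y U m : hom_FF p q (vy m) = q m :> Salg E U.
Proof.
by rewrite /hom_FF hom_ext_deg1 /copair /inj /= ?(lin0 pl) ?add0r //; exact: copair_lin.
Qed.
End Hom2.

Definition der_FF (D : forall U, O U -> Salg FF U) (p q : forall U, F U -> Salg FF U) :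
  forall U, Salg FF U -> Salg FF U := der_ext D (copair p q).

Lemma twisted0 E E' D (f g : forall U, E U -> Salg E' U) U :
  is_lin f -> is_twisted D f g -> g U 0 = 0.
Proof.
move=> fl gt; apply: (addrI (g U 0)); rewrite addr0.
have := twP gt (1 : O U) 0 0.
by rewrite scale1r addr0 scal1 mul1r (lin0 fl) mulr0 addr0 => <-.
Qed.

Section Der2.
Variables (D : forall U, O U -> Salg FF U) (p q : forall U, F U -> Salg FF U).
Hypotheses (Dd : is_derO D) (pt : is_twisted D vx p) (qt : is_twisted D vy q).

Lemma der_FFP : is_der (fun U u => u) (der_FF D p q).
Proof. exact/der_extP/copair_xy_twisted. Qed.
Lemma der_FF_scal U a : der_FF D p q (scal FF a) = D a :> Salg FF U.
Proof. exact/der_ext_scal/copair_xy_twisted. Qed.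
Lemma der_FF_x U m : der_FF D p q (vx m) = p m :> Salg FF U.
Proof.
rewrite /der_FF der_ext_deg1 //; last exact: copair_xy_twisted.
by rewrite /copair /inj /= (twisted0 _ vy_lin qt) addr0.
Qed.
Lemma der_FF_y U m : der_FF D p q (vy m) = q m :> Salg FF U.
Proof.
rewrite /der_FF der_ext_deg1 //; last exact: copair_xy_twisted.
by rewrite /copair /inj /= (twisted0 _ vx_lin pt) add0r.
Qed.
End Der2.

(** * Quadratic expressions on the second tensor power, and flatness *)

Section TensorTwo.
Variables (E : modSheaf O) (p q : forall U, F U -> Salg E U).
Hypotheses (pl : is_lin p) (ql : is_lin q).

(** The rule m (x) m' |-> p(m) q(m'). With p and q among x and y it turns a value of the connection
    into a quadratic element x x, x y or y x. *)
Definition bil_gen U (t : 'I_2 -> F U) : Salg E U := p (t ord0) * q (t ord_max).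
Definition bil_pre U (w : tenspre F 2 U) : Salg E U := plift (N := Salg E U) idfun (@bil_gen U) w.
Definition bil U (w : Tpow F 2 U) : Salg E U := shlift (G := Sprod E) bil_pre w.

Fact bil_rel U s t : tens_rel s t ->
  leval (N := Salg E U) idfun (@bil_gen U) s = leval (N := Salg E U) idfun (@bil_gen U) t.
Proof.
case=> {s}t i a m m' /=; rewrite /bil_gen /upd.
case: i => -[|[|//]] /= il.
  by rewrite (linP pl) mulrDl scale_scal mulrA.
by rewrite (linP ql) mulrDr scale_scal mulrCA.
Qed.

Fact bil_pre_gen U (t : 'I_2 -> F U) : bil_pre (tens_gen t : tenspre F 2 U) = bil_gen t.
Proof. exact: (plift_gen (N := Salg E U) (@bil_rel U)). Qed.

Fact bil_pre_lin U : Defs.semilinear (M' := Salg E U) idfun (@bil_pre U).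
Proof.
by move=> a x y; rewrite /bil_pre (pliftD (N := Salg E U) (@bil_rel U))
  (pliftZ (N := Salg E U) (@bil_rel U)).
Qed.

Fact bil_pre_res U V (h : opsub V U) (w : tenspre F 2 U) :
  sres h (bil_pre w) = bil_pre (pres h w).
Proof.
apply: (@pmod_eq _ _ _ _ (Salg E V) (ares O h) (fun w : tenspre F 2 U => sres h (bil_pre w))
  (fun w : tenspre F 2 U => bil_pre (pres h w))).
- by move=> a x y; rewrite bil_pre_lin sresD sresZ.
- by move=> a x y; rewrite pres_lin bil_pre_lin.
move=> t; rewrite -/(tens_gen t) bil_pre_gen /= /tenspre_res (tens_map_gen (pres_lin h)).
by rewrite bil_pre_gen /bil_gen sresM (lin_res pl) (lin_res ql).
Qed.

Lemma bil_res U V (h : opsub V U) w : sres h (bil w) = bil (pres h w).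
Proof. exact: (shlift_res (G := Sprod E) bil_pre_res). Qed.

Lemma bil_lin U a w w' : bil (a *: w + w') = scal E a * bil w + bil w' :> Salg E U.
Proof.
by rewrite -scale_scal; exact: (shlift_lin (G := Sprod E) bil_pre_res bil_pre_lin).
Qed.

Lemma bil_tens2 U (m m' : F U) : bil (tens2 m m') = p m * q m'.
Proof.
rewrite /bil /tens2 /Tgen (shlift_eta (G := Sprod E) bil_pre_res).
exact: bil_pre_gen.
Qed.

Lemma bil_fil U w : fil 2 (bil w : Salg E U).
Proof.
apply: fil_loc => x Ux; have [V [h [z [Vx wz]]]] := eta_loc w Ux.
exists V, h; split=> //; rewrite bil_res wz /bil (shlift_eta (G := Sprod E) bil_pre_res).
elim/pmod_ind: z {wz} => [|z z' Hz Hz'|a z Hz|t].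
- by rewrite (semilinear0 (@bil_pre_lin V)).
- by rewrite (semilinearD (@bil_pre_lin V)); exact: filD.
- by rewrite (semilinearZ _ _ (@bil_pre_lin V)); exact: filZ.
- rewrite -/(tens_gen t) bil_pre_gen; apply: (@filM _ _ _ 1 1); exact: lin_fil.
Qed.

End TensorTwo.

Section Flat.
Variables (E : modSheaf O) (p q : forall U, F U -> Salg E U).
Hypotheses (pl : is_lin p) (ql : is_lin q).

Definition skew_gen U (t : 'I_2 -> F U) : Salg E U :=
  p (t ord0) * q (t ord_max) - q (t ord0) * p (t ord_max).
Definition skew_pre U (w : altpre F 2 U) : Salg E U := plift (N := Salg E U) idfun (@skew_gen U) w.
Definition skew U (w : Apow F 2 U) : Salg E U := shlift (G := Sprod E) skew_pre w.

Fact skew_rel U s t : alt_rel s t ->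
  leval (N := Salg E U) idfun (@skew_gen U) s = leval (N := Salg E U) idfun (@skew_gen U) t.
Proof.
case=> [_ _ [] {s}t i a m m'|{s}t i j ij tij] /=; last first.
  have t01 : t ord0 = t ord_max.
    have I2 (k : 'I_2) : k = ord0 \/ k = ord_max.
      by case: k => -[|[|//]] kl; [left|right]; exact/val_inj.
    by move: ij tij; case: (I2 i) => ->; case: (I2 j) => ->; rewrite ?eqxx.
  by rewrite /skew_gen t01 mulrC subrr.
have [r1 r2] := (bil_rel pl ql (TensLin t i a m m'), bil_rel ql pl (TensLin t i a m m')).
rewrite /= /bil_gen in r1 r2; rewrite /skew_gen r1 r2.
by rewrite scalerBr opprD addrACA.
Qed.

Fact skew_pre_gen U (t : 'I_2 -> F U) : skew_pre (alt_gen t : altpre F 2 U) = skew_gen t.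
Proof. exact: (plift_gen (N := Salg E U) (@skew_rel U)). Qed.

Fact skew_pre_lin U : Defs.semilinear (M' := Salg E U) idfun (@skew_pre U).
Proof.
by move=> a x y; rewrite /skew_pre (pliftD (N := Salg E U) (@skew_rel U))
  (pliftZ (N := Salg E U) (@skew_rel U)).
Qed.

Fact skew_pre_res U V (h : opsub V U) (w : altpre F 2 U) :
  sres h (skew_pre w) = skew_pre (pres h w).
Proof.
apply: (@pmod_eq _ _ _ _ (Salg E V) (ares O h) (fun w : altpre F 2 U => sres h (skew_pre w))
  (fun w : altpre F 2 U => skew_pre (pres h w))).
- by move=> a x y; rewrite skew_pre_lin sresD sresZ.
- by move=> a x y; rewrite pres_lin skew_pre_lin.
move=> t; rewrite -/(alt_gen t) skew_pre_gen /= /altpre_res (alt_map_gen (pres_lin h)).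
by rewrite skew_pre_gen /skew_gen sresD sresN !sresM !(lin_res pl) !(lin_res ql).
Qed.

(** The antisymmetrization factors through the exterior square, so vanishing there, which is how
    flatness is stated, permits exchanging p and q ([bil_flat]). *)
Lemma skew_T_to_A U (w : Tpow F 2 U) : skew (T_to_A w) = bil p q w - bil q p w.
Proof.
apply: sres_sep => x Ux; have [V [h [z [Vx wz]]]] := eta_loc w Ux.
exists V, h; split=> //; rewrite sresD sresN !bil_res //.
have Tres W W' (k : opsub W' W) (y : tenspre F 2 W) :
    pres k (Defs.eta (tens_to_alt y : altpre F 2 W)) =
    Defs.eta (tens_to_alt (pres k y : tenspre F 2 W') : altpre F 2 W').
  by rewrite eta_res /= /altpre_res (alt_map_tens (pres_lin k)).
rewrite /skew /sres (shlift_res (G := Sprod E) skew_pre_res) /T_to_A (shlift_res Tres).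
rewrite wz {wz} (shlift_eta Tres) (shlift_eta (G := Sprod E) skew_pre_res) /bil.
rewrite !(shlift_eta (G := Sprod E) (bil_pre_res _ _)) //.
apply: (@pmod_eq _ _ _ _ (Salg E V) idfun
  (fun z : tenspre F 2 V => skew_pre (tens_to_alt z : altpre F 2 V))
  (fun z : tenspre F 2 V => bil_pre p q z - bil_pre q p z)) z.
- by move=> a y y'; rewrite tens_to_altP skew_pre_lin.
- by move=> a y y'; rewrite !bil_pre_lin // scalerBr opprD addrACA.
by move=> t; rewrite -/(tens_gen t) tens_to_alt_gen skew_pre_gen !bil_pre_gen.
Qed.

Lemma bil_flat U (w : Tpow F 2 U) : T_to_A w = 0 -> bil p q w = bil q p w.
Proof.
move=> w0; apply/eqP; rewrite -subr_eq0 -skew_T_to_A w0; apply/eqP.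
have sl : Defs.semilinear (M' := Salg E U) idfun (@skew U).
  exact: (shlift_lin (G := Sprod E) skew_pre_res skew_pre_lin).
exact: (semilinear0 sl).
Qed.

End Flat.

End Two.

(** * The exponential of a flat connection *)

Section Limits.
Variables (X : topologicalType) (O : algSheaf X).
Implicit Types (U V : opens X) (E : modSheaf O).

(** Meant for series whose [n]-th term lies in [fil n]: the terms beyond [k] do not reach degree
    [k], so a finite sum computes each component of the limit. *)
Definition lsum E U (w : nat -> Salg E U) : Salg E U := fun k => (\sum_(n < k.+1) w n) k.

Lemma lsum_fil E U (w : nat -> Salg E U) N : (forall n, fil n (w n)) ->
  fil N (lsum w - \sum_(n < N) w n).
Proof.
move=> wf k kN; rewrite Salg_D Salg_N /lsum !Salg_sum.
rewrite -!(big_mkord xpredT (fun n => w n k)) (@big_cat_nat _ _ _ k.+1 0 N) //=.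
rewrite [X in _ - (_ + X)]big_nat_cond [X in _ - (_ + X)]big1 ?addr0 ?subrr //.
by move=> n /andP[/andP[kn _] _]; exact: wf.
Qed.

Lemma lsum_eq E U (v w : nat -> Salg E U) : (forall n, v n = w n) -> lsum v = lsum w.
Proof. by move=> vw; congr lsum; apply/funext. Qed.

Lemma lsum_filtered E E' U (S : Salg E U -> Salg E' U) (w : nat -> Salg E U) : filtered S ->
  (forall n, fil n (w n)) -> S (lsum w) = lsum (fun n => S (w n)).
Proof.
move=> Sf wf; apply: Salg_ext => k.
have /(Sf.2) /(_ k (ltnSn k)) := lsum_fil (N := k.+1) wf.
rewrite (filteredB Sf) Salg_D Salg_N => /eqP; rewrite subr_eq0 => /eqP ->.
by rewrite (filtered_sum Sf).
Qed.

Lemma lsumD E U (v w : nat -> Salg E U) : lsum (fun n => v n + w n) = lsum v + lsum w.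
Proof. by apply: Salg_ext => k; rewrite Salg_D /lsum big_split. Qed.

Lemma lsumM E U (v w : nat -> Salg E U) : (forall n, fil n (v n)) -> (forall n, fil n (w n)) ->
  lsum v * lsum w = lsum (fun n => \sum_(i < n.+1) v i * w (n - i)%N).
Proof.
move=> vf wf.
rewrite (lsum_filtered (filtered_mulr (lsum w) (S := id) _)) //.
apply: Salg_ext => k; rewrite {1}/lsum Salg_sum.
rewrite (eq_bigr (fun i : 'I_k.+1 => (\sum_(j < k.+1) v i * w j) k)); last first.
  move=> i _; rewrite (lsum_filtered (filtered_mull (v i) (S := id) _)) //.
rewrite /lsum Salg_sum.
rewrite [RHS](eq_bigr (fun n : 'I_k.+1 => \sum_(0 <= i < k.+1 | (i <= n)%N) (v i * w (n - i)%N) k)); last first.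
  move=> n _; rewrite Salg_sum -(big_mkord xpredT (fun i => (v i * w (n - i)%N) k)).
  rewrite (big_nat_widen 0 n.+1 k.+1) //=.
rewrite -[RHS](big_mkord xpredT (fun n => \sum_(0 <= i < k.+1 | (i <= n)%N) (v i * w (n - i)%N) k)).
rewrite [RHS](exchange_big_dep_nat xpredT) //= [RHS]big_mkord; apply: eq_bigr => i _.
rewrite Salg_sum -(big_mkord xpredT (fun j => (v i * w j) k)).
(* The products with i + j > k have no component of degree [k]; dropping them leaves the triangle of
   the Cauchy product. *)
rewrite (@big_cat_nat _ _ _ (k.+1 - i)) //=; last exact: leq_subr.
rewrite [X in _ + X]big_nat_cond [X in _ + X]big1 ?addr0; last first.
  move=> j /andP[/andP[kj _] _]; apply: (filM (vf i) (wf j)).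
  by rewrite -leq_subLR.
rewrite [RHS](_ : _ = \sum_(i <= n < k.+1) (v i * w (n - i)%N) k); last first.
  by rewrite [RHS](big_nat_widenl _ 0).
have := big_addn 0 k.+1 i xpredT (fun n => (v i * w (n - i)%N) k); rewrite add0n => ->.
by apply: eq_bigr => j _; rewrite addnK.
Qed.

End Limits.

(** The induction step of the binomial Leibniz formula for iterates, with the operator acting on the
    first or on the second argument of [G]. *)
Lemma pascal_sum (V : zmodType) (G : nat -> nat -> V) n :
  \sum_(j < n.+1) (G j.+1 (n - j)%N + G j (n - j).+1) *+ 'C(n, j) =
  \sum_(j < n.+2) G j (n.+1 - j)%N *+ 'C(n.+1, j).
Proof.
rewrite [RHS]big_ord_recl bin0 subn0 /=.
under eq_bigr do rewrite mulrnDl; rewrite big_split /= addrC.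
under [X in _ = _ + X]eq_bigr do rewrite binS mulrnDr subSS.
rewrite [X in _ = _ + X]big_split /= addrA; congr (_ + _).
transitivity (\sum_(j < n.+2) G j (n.+1 - j)%N *+ 'C(n, j)).
  rewrite [RHS]big_ord_recr /= bin_small // mulr0n addr0.
  by apply: eq_bigr => j _; rewrite subSn // -ltnS.
by rewrite big_ord_recl /= bin0 subn0.
Qed.

(** * The geodesic derivation and its Jacobi equation *)

Section Base.
Variables (X : topologicalType) (O : algSheaf X) (F : modSheaf O).
Implicit Types (U V : opens X) (E : modSheaf O).
Variables (D : forall U, O U -> F U) (g : forall U, F U -> Tpow F 2 U).

Record is_derF : Prop := IsDerF {
  dF_res : forall U V (h : opsub V U) a, pres h (D a) = D (ares O h a);
  dF_D : forall U, {morph @D U : a b / a + b};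
  dF_M : forall U (a b : O U), D (a * b) = a *: D b + b *: D a
}.
Record is_flatconn : Prop := IsFlatConn {
  fc_res : forall U V (h : opsub V U) m, pres h (g m) = g (pres h m);
  fc_P : forall U a (m m' : F U), g (a *: m + m') = tens2 (D a) m + a *: g m + g m';
  fc_flat : forall U (a : O U), T_to_A (g (D a)) = 0
}.
Hypotheses (Dd : is_derF) (gc : is_flatconn).

Local Notation vx := (@vx X O F).
Local Notation vy := (@vy X O F).
Local Notation A2 := (Salg (FF F)).
Let zero_lin : is_lin (fun U (_ : F U) => 0 : A2 U) := lin_zero F (FF F).
Let vxl : is_lin vx := vx_lin F.
Let vyl : is_lin vy := vy_lin F.

Definition DX U (a : O U) : A2 U := vx (D a).
Fact DX_der : is_derO DX.
Proof.
split=> [U V h a|U a b|U a b]; rewrite /DX.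
- by rewrite (lin_res vxl) dF_res.
- by rewrite dF_D // (linD vxl).
- by rewrite dF_M // (linP vxl) (linZ vxl).
Qed.

Definition conn_mul (p q : forall U, F U -> A2 U) U (m : F U) : A2 U := bil p q (g m).

Lemma conn_mul_res p q : is_lin p -> is_lin q ->
  forall U V (h : opsub V U) m, sres h (conn_mul p q m) = conn_mul p q (pres h m).
Proof. by move=> pl ql U V h m; rewrite /conn_mul bil_res // fc_res. Qed.

Lemma conn_mulP p q : is_lin p -> is_lin q -> forall U a (m m' : F U),
  conn_mul p q (a *: m + m') = p U (D a) * q U m + scal _ a * conn_mul p q m + conn_mul p q m'.
Proof.
move=> pl ql U a m m'; rewrite /conn_mul fc_P // -addrA -[tens2 _ _]scale1r bil_lin // scal1 mul1r.
by rewrite bil_tens2 // bil_lin // addrA.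
Qed.

Lemma conn_mul_twisted q : is_lin q -> is_twisted DX q (conn_mul vx q).
Proof.
move=> ql; split=> [U V h m|U a m m'|U m]; first exact: conn_mul_res.
  by rewrite conn_mulP // [_ * q U m + _]addrC.
exact/filW/bil_fil.
Qed.

(** In g(a m) = D(a) (x) m + a g(m) the first tensor factor is the one that differentiates. It is
    therefore always x, as in D(a) |-> x, while the second keeps the name of the generator, x or
    y. *)
Definition nabla := der_FF DX (conn_mul vx vx) (conn_mul vx vy).
Definition dxy := der_FF (fun U (_ : O U) => 0) vy (fun _ _ => 0).

Fact nabla_der : is_der (fun U u => u) nabla.
Proof. by apply: der_FFP; [exact: DX_der|exact: conn_mul_twisted|exact: conn_mul_twisted]. Qed.
Fact nabla_scal U (a : O U) : nabla (scal _ a) = vx (D a).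
Proof. by apply: der_FF_scal; [exact: DX_der|exact: conn_mul_twisted|exact: conn_mul_twisted]. Qed.
Fact nabla_x U (m : F U) : nabla (vx m) = conn_mul vx vx m.
Proof. by apply: der_FF_x; [exact: DX_der|exact: conn_mul_twisted|exact: conn_mul_twisted]. Qed.
Fact nabla_y U (m : F U) : nabla (vy m) = conn_mul vx vy m.
Proof. by apply: der_FF_y; [exact: DX_der|exact: conn_mul_twisted|exact: conn_mul_twisted]. Qed.
Fact dxy_der : is_der (fun U u => u) dxy.
Proof. by apply: der_FFP; [exact: derO0|exact: twisted_lin|exact: twisted_lin]. Qed.
Fact dxy_scal U (a : O U) : dxy (scal _ a) = 0.
Proof. by apply: der_FF_scal; [exact: derO0|exact: twisted_lin|exact: twisted_lin]. Qed.
Fact dxy_x U (m : F U) : dxy (vx m) = vy m.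
Proof. by apply: der_FF_x; [exact: derO0|exact: twisted_lin|exact: twisted_lin]. Qed.

Lemma Tpow2_eq E (S T : forall U, Tpow F 2 U -> Salg E U) :
  (forall U V (h : opsub V U) w, sres h (S U w) = S V (pres h w)) ->
  (forall U V (h : opsub V U) w, sres h (T U w) = T V (pres h w)) ->
  (forall U a w w', S U (a *: w + w') = scal E a * S U w + S U w') ->
  (forall U a w w', T U (a *: w + w') = scal E a * T U w + T U w') ->
  (forall U m m', S U (tens2 m m') = T U (tens2 m m')) ->
  forall U w, S U w = T U w.
Proof.
move=> Sr Tr Sl Tl ST U w; apply: sres_sep => x Ux.
have [V [h [z [Vx wz]]]] := eta_loc w Ux; exists V, h; split=> //.
rewrite Sr Tr wz {wz}.
have el := @eta_lin _ _ (tenspre F 2) V.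
apply: (@pmod_eq _ _ _ _ (Salg E V) idfun
  (fun z : tenspre F 2 V => S V (Defs.eta z)) (fun z : tenspre F 2 V => T V (Defs.eta z))) z.
- by move=> a y y'; rewrite el Sl scale_scal.
- by move=> a y y'; rewrite el Tl scale_scal.
move=> t; have -> : t = (fun k : 'I_2 => if k == ord0 then t ord0 else t ord_max).
  apply/funext => -[[|[|//]] kl] /=; congr t; exact/val_inj.
exact: ST.
Qed.

Lemma map_olin E E' (S : forall U, Salg E U -> Salg E' U) : is_map S ->
  (forall U a u, S U (scal E a * u) = scal E' a * S U u) ->
  forall U a u v, S U (scal E a * u + v) = scal E' a * S U u + S U v.
Proof. by move=> Sm So U a u v; rewrite (map_fil Sm U).1 So. Qed.

Lemma hom_bil E E' (p q : forall U, F U -> Salg E U) (P : forall U, Salg E U -> Salg E' U) :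
  is_lin p -> is_lin q -> is_hom P ->
  forall U w, P U (bil p q w) = bil (fun U m => P U (p U m)) (fun U m => P U (q U m)) w.
Proof.
move=> pl ql Ph; have Pm := hom_map Ph.
have Po U a u : P U (scal E a * u) = scal E' a * P U u by rewrite (hom_M Ph) (hom_scal Ph).
have pl' := lin_comp pl Pm Po; have ql' := lin_comp ql Pm Po.
apply: Tpow2_eq => [U V h w|U V h w|U a w w'|U a w w'|U m m'].
- by rewrite (hom_res Ph) bil_res.
- by rewrite bil_res.
- by rewrite bil_lin // (map_olin Pm).
- by rewrite bil_lin.
- by rewrite !bil_tens2 // (hom_M Ph).
Qed.

Fact dxy_olin U a (u : A2 U) : dxy (scal _ a * u) = scal _ a * dxy u.
Proof. by rewrite (der_M dxy_der) dxy_scal mul0r addr0. Qed.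

Fact dxy_bil (p q : forall U, F U -> A2 U) : is_lin p -> is_lin q ->
  forall U w, dxy (bil p q w) =
    bil (fun U m => dxy (p U m)) q w + bil p (fun U m => dxy (q U m)) w :> A2 U.
Proof.
move=> pl ql; have dm := der_map dxy_der.
have pl' := lin_comp pl dm dxy_olin; have ql' := lin_comp ql dm dxy_olin.
apply: Tpow2_eq => [U V h w|U V h w|U a w w'|U a w w'|U m m'].
- by rewrite (map_res dm) bil_res.
- by rewrite sresD !bil_res.
- by rewrite bil_lin // (map_olin dm dxy_olin).
- by rewrite !bil_lin // mulrDr addrACA.
- by rewrite !bil_tens2 // (der_M dxy_der) addrC.
Qed.

Lemma bil0r E (p : forall U, F U -> Salg E U) : is_lin p ->
  forall U w, bil p (fun U (_ : F U) => 0) w = 0 :> Salg E U.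
Proof.
move=> pl.
have zl := lin_zero F E.
apply: Tpow2_eq => [U V h w|U V h w|U a w w'|U a w w'|U m m'].
- by rewrite bil_res.
- exact: sres0.
- by rewrite bil_lin.
- by rewrite mulr0 addr0.
- by rewrite bil_tens2 // mulr0.
Qed.

Lemma bil_ext E (p p' q q' : forall U, F U -> Salg E U) :
  (forall U m, p U m = p' U m) -> (forall U m, q U m = q' U m) ->
  forall U w, bil p q w = bil p' q' w :> Salg E U.
Proof.
move=> pp qq U w; have -> : p = p' by apply: functional_extensionality_dep => V; apply/funext.
by have -> : q = q' by apply: functional_extensionality_dep => V; apply/funext.
Qed.

(** The operator K of the overview; on scalars it differentiates in the direction y. The operator C
    is [curv]. *)
Definition cov_der U (u : A2 U) : A2 U := dxy (nabla u) - nabla (dxy u).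
Definition curv U (u : A2 U) : A2 U := cov_der (nabla u) - nabla (cov_der u).

Fact cov_is_der : is_der (fun U u => u) cov_der.
Proof. exact: der_comm dxy_der nabla_der. Qed.
Fact curv_der : is_der (fun U u => u) curv.
Proof. exact: der_comm cov_is_der nabla_der. Qed.

Fact nabla_0 U : nabla 0 = 0 :> A2 U. Proof. exact: filtered0 (der_fil nabla_der U). Qed.
Fact dxy_0 U : dxy 0 = 0 :> A2 U. Proof. exact: filtered0 (der_fil dxy_der U). Qed.

Fact cov_scal U (a : O U) : cov_der (scal _ a) = vy (D a).
Proof. by rewrite /cov_der nabla_scal dxy_x dxy_scal nabla_0 subr0. Qed.
(** Applying d to the quadratic element x x gives y x + x y, and the second term is the value of
    nabla on y = d x. *)
Fact cov_x U (m : F U) : cov_der (vx m) = conn_mul vy vx m.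
Proof.
rewrite /cov_der nabla_x dxy_x nabla_y /conn_mul dxy_bil //.
have ddx V (m' : F V) : dxy (vx m') = vy m' by exact: dxy_x.
by rewrite (bil_ext ddx (fun _ _ => erefl)) (bil_ext (fun _ _ => erefl) ddx) addrK.
Qed.
(** Flatness enters here: the value is the difference of the elements y x and x y attached to g (D
    a), whose image in the exterior square is zero. *)
Fact curv_scal U (a : O U) : curv (scal _ a) = 0.
Proof.
rewrite /curv nabla_scal cov_scal cov_x nabla_y /conn_mul (@bil_flat _ _ _ _ vy vx) // ?subrr //.
exact: fc_flat.
Qed.
Fact curv_olin U a (u : A2 U) : curv (scal _ a * u) = scal _ a * curv u.
Proof. by rewrite (der_M curv_der) curv_scal mul0r addr0. Qed.

(* The derivation c with C = c d on the x-part (see curv_killy). *)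
Definition jacobi := der_FF (fun U (_ : O U) => 0) (fun _ _ => 0) (fun U m => curv (vx m)).
Fact jacobi_lin : is_lin (fun U (m : F U) => curv (vx m)).
Proof. by apply: lin_comp vxl (der_map curv_der) _ => U a u; exact: curv_olin. Qed.
Fact jacobi_der : is_der (fun U u => u) jacobi.
Proof. by apply: der_FFP; [exact: derO0|exact: twisted_lin|exact/twisted_lin/jacobi_lin]. Qed.
Fact jacobi_scal U (a : O U) : jacobi (scal _ a) = 0.
Proof. by apply: der_FF_scal; [exact: derO0|exact: twisted_lin|exact/twisted_lin/jacobi_lin]. Qed.
Fact jacobi_x U (m : F U) : jacobi (vx m) = 0.
Proof. by apply: der_FF_x; [exact: derO0|exact: twisted_lin|exact/twisted_lin/jacobi_lin]. Qed.
Fact jacobi_y U (m : F U) : jacobi (vy m) = curv (vx m).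
Proof. by apply: der_FF_y; [exact: derO0|exact: twisted_lin|exact/twisted_lin/jacobi_lin]. Qed.
Fact jacobi_0 U : jacobi 0 = 0 :> A2 U. Proof. exact: filtered0 (der_fil jacobi_der U). Qed.

(* The projection onto the x-part. *)
Definition killy : forall U, A2 U -> A2 U := hom_FF vx (fun _ _ => 0).
Fact killy_hom : is_hom killy. Proof. exact: hom_FFP. Qed.
Fact killy_x U (m : F U) : killy (vx m) = vx m. Proof. exact: hom_FF_x. Qed.
Fact killy_y U (m : F U) : killy (vy m) = 0. Proof. exact: hom_FF_y. Qed.

Lemma deg1_FF_eq (P Q : forall U, A2 U -> A2 U) : is_map P -> is_map Q ->
  (forall U (m : F U), P U (vx m) = Q U (vx m)) ->
  (forall U (m : F U), P U (vy m) = Q U (vy m)) ->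
  forall U (m : FF F U), P U (deg1 m) = Q U (deg1 m).
Proof.
by move=> Pm Qm Px Py U m; rewrite deg1_FF (map_fil Pm U).1 (map_fil Qm U).1 Px Py.
Qed.

Fact killy_nabla U (u : A2 U) : killy (nabla u) = nabla (killy u).
Proof.
have d1 := der_homl nabla_der killy_hom; have d2 := der_homr nabla_der killy_hom.
move: U u; apply: (der_eq d1 d2) => [U a|].
  by rewrite nabla_scal killy_x (hom_scal killy_hom) nabla_scal.
apply: (deg1_FF_eq (der_map d1) (der_map d2)) => U m.
- rewrite nabla_x killy_x nabla_x /conn_mul (hom_bil _ _ killy_hom) //.
  exact: bil_ext killy_x killy_x _ _.
- rewrite nabla_y killy_y nabla_0 /conn_mul (hom_bil _ _ killy_hom) //.
  rewrite (bil_ext killy_x killy_y); exact: bil0r.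
Qed.

Fact jacobi_killy U (u : A2 U) : jacobi (killy u) = 0.
Proof.
have d2 := der_homr jacobi_der killy_hom.
have d0 : is_der killy (fun U (_ : A2 U) => 0 : A2 U).
  split=> [V W h w|V|V v w]; first exact: sres0; last by rewrite mulr0 mul0r addr0.
  by split=> [v w|n v _]; [rewrite addr0|exact: fil0].
move: U u; apply: (der_eq d2 d0) => [U a|]; first by rewrite (hom_scal killy_hom) jacobi_scal.
apply: (deg1_FF_eq (der_map d2) (der_map d0)) => U m.
- by rewrite killy_x jacobi_x.
- by rewrite killy_y jacobi_0.
Qed.

(** On the x-part, c d satisfies the Leibniz rule because c vanishes there and so is linear over it;
    both sides then only have to be compared on generators. *)
Fact curv_killy U (u : A2 U) : curv (killy u) = jacobi (dxy (killy u)).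
Proof.
have d1 := der_homr curv_der killy_hom.
have m2 := comp_is_map (comp_is_map (hom_map killy_hom) (der_map dxy_der)) (der_map jacobi_der).
move: U u; apply: (eq_on_generators (der_map d1) m2) => [U a||U u v Hu Hv].
- by rewrite (hom_scal killy_hom) curv_scal dxy_scal jacobi_0.
- apply: (deg1_FF_eq (der_map d1) m2) => U m.
    by rewrite killy_x dxy_x jacobi_y.
  by rewrite killy_y dxy_0 jacobi_0 (filtered0 (der_fil curv_der U)).
rewrite (hom_M killy_hom) (der_M curv_der) Hu Hv (der_M dxy_der) (der_fil jacobi_der U).1.
by rewrite !(der_M jacobi_der) !jacobi_killy mul0r mulr0 addr0 add0r.
Qed.

Fact nabla_fil n U (u : A2 U) : fil n u -> fil n.+1 (nabla u).
Proof.
rewrite -addn1; apply: (map_shift (der_map nabla_der)) => [W a|W m|i j W v w ui vj].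
- by rewrite nabla_scal; exact: lin_fil.
- rewrite deg1_FF (der_fil nabla_der W).1 nabla_x nabla_y; apply: filD; exact: bil_fil.
move=> nu nv; rewrite (der_M nabla_der); apply: filD.
  by rewrite -addnA; exact: filM.
by rewrite addnAC; exact: filM.
Qed.

Fact cov_fil n U (u : A2 U) : fil n u -> fil n.+1 (cov_der u).
Proof.
move=> un; apply: filB; first exact/(der_fil dxy_der U).2/nabla_fil.
exact/nabla_fil/(der_fil dxy_der U).2.
Qed.

Fact curv_fil n U (u : A2 U) : fil n u -> fil n.+2 (curv u).
Proof. by move=> un; apply: filB; [exact/cov_fil/nabla_fil|exact/nabla_fil/cov_fil]. Qed.

Fact jacobi_fil n U (u : A2 U) : fil n u -> fil n.+2 (jacobi u).
Proof.
rewrite -addn2; apply: (map_shift (der_map jacobi_der)) => [W a|W m|i j W v w ui vj].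
- by rewrite jacobi_scal; exact: fil0.
- by rewrite deg1_FF (der_fil jacobi_der W).1 jacobi_x jacobi_y add0r; exact/curv_fil/lin_fil.
move=> nu nv; rewrite (der_M jacobi_der); apply: filD.
  by rewrite -addnA; exact: filM.
by rewrite addnAC; exact: filM.
Qed.

Definition nabla_iter U (a : O U) n : A2 U := iter n (@nabla U) (scal _ a).
Definition jacobi_step U (w : A2 U * A2 U) : A2 U * A2 U :=
  (nabla w.1 + w.2, nabla w.2 + jacobi w.1).
Definition jacobi_iter U (m : F U) n : A2 U * A2 U := iter n (@jacobi_step U) (0, vy m).

Fact nabla_iter_fil U (a : O U) n : fil n (nabla_iter a n).
Proof. by elim: n => // n IHn; exact: nabla_fil. Qed.

(** The second component stays one degree ahead of the first; this persists because [jacobi] raises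
    degrees by two while [nabla] raises them by one. *)
Fact jacobi_iter_fil U (m : F U) n : fil n (jacobi_iter m n).1 /\ fil n.+1 (jacobi_iter m n).2.
Proof.
elim: n => [|n [H1 H2]]; first by split=> //; exact: lin_fil.
split; apply: filD => //=; [exact: nabla_fil|exact: nabla_fil|exact: jacobi_fil].
Qed.

Fact killy_nabla_iter U (a : O U) n : killy (nabla_iter a n) = nabla_iter a n.
Proof. by elim: n => [|n IHn] /=; [exact: hom_scal killy_hom _ _|rewrite killy_nabla IHn]. Qed.

Fact jacobi_iter_D U (a : O U) n :
  dxy (nabla_iter a n) = (jacobi_iter (D a) n).1 /\
  cov_der (nabla_iter a n) = (jacobi_iter (D a) n).2.
Proof.
elim: n => [|n [H1 H2]] /=; first by rewrite dxy_scal cov_scal.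
rewrite -H1 -H2; split.
  by rewrite /cov_der addrC subrK.
(* The iterates of [nabla] on a scalar remain in the x-part, where C = c d. *)
have -> : jacobi (dxy (nabla_iter a n)) = curv (nabla_iter a n).
  by rewrite -(killy_nabla_iter a n) curv_killy.
by rewrite /curv addrC subrK.
Qed.

Fact jacobi_iter_res U V (h : opsub V U) (m : F U) n :
  sres h (jacobi_iter m n).1 = (jacobi_iter (pres h m) n).1 /\
  sres h (jacobi_iter m n).2 = (jacobi_iter (pres h m) n).2.
Proof.
elim: n => [|n [H1 H2]] /=; first by rewrite sres0 (lin_res vyl).
by rewrite !sresD !(der_res nabla_der) (der_res jacobi_der) H1 H2.
Qed.

(** [jacobi] is linear over the x-part, so [jacobi_step] obeys the Leibniz rule along [nabla] for
    multiplication of pairs by x-parts. Divided by the factorial of n and summed, the binomial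
    formula becomes the semilinearity of H. *)
Fact jacobi_iter_P U (a : O U) (m m' : F U) n :
  (jacobi_iter (a *: m + m') n).1 =
    \sum_(j < n.+1) (nabla_iter a j * (jacobi_iter m (n - j)).1) *+ 'C(n, j) + (jacobi_iter m' n).1 /\
  (jacobi_iter (a *: m + m') n).2 =
    \sum_(j < n.+1) (nabla_iter a j * (jacobi_iter m (n - j)).2) *+ 'C(n, j) + (jacobi_iter m' n).2.
Proof.
have sumS (S : A2 U -> A2 U) (r : nat -> A2 U) N k : filtered S ->
    S (\sum_(j < k) r j *+ 'C(N, j)) = \sum_(j < k) S (r j) *+ 'C(N, j).
  move=> Sf; rewrite (filtered_sum Sf); apply: eq_bigr => j _.
  elim: 'C(N, j) => [|c IHc]; first by rewrite !mulr0n (filtered0 Sf).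
  by rewrite !mulrS Sf.1 IHc.
have jz b k : jacobi (nabla_iter b k) = 0 by rewrite -killy_nabla_iter jacobi_killy.
have [nf jf] := (der_fil nabla_der U, der_fil jacobi_der U).
elim: n => [|n [H1 H2]].
  by rewrite !big_ord1 /= mulr0 mul0rn addr0 (linP vyl).
rewrite [LHS](_ : _ = nabla (jacobi_iter (a *: m + m') n).1 + (jacobi_iter (a *: m + m') n).2) //.
rewrite [X in _ /\ X](_ : _ =
  (nabla (jacobi_iter (a *: m + m') n).2 + jacobi (jacobi_iter (a *: m + m') n).1 =
  \sum_(j < n.+2) (nabla_iter a j * (jacobi_iter m (n.+1 - j)).2) *+ 'C(n.+1, j) + (jacobi_iter m' n.+1).2)) //.
have N1 := sumS _ (fun j => nabla_iter a j * (jacobi_iter m (n - j)%N).1) n n.+1 nf.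
have N2 := sumS _ (fun j => nabla_iter a j * (jacobi_iter m (n - j)%N).2) n n.+1 nf.
have J1 := sumS _ (fun j => nabla_iter a j * (jacobi_iter m (n - j)%N).1) n n.+1 jf.
rewrite H1 H2 !nf.1 jf.1 N1 N2 J1.
rewrite -(pascal_sum (fun j k => nabla_iter a j * (jacobi_iter m k).1)).
rewrite -(pascal_sum (fun j k => nabla_iter a j * (jacobi_iter m k).2)).
split; rewrite addrACA -big_split.
  congr (_ + _); apply: eq_bigr => j _.
  by rewrite /= (der_M nabla_der) -mulrnDl mulrDr addrAC addrC.
congr (_ + _); apply: eq_bigr => j _.
rewrite /= (der_M nabla_der) (der_M jacobi_der) jz mul0r addr0 -mulrnDl mulrDr.
by rewrite addrAC addrC.
Qed.

End Base.

(** Inverses are unique; hence the scalars 1/n are compatible with restriction. *)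
Lemma rat_inv_uniq (R : comPzRingType) (f f' : {rmorphism rat -> R}) n :
  (0 < n)%N -> f n%:R^-1 = f' n%:R^-1.
Proof.
move=> n0; have nQ : (n%:R : rat) != 0 by rewrite Num.Theory.pnatr_eq0 -lt0n.
have fn (k : {rmorphism rat -> R}) : k n%:R^-1 * n%:R = 1.
  by rewrite -(rmorph_nat k) -rmorphM mulVf // rmorph1.
by rewrite -[LHS]mulr1 -(fn f') [f' _ * _]mulrC mulrA fn mul1r.
Qed.

(** * The exponential of nabla is a base *)

Section BaseExist.
Variables (X : topologicalType) (O : algSheaf X) (F : modSheaf O).
Implicit Types (U V : opens X) (E : modSheaf O).
Local Notation vx := (@vx X O F).
Local Notation vy := (@vy X O F).
Local Notation A2 := (Salg (FF F)).

Definition incl : forall U, Salg F U -> A2 U := hom_ext vx.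
Lemma incl_hom : is_hom incl. Proof. exact/hom_extP/vx_lin. Qed.
Lemma incl_deg1 U (m : F U) : incl (deg1 m) = vx m. Proof. exact/hom_ext_deg1/vx_lin. Qed.

Record is_base (D : forall U, O U -> F U) (h : forall U, O U -> Salg F U)
    (H : forall U, F U -> A2 U) : Prop := IsBase {
  base_res : forall U V (k : opsub V U) m, sres k (H U m) = H V (pres k m);
  base_P : forall U a m m', H U (a *: m + m') = incl (h U a) * H U m + H U m';
  base_D : forall U a, dxy (incl (h U a)) = H U (D U a);
  base_H : forall U m, fil 2 (H U m - vy m);
  base_h : forall U a, fil 1 (h U a - scal F a)
}.

Definition inv_fact n U : O U := aQ O U (n`!%:R^-1).

Lemma inv_fact_res n U V (h : opsub V U) : ares O h (inv_fact n U) = inv_fact n V.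
Proof.
exact: (rat_inv_uniq (GRing.RMorphism.clone _ _ (ares O h \o aQ O U) _) _ (fact_gt0 n)).
Qed.

Lemma inv_fact_bin U n j : (j <= n)%N ->
  inv_fact n U *+ 'C(n, j) = inv_fact j U * inv_fact (n - j) U.
Proof.
move=> jn; rewrite /inv_fact -rmorphMn -rmorphM; congr (aQ O U _).
have fQ k : (k`!%:R : rat) != 0 by rewrite Num.Theory.pnatr_eq0 -lt0n fact_gt0.
apply: (mulfI (fQ n)); rewrite mulrnAr divff // -[in RHS](bin_fact jn) !natrM.
by rewrite -mulrA mulrACA !divff // !mulr1.
Qed.

(** The exponential is formed in S(F + F), where d acts. Since it lies in the x-part
    ([killy_exp_nabla]), projecting it to S(F) loses nothing. *)
Definition proj : forall U, A2 U -> Salg F U := hom_FF (@deg1 X O F) (fun _ _ => 0).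
Lemma proj_hom : is_hom proj. Proof. apply: hom_FFP; [exact: lin_deg1|exact: lin_zero]. Qed.
Lemma incl_proj U (u : A2 U) : incl (proj u) = killy u.
Proof.
move: U u; apply: hom_eq (hom_comp proj_hom incl_hom) (killy_hom F) _.
apply: (deg1_FF_eq (comp_is_map (hom_map proj_hom) (hom_map incl_hom)) (hom_map (killy_hom F))) => U m.
  by rewrite /proj hom_FF_x ?incl_deg1 ?killy_x //; [exact: lin_deg1|exact: lin_zero].
rewrite /proj hom_FF_y ?killy_y; [|exact: lin_deg1|exact: lin_zero].
exact: filtered0 (hom_fil incl_hom U).
Qed.

Lemma filtered_Z E E' U (S : Salg E U -> Salg E' U) a :
  (forall u, S (scal E a * u) = scal E' a * S u) -> forall u, S (a *: u) = a *: S u.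
Proof. by move=> So u; rewrite !scale_scal. Qed.

Variables (D : forall U, O U -> F U) (g : forall U, F U -> Tpow F 2 U).
Hypotheses (Dd : is_derF D) (gc : is_flatconn D g).

Let zfil := nabla_iter_fil Dd gc.
Let wfil := jacobi_iter_fil Dd gc.

Definition exp_nabla U (a : O U) : A2 U := lsum (fun n => inv_fact n U *: nabla_iter D g a n).
Definition exp_jacobi U (m : F U) : A2 U := lsum (fun n => inv_fact n U *: (jacobi_iter D g m n).1).

Lemma inv_fact0 U : inv_fact 0 U = 1. Proof. by rewrite /inv_fact fact0 invr1 rmorph1. Qed.
Lemma inv_fact1 U : inv_fact 1 U = 1. Proof. by rewrite /inv_fact invr1 rmorph1. Qed.

Lemma killy_exp_nabla U (a : O U) : killy (exp_nabla a) = exp_nabla a.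
Proof.
rewrite /exp_nabla (lsum_filtered (hom_fil (killy_hom F) U)) => [|n]; last exact/filZ/zfil.
apply: lsum_eq => n; rewrite filtered_Z ?killy_nabla_iter // => u.
by rewrite (hom_M (killy_hom F)) (hom_scal (killy_hom F)).
Qed.

Lemma exp_base : is_base D (fun U a => proj (exp_nabla a)) exp_jacobi.
Proof.
split=> [U V k m|U a m m'|U a|U m|U a].
- apply: Salg_ext => n; rewrite /exp_jacobi /lsum sresE -sresE sres_sum.
  rewrite (eq_bigr (fun i : 'I_n.+1 => inv_fact i V *: (jacobi_iter D g (pres k m) i).1)) // => i _.
  by rewrite sresZ inv_fact_res; have [-> _] := jacobi_iter_res Dd gc k m i.
- rewrite incl_proj killy_exp_nabla /exp_nabla /exp_jacobi lsumM => [|n|n]; first last.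
  + by apply: filZ; have [] := wfil m n.
  + exact/filZ/zfil.
  rewrite -lsumD; apply: lsum_eq => n.
  have [-> _] := jacobi_iter_P Dd gc a m m' n; rewrite scalerDr scaler_sumr.
  congr (_ + _); apply: eq_bigr => j _.
  rewrite -scalerMnr scalerMnl inv_fact_bin; last by rewrite -ltnS.
  by rewrite Salg_scaleAl Salg_scaleAr scalerA.
- rewrite incl_proj killy_exp_nabla /exp_nabla /exp_jacobi (lsum_filtered (der_fil (dxy_der F) U)) => [|n].
    apply: lsum_eq => n; rewrite filtered_Z; last by move=> u; exact: dxy_olin.
    by have [-> _] := jacobi_iter_D Dd gc a n.
  exact/filZ/zfil.
(* The terms of index 0 and 1 are 0 and [vy m], hence the leading term y and the cut at 2. *)
- have := @lsum_fil _ _ (FF F) U (fun n => inv_fact n U *: (jacobi_iter D g m n).1) 2.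
  rewrite -/(exp_jacobi m) !big_ord_recl big_ord0 /= inv_fact1 scaler0 add0r addr0 scale1r.
  rewrite (filtered0 (der_fil (nabla_der Dd gc) U)) add0r; apply=> n.
  by apply: filZ; have [] := wfil m n.
- have := @lsum_fil _ _ (FF F) U (fun n => inv_fact n U *: nabla_iter D g a n) 1.
  rewrite -/(exp_nabla a) big_ord1 inv_fact0 scale1r /= => H.
  have {}H : fil 1 (exp_nabla a - scal _ a) by apply: H => n; exact/filZ/zfil.
  rewrite -(hom_scal proj_hom a) -(filteredB (hom_fil proj_hom U)).
  exact: (hom_fil proj_hom U).2.
Qed.

End BaseExist.

(** * Comparison with iterated Hasse derivations *)

Section Euler.
Variables (X : topologicalType) (O : algSheaf X).
Implicit Types (U V : opens X) (E : modSheaf O).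

Definition euler E U (w : Salg E U) : Salg E U := fun n => w n *+ n.

Lemma euler_filtered E U : filtered (@euler E U).
Proof.
split=> [u v|n u un k kn]; last by rewrite /euler un ?mul0rn.
by apply: Salg_ext => n; rewrite Salg_D /euler Salg_D mulrnDl.
Qed.

Lemma Salg_muln E U (u : Salg E U) k n : (u *+ k) n = u n *+ k.
Proof. by elim: k => [|k IHk]; rewrite ?mulr0n // !mulrS Salg_D IHk. Qed.

Lemma euler_homog E n U (s : Spow E n U) : euler (homog s) = homog s *+ n.
Proof.
apply: Salg_ext => k; rewrite Salg_muln /euler; have [nk|nk] := eqVneq n k; first by subst k.
by rewrite homog_neq // !mul0rn.
Qed.

Lemma euler_der E : is_der (fun U (u : Salg E U) => u) (@euler E).
Proof.
split=> [U V h w|U|U u v]; [|exact: euler_filtered|].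
  apply: Salg_ext => n; rewrite sresE /euler sresE.
  have presMn k (x : Spow E n U) : pres h (x *+ k) = pres h x *+ k.
    by elim: k => [|k IHk]; rewrite ?mulr0n ?pres0 // !mulrS presD IHk.
  exact: presMn.
have ef := euler_filtered E U.
apply: (@filtered_eq _ _ E E U (fun u => euler (u * v)) (fun u => u * euler v + euler u * v)) u => [||i s].
- by apply: filtered_comp ef; exact: (filtered_mulr v (S := id)).
- apply: filteredD; [exact: (filtered_mulr _ (S := id))|exact: filtered_mulr].
apply: (@filtered_eq _ _ E E U (fun v => euler (homog s * v))
  (fun v => homog s * euler v + euler (homog s) * v)) v => [||j t].
- by apply: filtered_comp ef; exact: (filtered_mull _ (S := id)).
- apply: filteredD; [exact: filtered_mull|exact: (filtered_mull _ (S := id))].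
rewrite (homogM (erefl (i + j)%N)) !euler_homog mulrnAr mulrnAl -mulrnDr.
by rewrite (homogM (erefl (i + j)%N)); congr (_ *+ _); rewrite addnC.
Qed.

Lemma euler_scal E U (a : O U) : euler (scal E a) = 0.
Proof. by rewrite scal_homog euler_homog mulr0n. Qed.
Lemma euler_deg1 E U (m : E U) : euler (deg1 m) = deg1 m.
Proof. by rewrite /deg1 euler_homog. Qed.
Lemma euler_olin E U a (u : Salg E U) : euler (scal E a * u) = scal E a * euler u.
Proof. by rewrite (der_M (@euler_der E)) euler_scal mul0r addr0. Qed.

Lemma natr_inv U n : aQ O U n.+1%:R^-1 * n.+1%:R = 1.
Proof.
rewrite -(rmorph_nat (aQ O U)) -rmorphM mulVf ?rmorph1 //.
by rewrite Num.Theory.pnatr_eq0.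
Qed.

(** In degree k + 1 the Euler derivation is multiplication by the invertible k + 1; degree 0, which
    it kills, is handled by the first hypothesis. *)
Lemma euler_fil E U n (w : Salg E U) : w 0%N = 0 -> fil n (euler w) -> fil n w.
Proof.
move=> w0 wn [|k] kn //; rewrite -[w _]scale1r -(natr_inv U k) -scalerA scaler_nat.
by rewrite -/(euler w k.+1) wn ?scaler0.
Qed.

(** The difference is not a derivation, but P(u)P(v) - Q(u)Q(v) splits as P(u)(P - Q)(v) + (P -
    Q)(u)Q(v), which suffices for [map_shift]. *)
Lemma hom_shift E E' (P Q : forall U, Salg E U -> Salg E' U) n : is_hom P -> is_hom Q ->
  (forall U (m : E U), fil n.+1 (P U (deg1 m) - Q U (deg1 m))) ->
  forall p U u, fil p u -> fil (p + n) (P U u - Q U u).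
Proof.
move=> Ph Qh PQ; have [Pm Qm] := (hom_map Ph, hom_map Qh).
apply: (map_shift (sub_is_map Pm Qm)) => [U a|U m|i j U u v ui vj Hu Hv].
- by rewrite (hom_scal Ph) (hom_scal Qh) subrr; exact: fil0.
- by rewrite add1n; exact: PQ.
rewrite (hom_M Ph) (hom_M Qh).
have -> : P U u * P U v - Q U u * Q U v =
    P U u * (P U v - Q U v) + (P U u - Q U u) * Q U v.
  by rewrite mulrBr mulrBl addrA subrK.
apply: filD; first by rewrite -addnA; apply: filM => //; exact: (map_fil Pm U).2.
by rewrite addnAC; apply: filM => //; exact: (map_fil Qm U).2.
Qed.

(* The inverse is the Neumann series of 1 - S. *)
Lemma unipotent_bij E U (S : Salg E U -> Salg E U) : filtered S ->
  (forall p u, fil p u -> fil p.+1 (S u - u)) -> bijective S.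
Proof.
move=> Sf SU.
pose approx v n := iter n (fun u => u + (v - S u)) 0.
have apP v n : fil n (v - S (approx v n)).
  elim: n => [|n IHn] //; rewrite [approx v _]/(_ + _) Sf.1 opprD addrA.
  by rewrite -opprB; apply/filN/SU.
pose inv v : Salg E U := fun k => approx v k.+1 k.
have apS v n k : (n <= k)%N -> fil n (approx v k - approx v n).
  elim: k => [|k IHk]; first by rewrite leqn0 => /eqP ->.
  rewrite leq_eqVlt => /predU1P[<-|]; first by rewrite subrr.
  rewrite ltnS => nk; rewrite [approx v k.+1]/(_ + _) addrAC.
  by apply: filD; [exact: IHk|exact: filW (apP _ _)].
have invP v n : fil n (inv v - approx v n).
  move=> k kn; have := apS v k.+1 n kn k (ltnSn k).
  by rewrite !Salg_D !Salg_N => /eqP; rewrite subr_eq0 => /eqP ->; rewrite subrr.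
have S_inv v : S (inv v) = v.
  apply/eqP; rewrite -subr_eq0; apply/eqP/fil_eq0 => n.
  rewrite -[inv v](subrK (approx v n)) Sf.1 -addrA; apply: filD; first exact: Sf.2.
  by rewrite -opprB; apply/filN/apP.
have S_inj : injective S.
  move=> u v /eqP; rewrite -subr_eq0 -(filteredB Sf) => /eqP E0.
  apply/eqP; rewrite -subr_eq0; apply/eqP/fil_eq0; elim=> // n IHn.
  by rewrite -[_ - _]opprK -[- (u - v)]add0r -{1}E0; apply/filN/SU.
by exists inv => // u; apply: S_inj; rewrite S_inv.
Qed.

End Euler.

(** To be read with h = h'(a), p = phi(h(a)), q = a, t = tau(m) and s = Theta(H(m)): the left side
    measures how far t - s is from being O-linear, and each product on the right is of higher
    order. *)
Lemma twisted_diff (R : comPzRingType) (h t t' p s s' q : R) :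
  h * t + t' - (p * s + s') - (q * (t - s) + (t' - s')) = (h - q) * (t - s) + (h - p) * s.
Proof.
have -> : h * t + t' - (p * s + s') = h * t - p * s + (t' - s') by rewrite opprD addrACA.
rewrite opprD addrACA subrr addr0 !mulrBl [h * (t - s)]mulrBr [RHS]addrAC.
by rewrite [X in _ = X - _]addrA subrK.
Qed.

(** Here s and s' are Theta(H(m)) before and after a correction step, e is the old Theta(y), and p
    is the change of Theta(y). *)
Lemma subr_telescope (V : zmodType) (t s s' e p : V) :
  t - s' = (t - s - p) - ((s' - (e + p)) - (s - e)).
Proof.
have -> : s' - (e + p) - (s - e) = s' - s - p.
  by rewrite opprB opprD !addrA [_ - p + e]addrAC subrK addrAC.
by rewrite opprB addrA subrK opprB addrA subrK.
Qed.

(** * The algebra maps attached to a linear map on F *)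

Section Compare.
Variables (X : topologicalType) (O : algSheaf X) (F : modSheaf O).
Implicit Types (U V : opens X).
Local Notation vx := (@vx X O F).
Local Notation vy := (@vy X O F).
Local Notation A1 := (Salg F).
Local Notation A2 := (Salg (FF F)).

Lemma is_der_eq_hom E E' (P P' d : forall U, Salg (O := O) E U -> Salg E' U) :
  (forall U u, P U u = P' U u) -> is_der P d -> is_der P' d.
Proof. by move=> PP [r f M]; split=> // U u v; rewrite M !PP. Qed.

Section Theta.
Variable f : forall U, F U -> A1 U.
Hypothesis fl : is_lin f.

Fact euler_lin : is_lin (fun U m => euler (f m)).
Proof. by apply: lin_comp fl (der_map (euler_der F)) _ => U a u; exact: euler_olin. Qed.

Definition Theta : forall U, A2 U -> A1 U := hom_FF f (fun U m => euler (f m)).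
Definition phi : forall U, A1 U -> A1 U := hom_ext f.

Lemma Theta_hom : is_hom Theta. Proof. exact: hom_FFP fl euler_lin. Qed.
Lemma Theta_x U (m : F U) : Theta (vx m) = f m. Proof. exact: hom_FF_x fl euler_lin _ _. Qed.
Lemma Theta_y U (m : F U) : Theta (vy m) = euler (f m).
Proof. exact: hom_FF_y fl euler_lin _ _. Qed.
Lemma phi_hom : is_hom phi. Proof. exact: hom_extP fl. Qed.
Lemma phi_deg1 U (m : F U) : phi (deg1 m) = f m. Proof. exact: hom_ext_deg1 fl _ _. Qed.

Lemma Theta_incl U (u : A1 U) : Theta (incl u) = phi u.
Proof.
move: U u; apply: hom_eq (hom_comp (incl_hom F) Theta_hom) phi_hom _ => U m.
by rewrite incl_deg1 Theta_x phi_deg1.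
Qed.

(** Both sides are derivations along phi that kill scalars and send m to E(f(m)). *)
Lemma Theta_dxy U (u : A1 U) : Theta (dxy (incl u)) = euler (phi u).
Proof.
have d1 := der_homl (der_homr (dxy_der F) (incl_hom F)) Theta_hom.
have d2 := der_homr (euler_der F) phi_hom.
move: U u; apply: der_eq (is_der_eq_hom Theta_incl d1) d2 _ _ => U a.
  rewrite (hom_scal (incl_hom F)) dxy_scal (hom_scal phi_hom) euler_scal.
  exact: filtered0 (hom_fil Theta_hom U).
by rewrite incl_deg1 dxy_x Theta_y phi_deg1.
Qed.

(** The prolongation of phi to S(F + F): the value on y is chosen so that [chi] commutes with d
    ([chi_dxy]), and [chi] then carries H to the map required for phi h. *)
Definition chi : forall U, A2 U -> A2 U :=
  hom_FF (fun U m => incl (f m)) (fun U m => dxy (incl (f m))).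

Fact incl_olin U a (u : A1 U) : incl (scal F a * u) = scal _ a * incl u.
Proof. by rewrite (hom_M (incl_hom F)) (hom_scal (incl_hom F)). Qed.

Fact incl_f_lin : is_lin (fun U m => incl (f m)).
Proof. exact: lin_comp fl (hom_map (incl_hom F)) incl_olin. Qed.
Fact dxy_incl_f_lin : is_lin (fun U m => dxy (incl (f m))).
Proof. exact: lin_comp incl_f_lin (der_map (dxy_der F)) (@dxy_olin _ _ F). Qed.

Lemma chi_hom : is_hom chi. Proof. exact: hom_FFP incl_f_lin dxy_incl_f_lin. Qed.
Lemma chi_x U (m : F U) : chi (vx m) = incl (f m).
Proof. exact: hom_FF_x incl_f_lin dxy_incl_f_lin _ _. Qed.
Lemma chi_y U (m : F U) : chi (vy m) = dxy (incl (f m)).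
Proof. exact: hom_FF_y incl_f_lin dxy_incl_f_lin _ _. Qed.

Lemma chi_incl U (u : A1 U) : chi (incl u) = incl (phi u).
Proof.
move: U u; apply: hom_eq (hom_comp (incl_hom F) chi_hom) (hom_comp phi_hom (incl_hom F)) _ => U m.
by rewrite incl_deg1 chi_x phi_deg1.
Qed.

Lemma chi_dxy U (u : A1 U) : chi (dxy (incl u)) = dxy (incl (phi u)).
Proof.
have d1 := der_homl (der_homr (dxy_der F) (incl_hom F)) chi_hom.
have d2 := der_homr (dxy_der F) (hom_comp phi_hom (incl_hom F)).
move: U u; apply: der_eq (is_der_eq_hom chi_incl d1) d2 _ _ => U a.
  rewrite (hom_scal (incl_hom F)) dxy_scal (hom_scal phi_hom) (hom_scal (incl_hom F)) dxy_scal.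
  exact: filtered0 (hom_fil chi_hom U).
by rewrite incl_deg1 dxy_x chi_y phi_deg1.
Qed.

Lemma base_phi D h H : (forall U m, fil 2 (f m - deg1 m : A1 U)) ->
  is_base D h H -> is_base D (fun U a => phi (h U a)) (fun U m => chi (H U m)).
Proof.
move=> f1 [Hr HP HD Hy h0]; split=> [U V k m|U a m m'|U a|U m|U a].
- by rewrite (hom_res chi_hom) Hr.
- by rewrite HP (hom_fil chi_hom U).1 (hom_M chi_hom) chi_incl.
- by rewrite -chi_dxy HD.
- have -> : chi (H U m) - vy m = chi (H U m - vy m) + (chi (vy m) - vy m).
    by rewrite (filteredB (hom_fil chi_hom U)) addrA subrK.
  apply: filD; first exact/(hom_fil chi_hom U).2/Hy.
  (* The difference of [chi (vy m)] and [vy m] is d of the inclusion of [f m - deg1 m], which starts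
     in degree two. *)
  rewrite chi_y -dxy_x -incl_deg1.
  rewrite -(filteredB (der_fil (dxy_der F) U)) -(filteredB (hom_fil (incl_hom F) U)).
  exact/(der_fil (dxy_der F) U).2/(hom_fil (incl_hom F) U).2.
- rewrite -(hom_scal phi_hom a) -(filteredB (hom_fil phi_hom U)).
  exact/(hom_fil phi_hom U).2.
Qed.

End Theta.

Lemma Theta_diff (f f' : forall U, F U -> A1 U) n : is_lin f -> is_lin f' ->
  (forall U m, fil n.+1 (f U m - f' U m)) ->
  forall p U (u : A2 U), fil p u -> fil (p + n) (Theta f u - Theta f' u).
Proof.
move=> fl fl' ff; apply: (hom_shift (Theta_hom fl) (Theta_hom fl')) => U m.
rewrite deg1_FF (hom_fil (Theta_hom fl) U).1 (hom_fil (Theta_hom fl') U).1.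
rewrite !Theta_x // !Theta_y // opprD addrACA; apply: filD; first exact: ff.
by rewrite -(filteredB (euler_filtered F U)); apply/(euler_filtered F U).2.
Qed.

(** What remains of an extended connection in S(F). In [it_D] the Euler derivation absorbs the
    factors 1/i of the definition of iterated. *)
Record is_iter (D : forall U, O U -> F U) (h' : forall U, O U -> A1 U)
    (tau : forall U, F U -> A1 U) : Prop := IsIter {
  it_res : forall U V (k : opsub V U) m, sres k (tau U m) = tau V (pres k m);
  it_P : forall U a m m', tau U (a *: m + m') = h' U a * tau U m + tau U m';
  it_D : forall U a, euler (h' U a) = tau U (D U a);
  it_1 : forall U m, fil 2 (tau U m - deg1 m);
  it_h : forall U a, fil 1 (h' U a - scal F a)
}.

(** * Solving Theta H = T' degree by degree *)

Section Recursion.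
Variables (D : forall U, O U -> F U) (h : forall U, O U -> A1 U) (H : forall U, F U -> A2 U).
Variables (h' : forall U, O U -> A1 U) (tau : forall U, F U -> A1 U).
Hypotheses (hb : is_base D h H) (hi : is_iter D h' tau).

Fact tau_fil U (m : F U) : fil 1 (tau m).
Proof.
rewrite -[tau m](subrK (deg1 m)); apply: filD; last exact: fil_deg1.
exact: filW (it_1 hi m).
Qed.

Fact H_fil U (m : F U) : fil 1 (H m).
Proof.
rewrite -[H m](subrK (vy m)); apply: filD; last exact: (lin_fil (vy_lin F)).
exact: filW (base_H hb m).
Qed.

Fact phi_h_fil f U (a : O U) : is_lin f -> fil 1 (phi f (h a) - scal F a).
Proof.
move=> fl; rewrite -(hom_scal (phi_hom fl) a) -(filteredB (hom_fil (phi_hom fl) U)).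
exact/(hom_fil (phi_hom fl) U).2/(base_h hb).
Qed.

(** E (h' a - phi h a) is the defect tau - Theta H at D(a); E can be undone since the difference has
    no component of degree 0. *)
Lemma agree_fil f n : is_lin f -> (forall U (m : F U), fil n (tau m - Theta f (H m))) ->
  forall U (a : O U), fil n (h' a - phi f (h a)).
Proof.
move=> fl fn U a; apply: euler_fil.
  suff : fil 1 (h' a - phi f (h a)) by apply.
  have -> : h' a - phi f (h a) = (h' a - scal F a) - (phi f (h a) - scal F a).
    by rewrite opprB addrA subrK.
  by apply: filB; [exact: (it_h hi)|exact: phi_h_fil].
rewrite (filteredB (euler_filtered F U)) (it_D hi) -Theta_dxy // (base_D hb); exact: fn.
Qed.

Definition delta (f : forall U, F U -> A1 U) U (m : F U) : A1 U := tau m - Theta f (H m).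
(** The division by n compensates for E in Theta(y) = E(f), see [euler_corr]. *)
Definition corr (f : forall U, F U -> A1 U) n U (m : F U) : A1 U :=
  homog (aQ O U (n%:R^-1) *: delta f m n).
(* The n-th step adds a term of degree n, which changes Theta (H m) in degree n by n
   times that term, since H m = y + terms of higher degree. *)
Fixpoint approx n : forall U, F U -> A1 U :=
  if n is k.+1 then fun U m => approx k m + corr (approx k) k.+1 m else fun _ _ => 0.

(** The leading part of the defect is O-linear. By [twisted_diff] the error consists of (h' a - a)
    times a defect in [fil n.+1], and of h' a - phi h a, in [fil n.+1] by [agree_fil], times an
    element of [fil 1]. *)
Fact delta_fil2 f n : is_lin f -> (forall U (m : F U), fil n.+1 (delta f m)) ->
  forall U a (m m' : F U),
    delta f (a *: m + m') n.+1 = a *: delta f m n.+1 + delta f m' n.+1.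
Proof.
move=> fl fn U a m m'.
suff : fil n.+2 (delta f (a *: m + m') - (a *: delta f m + delta f m')).
  by move=> /(_ n.+1 (ltnSn _)) /eqP; rewrite Salg_D Salg_N subr_eq0 => /eqP ->.
rewrite scale_scal {1}/delta (it_P hi) (base_P hb) (hom_fil (Theta_hom fl) U).1.
rewrite (hom_M (Theta_hom fl)) Theta_incl // [X in _ - (_ + X)]/delta.
rewrite twisted_diff; apply: filD.
  by apply: (@filM _ _ _ 1 n.+1); [exact: (it_h hi)|exact: fn].
rewrite -addn1; apply: filM; first exact: agree_fil.
exact/(hom_fil (Theta_hom fl) U).2/H_fil.
Qed.

Fact delta_res f : is_lin f -> forall U V (k : opsub V U) (m : F U),
  sres k (delta f m) = delta f (pres k m).
Proof.
by move=> fl U V k m; rewrite /delta sresD sresN (it_res hi) (hom_res (Theta_hom fl)) (base_res hb).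
Qed.

Fact corr_lin f n : is_lin f -> (forall U (m : F U), fil n.+1 (delta f m)) ->
  is_lin (corr f n.+1).
Proof.
move=> fl fn; split=> [U V k m|U a m m'|U m].
- rewrite /corr sres_homog presZ -(delta_res fl) sresE; congr homog; congr (_ *: _).
  exact: (rat_inv_uniq (GRing.RMorphism.clone _ _ (ares O k \o aQ O U) _) _ (ltn0Sn n)).
- rewrite /corr (delta_fil2 fl fn) scalerDr homogD !homogZ -scale_scal; congr (_ + _).
  by rewrite !scalerA mulrC.
- exact/filW/fil_homog.
Qed.

Fact euler_corr f n U (m : F U) : euler (corr f n.+1 m) = hpart n.+1 (delta f m).
Proof. by rewrite /corr euler_homog homogZ scalerMnl -mulr_natr natr_inv scale1r. Qed.

Fact approx_spec n : is_lin (approx n) /\ forall U (m : F U), fil n.+1 (delta (approx n) m).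
Proof.
elim: n => [|n [al an]].
  have z := @lin_zero X O F F; split=> // U m.
  by apply: filB; [exact: tau_fil|exact/(hom_fil (Theta_hom z) U).2/H_fil].
have cl := corr_lin al an.
have sl : is_lin (approx n.+1).
  split=> [U V k m|U a m m'|U m] /=.
  - by rewrite sresD (lin_res al) (lin_res cl).
  - by rewrite (linP al) (linP cl) mulrDr addrACA.
  - by apply: filD; exact: lin_fil.
split=> // U m.
have ddiff V (m' : F V) : fil n.+1 (approx n.+1 m' - approx n m').
  by rewrite /= addrAC subrr add0r; exact: fil_homog.
have dT := Theta_diff sl al ddiff.
have -> : delta (approx n.+1) m =
    (delta (approx n) m - hpart n.+1 (delta (approx n) m)) -
    (Theta (approx n.+1) (H m - vy m) - Theta (approx n) (H m - vy m)).
  rewrite (filteredB (hom_fil (Theta_hom sl) U)) (filteredB (hom_fil (Theta_hom al) U)).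
  rewrite !Theta_y // [approx n.+1 m]/(_ + _) (euler_filtered F U).1 euler_corr.
  exact: subr_telescope.
(* The two maps Theta differ by n degrees and [H m - vy m] starts in degree 2, so the correction
   disturbs nothing below degree n + 2. *)
apply: filB; last by rewrite -add2n; exact: dT (base_H hb m).
move=> k; rewrite ltnS leq_eqVlt => /predU1P[->|kn].
  by rewrite Salg_D Salg_N /hpart homog_id subrr.
by rewrite Salg_D Salg_N an // /hpart homog_neq ?subr0 // neq_ltn kn orbT.
Qed.

Let al n : is_lin (approx n) := (approx_spec n).1.

Fact approx_fil n k U (m : F U) : (n <= k)%N -> fil n.+1 (approx k m - approx n m).
Proof.
elim: k => [|k IHk]; first by rewrite leqn0 => /eqP ->; rewrite subrr; exact: fil0.
rewrite leq_eqVlt => /predU1P[->|]; first by rewrite subrr; exact: fil0.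
rewrite ltnS => nk /=; rewrite addrAC; apply: filD; first exact: IHk.
by apply: (@filW _ _ _ n.+1 k.+1) => //; exact: fil_homog.
Qed.

(** The diagonal is the limit, as the component of degree [k] no longer changes after step [k]. *)
Definition approx_lim U (m : F U) : A1 U := fun k => approx k m k.

Fact approx_lim_fil n U (m : F U) : fil n.+1 (approx_lim m - approx n m).
Proof.
move=> k; rewrite ltnS => kn; have := approx_fil m kn (ltnSn k).
by rewrite !Salg_D !Salg_N => /eqP; rewrite subr_eq0 => /eqP ->; rewrite subrr.
Qed.

Fact approx_lim_lin : is_lin approx_lim.
Proof.
split=> [U V k m|U a m m'|U m].
- by apply: Salg_ext => n; rewrite sresE /approx_lim -(lin_res (al n)).
- apply: Salg_ext => n; rewrite -scale_scal Salg_D Salg_Z /approx_lim.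
  by rewrite (linP (al n)) -scale_scal Salg_D Salg_Z.
- by rewrite -[approx_lim m]subr0; exact: (@approx_lim_fil 0 U m).
Qed.

Fact approx_lim_delta n U (m : F U) : fil n (tau m - Theta approx_lim (H m)).
Proof.
have -> : tau m - Theta approx_lim (H m) =
    delta (approx n) m - (Theta approx_lim (H m) - Theta (approx n) (H m)).
  by rewrite opprB addrA subrK.
apply: filB; first exact: filW ((approx_spec n).2 U m).
exact/(@filW _ _ _ n (1 + n))/(Theta_diff approx_lim_lin (al n) (@approx_lim_fil n))/H_fil.
Qed.

Lemma iterated_equiv : exists f : forall U, F U -> A1 U,
  [/\ is_lin f, forall U m, fil 2 (f U m - deg1 m) & forall U a, h' a = phi f (h a) :> A1 U].
Proof.
exists approx_lim; split=> [|U m|U a]; first exact: approx_lim_lin.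
- apply: euler_fil.
    have /(_ 0%N isT) := lin_fil approx_lim_lin m; rewrite Salg_D Salg_N => ->.
    by rewrite (fil_deg1 m (ltn0Sn 0)) subrr.
  rewrite (filteredB (euler_filtered F U)) euler_deg1 -(Theta_y approx_lim_lin).
  (* In the limit Theta(H(m)) = tau(m), so E(f(m)) has the same linear term as tau(m), up to the
     image of the higher terms of H. *)
  have -> : Theta approx_lim (vy m) - deg1 m = (tau m - deg1 m) - (tau m - Theta approx_lim (H m))
      - Theta approx_lim (H m - vy m).
    rewrite (filteredB (hom_fil (Theta_hom approx_lim_lin) U)) !opprB.
    by rewrite [tau m - deg1 m + _]addrC subrKA [RHS]addrC subrKA.
  apply: filB; last exact/(hom_fil (Theta_hom approx_lim_lin) U).2/(base_H hb).
  by apply: filB; [exact: (it_1 hi)|exact: approx_lim_delta].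
- apply/eqP; rewrite -subr_eq0; apply/eqP/fil_eq0 => n.
  by apply: agree_fil; [exact: approx_lim_lin|exact: approx_lim_delta].
Qed.

End Recursion.
End Compare.

Lemma hpartM (X : topologicalType) (O : algSheaf X) (E : modSheaf O) n
    (U : opens X) (u v : Salg E U) :
  hpart n (u * v) = \sum_(i < n.+1) hpart i u * hpart (n - i) v.
Proof. exact: hpart_smul. Qed.

Lemma otimesZr (A : comPzRingType) (M N : lmodType A) a (m : M) (n : N) :
  otimes m (a *: n) = a *: otimes m n.
Proof.
have scal0 : otimes m (0 : N) = 0.
  have := otimesDr 1 m (0 : N) 0; rewrite scaler0 addr0 scale1r => /(canLR (addrK _)).
  by rewrite subrr.
by rewrite -[a *: n]addr0 otimesDr scal0 addr0.
Qed.

(** * The theorem *)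

Section RtoS.
Variables (X : topologicalType) (O : algSheaf X) (F : modSheaf O).
Implicit Types (U V : opens X).

Lemma R1Z U a (m : F U) : R1 (a *: m) = a *: R1 m.
Proof.
have el := @eta_lin _ _ (otimespre (Spow F 0) F) U.
by rewrite /R1 /otimesS otimesZr (semilinearZ _ _ el).
Qed.

Lemma R_to_S_pres i U V (h : opsub V U) (x : Rpow F i.+1 U) :
  pres h (R_to_S x) = R_to_S (pres h x).
Proof. exact: shlift_res (@R_to_S_res _ _ F i) _ _ _ _. Qed.

Fact R_to_S_pre_lin i U : Defs.semilinear (M' := Spow F i.+1 U) idfun
  (fun x : otimespre (Spow F i) F U => plift idfun (@R_to_S_pre _ _ F i U) x).
Proof.
by move=> a x y; rewrite (pliftD (@R_to_S_rel _ _ F i U)) (pliftZ (@R_to_S_rel _ _ F i U)).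
Qed.

Lemma R_to_S_lin i U : Defs.semilinear idfun (@R_to_S _ _ F i U).
Proof. exact: shlift_lin (@R_to_S_res _ _ F i) (@R_to_S_pre_lin i) U. Qed.

(** On generators this is associativity, (s m s') m' = (s m)(s' m'). *)
Lemma R_to_S_mul i j n (e : (i.+1 + j.+1 = n.+1)%N) U (x : Rpow F i.+1 U) (y : Rpow F j.+1 U) :
  R_to_S (Rmul e x y) = Smul e (R_to_S x) (R_to_S y).
Proof.
have Rres V W (k : opsub W V) (p : otimespre (Spow F i) F V) (q : otimespre (Spow F j) F V) :
    pres k (Defs.eta (Rmul_pre (Rmul_deg e) p q : otimespre (Spow F n) F V)) =
    Defs.eta (Rmul_pre (Rmul_deg e) (pres k p) (pres k q) : otimespre (Spow F n) F W).
  by rewrite -Rmul_pre_res; exact: eta_res.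
apply: sheaf_sep => z Uz.
have [V [h [p [q [Vz xp yq]]]]] := eta_loc2 x y Uz.
exists V, h; split=> //; rewrite Smul_res !R_to_S_pres xp yq.
rewrite [pres h (Rmul e x y)](_ : _ =
  Defs.eta (Rmul_pre (Rmul_deg e) p q : otimespre (Spow F n) F V)); last first.
  exact: (shlift2P (G := Rpow F n.+1) Rres xp yq).
rewrite /R_to_S !(shlift_eta (@R_to_S_res _ _ F _)) {xp yq}.
have L k := @R_to_S_pre_lin k V.
elim/pmod_ind: p => [|p p' Hp Hp'|a p Hp|[s m]].
- rewrite (semilinear0 (Rmul_pre_linl _ q)) !(semilinear0 (L _)).
  by rewrite (semilinear0 (Smul_linl _ _)).
- rewrite (semilinearD (Rmul_pre_linl _ q)) !(semilinearD (L _)) Hp Hp'.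
  by rewrite (semilinearD (Smul_linl _ _)).
- rewrite (semilinearZ _ _ (Rmul_pre_linl _ q)) !(semilinearZ _ _ (L _)) Hp.
  by rewrite (semilinearZ _ _ (Smul_linl _ _)).
elim/pmod_ind: q => [|p p' Hp Hp'|a p Hp|[s' m']].
- rewrite (semilinear0 (Rmul_pre_linr _ _)) !(semilinear0 (L _)).
  by rewrite (semilinear0 (Smul_linr _ _)).
- rewrite (semilinearD (Rmul_pre_linr _ _)) !(semilinearD (L _)) Hp Hp'.
  by rewrite (semilinearD (Smul_linr _ _)).
- rewrite (semilinearZ _ _ (Rmul_pre_linr _ _)) !(semilinearZ _ _ (L _)) Hp.
  by rewrite (semilinearZ _ _ (Smul_linr _ _)).
rewrite -![pgen _ _]/(otimes _ _) Rmul_pre_otimes !(plift_gen (@R_to_S_rel _ _ F _ V)).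
by rewrite /R_to_S_pre /= (SmulA _ _ (addn1 j) e).
Qed.

End RtoS.

(** * From Hasse derivations to automorphisms, and uniqueness *)

Section Main.
Variables (X : topologicalType) (OB OX : algSheaf X) (iota : algMor OB OX) (F : modSheaf OX).
Implicit Types (U V : opens X).

Lemma B_linearD (M N : modSheaf OX) (f : forall U, M U -> N U) U :
  B_linear iota f -> {morph f U : m m' / m + m'}.
Proof. by move=> [_ fl] m m'; have := fl U 1 m m'; rewrite rmorph1 !scale1r. Qed.

Lemma derivation_derF (D : forall U, OX U -> F U) : derivation iota D -> is_derF D.
Proof.
move=> [DB DM]; split=> [U V h a|U a b|U a b]; first exact: DB.1.
  exact: (@B_linearD (selfMod OX) F D U DB a b).
exact: DM.
Qed.

Lemma connection_flatconn (D : forall U, OX U -> F U) (g : forall U, F U -> Tpow F 2 U) :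
  connection iota D g -> flat D g -> is_flatconn D g.
Proof.
move=> [gB gZ] gf; split=> [U V h m|U a m m'|U a]; [exact: gB.1| |exact: gf].
by rewrite (B_linearD gB) gZ.
Qed.

(** The index shift puts T_i in degree i + 1. The value 0 in degree 0 makes the last term of the
    Cauchy product with h(a) vanish. *)
Definition sym_part (T : forall U, F U -> Rprod F U) U (m : F U) : Salg F U :=
  fun n => if n is i.+1 then R_to_S (T U m i) else 0.

(** Once (1/j) T_{j-1} D(a) is recognized as h_j(a), the recursion defining an extended connection
    is the Cauchy product for tau(a m) = h(a) tau(m). *)
Lemma iterated_iter (D : forall U, OX U -> F U) (h : forall U, OX U -> Salg F U)
    (T : forall U, F U -> Rprod F U) :
  hasse_derivation iota h -> ext_connection iota D T ->
  (forall i U (a : OX U), h U a i.+1 = R_to_S (aQ OX U (i.+1%:R^-1) *: T U (D U a) i)) ->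
  is_iter D h (sym_part T).
Proof.
move=> [hB h1 hM h0] [TB T0 TM] hT.
have RZ i U a (x : Rpow F i.+1 U) : R_to_S (a *: x) = a *: R_to_S x.
  exact: (semilinearZ _ _ (@R_to_S_lin _ _ F i U)).
have RD i U : {morph @R_to_S _ _ F i U : x y / x + y}.
  exact: (semilinearD (@R_to_S_lin _ _ F i U)).
have R0 i U : R_to_S (0 : Rpow F i.+1 U) = 0.
  exact: (semilinear0 (@R_to_S_lin _ _ F i U)).
have tau1 U (m : F U) : sym_part T m 1%N = S1 m.
  by rewrite /= T0 /R1 R_to_S_otimes Smul1.
split=> [U V k m|U a m m'|U a|U m|U a].
- apply: Salg_ext => -[|i]; first exact: pres0.
  transitivity (pres k (R_to_S (T U m i))) => //; rewrite R_to_S_pres.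
  have /(congr1 (fun t : Rprod F V => t i)) E0 := TB.1 U V k m.
  by rewrite [RHS]/(R_to_S (T V (pres k m) i)) -E0.
- have -> : sym_part T (a *: m + m') = sym_part T (a *: m) + sym_part T m'.
    apply: Salg_ext => -[|i]; rewrite Salg_D /= ?addr0 // (B_linearD TB); exact: RD.
  congr (_ + _); apply: hpartP => -[|i].
    by rewrite hpartM big_ord1 /hpart /= homog0 mulr0.
  (* The first summand carries h_0(a) = a and the last one tau in degree 0, which is zero; the [i]
     in between match the sum in [ext_connection]. *)
  rewrite hpartM big_ord_recl big_ord_recr /= subn0 subnn.
  rewrite [hpart 0 (sym_part T m)](_ : _ = 0) ?mulr0 ?addr0; last by rewrite /hpart /= homog0.
  rewrite [hpart 0 (h U a)](_ : _ = scal F a); last by rewrite /hpart h0 scal_homog.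
  (* The recursion is stated for positive [i]; for [i = 0] the sum is empty and the claim is
     linearity of [R1]. *)
  have Tam : T U (a *: m) i = a *: T U m i +
      \sum_(j < i) aQ OX U (j.+1%:R^-1) *:
        Rmul (ext_deg j) (T U (D U a) j) (T U m (i - j.+1)%N).
    case: i => [|i]; last exact: TM.
    by rewrite big_ord0 addr0 !T0 R1Z.
  rewrite /hpart /= Tam RD RZ homogD homogZ scale_scal; congr (_ + _).
  rewrite (big_morph _ (@RD i U) (@R0 i U)) homog_sum; apply: eq_bigr => j _.
  rewrite RZ R_to_S_mul homogZ -(homogM (ext_deg j)) -Salg_scaleAl -homogZ -RZ -hT /=.
  congr (_ * _); rewrite -[LHS]/(hpart (i - j.+1).+1 (sym_part T m)).
  by rewrite subnSK // -[RHS]/(hpart (i - j) (sym_part T m)).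
- apply: Salg_ext => -[|i]; rewrite /euler ?mulr0n //.
  by rewrite hT RZ -scaler_nat scalerA mulrC natr_inv scale1r.
- move=> [|[|]] // _; rewrite Salg_D Salg_N; first by rewrite (fil_deg1 m) // subr0.
  by rewrite tau1 /deg1 homog_id subrr.
- by move=> [|] // _; rewrite Salg_D Salg_N h0 scal_homog homog_id subrr.
Qed.
Lemma phi_equivalence (h h' : forall U, OX U -> Salg F U) (f : forall U, F U -> Salg F U) :
  is_lin f -> (forall U m, fil 2 (f U m - deg1 m)) ->
  (forall U a, h' U a = phi f (h U a)) -> equivalence_of h h' (phi f).
Proof.
move=> fl f1 hh; have ph := phi_hom fl; have pf U := hom_fil ph U.
have pZ U a (u : Salg F U) : phi f (a *: u) = a *: phi f u.
  by rewrite !scale_scal (hom_M ph) (hom_scal ph).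
have pN U p (u : Salg F U) : fil p u -> fil p.+1 (phi f u - u).
  rewrite -addn1; apply: (hom_shift ph (@hom_id _ _ F)) => V m.
  by rewrite phi_deg1.
split=> //.
  split=> [||U u v|U].
  - split=> [U V k u|U a u v]; first exact: (hom_res ph).
    by rewrite [LHS](pf U).1 pZ.
  - by move=> U; exact: (hom1 U ph).
  - exact: (hom_M ph).
  - exact: unipotent_bij (pf U) (pN U).
(* The part from degree [p] to degree [n] is the [n]-th component of phi on homogeneous elements; by
   filtration only [p <= n] contributes. *)
exists (fun p n U s => phi f (homog s) n); split=> [p n pn|U w n|U m].
- split=> [U V k s|U a s t].
    by rewrite -sres_homog -(hom_res ph).
  by rewrite homog_lin (pf U).1 pZ.
- rewrite [LHS](filtered_trunc (pf U)) /trunc (filtered_sum (pf U)) Salg_sum.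
  by apply: eq_bigr.
- rewrite -/(deg1 m) phi_deg1 //; have := f1 U m 1%N (ltnSn 1).
  by rewrite Salg_D Salg_N /deg1 homog_id => /eqP; rewrite subr_eq0 => /eqP.
Qed.

(** The decomposition into parts of nonnegative degree provides the compatibility with the
    filtration, after which generators determine the automorphism. *)
Lemma equivalence_hom (h h' : forall U, OX U -> Salg F U) (p : forall U, Salg F U -> Salg F U) :
  equivalence_of h h' p -> is_hom p.
Proof.
move=> [[[pnat pl] p1 pM _] [q [ql qE q1]] _].
have pD U : {morph p U : u v / u + v}.
  by move=> u v; have := pl U 1 u v; rewrite !scale1r.
split=> [U V k w|U|U|U a].
- exact: pnat.
- split=> // n u un k kn; rewrite qE big1 // => i _.
  have ik : (i <= k)%N by rewrite -ltnS.
  rewrite un; last exact: leq_ltn_trans kn.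
  have := (ql i k ik).2 U 1 0 0; rewrite scaler0 addr0 scale1r.
  by move=> /(canLR (addrK _)); rewrite subrr.
- exact: pM.
have := pl U a (1 : Salg F U) 0; rewrite addr0 /scal => ->.
have p0 : p U 0 = 0 by apply: (addrI (p U 0)); rewrite -pD !addr0.
by rewrite p0 addr0; congr (_ *: _); exact: p1.
Qed.

Lemma equivalence_unique (D : forall U, OX U -> F U) (h h' : forall U, OX U -> Salg F U)
    (p p' : forall U, Salg F U -> Salg F U) :
  (forall nu : forall U, F U -> Sprod F U,
    O_linear nu -> (exists U m, nu U m <> 0) -> exists U a, nu U (D U a) <> 0) ->
  hasse_derivation iota h -> hasse_extends D h ->
  equivalence_of h h' p -> equivalence_of h h' p' -> p = p'.
Proof.
move=> Dnu [hB _ _ h0] h1 pe pe'; have ph := equivalence_hom pe; have ph' := equivalence_hom pe'.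
have hfil U a : fil 2 (h U a - (scal F a + deg1 (D U a))).
  move=> [|[|]] // _; rewrite Salg_D Salg_N Salg_D.
    by rewrite h0 scal_homog homog_id (fil_deg1 (D U a)) // addr0 subrr.
  by rewrite h1 scal_homog homog_neq // /deg1 homog_id add0r subrr.
(* [p - p'] raises degrees by [n] and vanishes on [h a], which is [a] plus [D a] up to degree 2;
   scalars cancel, so the difference at [D a] gains one degree over the general bound. *)
have pD n U a : (forall V (m : F V), fil n.+1 (p V (deg1 m) - p' V (deg1 m))) ->
    fil n.+2 (p U (deg1 (D U a)) - p' U (deg1 (D U a))).
  move=> Hn; have E0 : p U (h U a) = p' U (h U a) by case: pe pe' => [_ _ <-] [_ _ <-].
  have := hom_shift ph ph' Hn (hfil U a); rewrite add2n.
  rewrite (filteredB (hom_fil ph U)) (filteredB (hom_fil ph' U)) E0.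
  rewrite (hom_fil ph U).1 (hom_fil ph' U).1 (hom_scal ph) (hom_scal ph').
  rewrite opprB addrC subrKA [scal F a + _]addrC addrKA => H.
  by rewrite -opprB; apply: filN.
have step n : (forall V (m : F V), fil n.+1 (p V (deg1 m) - p' V (deg1 m))) ->
    forall V (m : F V), fil n.+2 (p V (deg1 m) - p' V (deg1 m)).
  move=> Hn.
  pose nu U (m : F U) : Sprod F U := hpart n.+1 (p U (deg1 m) - p' U (deg1 m)).
  have nul : O_linear nu.
    split=> [U V k m|U a m m'].
      transitivity (sres k (hpart n.+1 (p U (deg1 m) - p' U (deg1 m)))) => //.
      rewrite /hpart sres_homog; congr homog.
      by rewrite -sresE sresD sresN (hom_res ph) (hom_res ph') sres_deg1.
    rewrite /nu deg1_lin (hom_fil ph U).1 (hom_fil ph' U).1.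
    rewrite (hom_M ph) (hom_M ph') (hom_scal ph) (hom_scal ph').
    by rewrite opprD addrACA -mulrBr -scale_scal; exact: homog_lin.
  have nu0 V (m : F V) : nu V m = 0.
    apply: contrapT => H; have [|U [a]] := Dnu nu nul; first by exists V, m.
    by apply; rewrite /nu /hpart (pD n U a Hn) // homog0.
  move=> V m; apply: filS; first exact: Hn.
  have := congr1 (fun w : Salg F V => w n.+1) (nu0 V m).
  by rewrite /nu /hpart homog_id.
have all n V (m : F V) : fil n.+1 (p V (deg1 m) - p' V (deg1 m)).
  elim: n V m => [|n IHn] V m; last exact: step.
  by apply: filB; [apply: (hom_fil ph V).2|apply: (hom_fil ph' V).2]; exact: fil_deg1.
apply: functional_extensionality_dep => U; apply/funext => u.
apply: (hom_eq ph ph') => V m; apply/eqP; rewrite -subr_eq0; apply/eqP/fil_eq0 => n.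
exact: filW (all n V m).
Qed.

End Main.

Theorem corollary4p3 (X : topologicalType) (OB OX : algSheaf X)
    (iota : algMor OB OX) (F : modSheaf OX) (D : forall U, OX U -> F U)
    (D_der : derivation iota D)
    (h h' : forall U, OX U -> Sprod F U)
    (h_hasse : hasse_derivation iota h) (h_ext : hasse_extends D h)
    (h_iter : hasse_iterated iota D h)
    (h'_hasse : hasse_derivation iota h') (h'_ext : hasse_extends D h')
    (h'_iter : hasse_iterated iota D h')
    (D_int : integrable iota D) :
  hasse_equivalent h h' /\
  ((forall nu : forall U, F U -> Sprod F U,
      O_linear nu -> (exists U m, nu U m <> 0) ->
      exists U a, nu U (D U a) <> 0) ->
   canonically_equivalent h h').
Proof.
have [g [gc gf]] := D_int; have [T Tc hT] := h_iter; have [T' Tc' hT'] := h'_iter.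
have b0 := exp_base (derivation_derF D_der) (connection_flatconn gc gf).
have [f0 [f0l f01 hf0]] := iterated_equiv b0 (iterated_iter h_hasse Tc hT).
(* Being the image of the exponential, [h] is itself a base, so [h'] is compared with it directly
   and no inverse automorphism is needed. *)
have b1 := base_phi f0l f01 b0.
have [f [fl f1 hf]] := iterated_equiv b1 (iterated_iter h'_hasse Tc' hT').
have eq_f : equivalence_of h h' (phi f).
  by apply: phi_equivalence => // U a; rewrite hf -hf0.
split=> [|Dnu]; first by exists (phi f).
exists (phi f); split=> // p' p'e.
exact: equivalence_unique Dnu h_hasse h_ext eq_f p'e.
Qed.
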